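(* Let $K$ be an algebraically closed field, let $I\subset K[[s_1,\dots,s_N]]$ be a proper ideal, $A=K[[s_1,\dots,s_N]]/I$ with maximal ideal $\mathfrak m_A$, and let $F\in K[[s_1,\dots,s_N,x,y]]$ be such that $f:=F \bmod \langle s_1,\dots,s_N\rangle\in K[[x,y]]$ is a square-free power series in $\langle x,y\rangle$, $f\neq 0$. Thus $F$ defines a deformation over $A$, with trivial section, of the reduced plane algebroid curve singularity $C=\{f=0\}$. Assume that either $\operatorname{char}(K)=0$ or $\operatorname{char}(K)>\operatorname{ord}(f)$. Then there exists an ideal $ES(F)\subset A$ such that (i) the deformation over $A/ES(F)$ induced by $F$ is equisingular along the trivial section, and (ii) for each ideal $J\subset A$ such that the deformation over $A/J$ induced by $F$ is equisingular along the trivial section, one has $ES(F)\subset J$; and there is an algorithm which, given $F$ and $I$, returns a set of generators of $ES(F)$.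
   Context: $\operatorname{ord}(g)$ denotes the order (multiplicity) of a power series $g\in K[[x,y]]$ with respect to $\langle x,y\rangle$. For an ideal $J\subset A$, the deformation over $B=A/J$ induced by $F$ is given by the image of $F$ in $B[[x,y]]$. Let $B$ be a complete local Noetherian $K$-algebra with maximal ideal $\mathfrak m_B$ and $B/\mathfrak m_B=K$. A deformation of $\{f=0\}$ over $B$ is given by a power series $F\in B[[x,y]]$ with $F \bmod \mathfrak m_B=f$. A section $\sigma$ of it is given by a pair $(a,b)\in\mathfrak m_B\times\mathfrak m_B$ with $F\in I_\sigma:=\langle x-a,y-b\rangle$; the trivial section is $(a,b)=(0,0)$. The deformation is *equimultiple along $\sigma$* if $F\in I_\sigma^{\,n}$, where $n=\operatorname{ord}(f)$. *Equisingularity along $\sigma$* is defined by induction on the number of blowing ups needed to get a reduced total transform of $\{f=0\}$ having only nodal singularities: (1) If $\{f=0\}$ is smooth or a node (in suitable coordinates $f$ is $xy$ up to a unit), the deformation is equisingular along $\sigma$ iff it is equimultiple along $\sigma$. (2) Otherwise, it is equisingular along $\sigma$ iff it is equimultiple along $\sigma$ and, after blowing up $\sigma$, there exist sections through the infinitely near points of $\{f=0\}$ in the first neighbourhood such that the respective reduced total transforms are equisingular along these sections. Explicitly, translate coordinates so that $\sigma$ is trivial. For each tangent direction $y=\bar a x$ of $f$ (that is, each linear factor $y-\bar a x$, $\bar a\in K$, of the lowest-degree form of $f$) the reduced total transform at the corresponding point is the deformation of $\{x\cdot f(x,x(y+\bar a))/x^n=0\}$ given by $x\cdot F(x,x(y+\bar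 a))/x^n$; if $x$ divides the lowest-degree form of $f$, the reduced total transform at the point corresponding to the tangent $x=0$ is the deformation of $\{y\cdot f(xy,y)/y^n=0\}$ given by $y\cdot F(xy,y)/y^n$. The requirement is that for each of these points there exists a section along which the corresponding deformation is equisingular. *)

(* Defs.v *)
From HB Require Import structures.
From mathcomp Require Import all_boot all_order all_algebra.
From mathcomp Require Import ring_quotient boolp.
From mathcomp Require Import mpoly.

Set Implicit Arguments.
Unset Strict Implicit.
Unset Printing Implicit Defensive.

Import GRing.Theory.

Local Open Scope ring_scope.
Local Open Scope quotient_scope.

(* Formal power series R[[x_1, ..., x_n]], as coefficient families indexed by *)
(* the monomials 'X_{1..n} of multinomials.                                   *)

Record mpser (R : Type) (n : nat) : Type := MPSer { sercoef :> 'X_{1..n} -> R }.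

Lemma mpserP (R : Type) (n : nat) (F G : mpser R n) :
  (forall m, F m = G m) -> F = G.
Proof. by case: F G => [F] [G] /= FG; congr MPSer; apply: funext. Qed.

HB.instance Definition _ (R : Type) (n : nat) := gen_eqMixin (mpser R n).
HB.instance Definition _ (R : Type) (n : nat) := gen_choiceMixin (mpser R n).

Section SeriesRing.
Variables (R : comNzRingType) (n : nat).
Implicit Types F G H : mpser R n.

Definition ser_const (c : R) : mpser R n := MPSer (fun m => c *+ (m == 0%MM)).
Definition ser_var (i : 'I_n) : mpser R n := MPSer (fun m => (m == U_(i)%MM)%:R).

Definition ser_add F G : mpser R n := MPSer (fun m => F m + G m).
Definition ser_opp F : mpser R n := MPSer (fun m => - F m).

(* The bounds only serve to make the index type {(k1, k2) | k1 + k2 = m}      *)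
(* finite.                                                                    *)
Definition ser_mul F G : mpser R n := MPSer (fun m =>
  \sum_(k : 'X_{1..n < (mdeg m).+1, (mdeg m).+1} | m == (k.1 + k.2)%MM)
     F k.1 * G k.2).

Let trunc d F : {mpoly R[n]} := \sum_(k : 'X_{1..n < d}) F k *: 'X_[k].

Let truncE d F m : (mdeg m < d)%N -> (trunc d F)@_m = F m.
Proof. exact: mcoeff_mpoly. Qed.

Let eq_mcoeffM (p p' q q' : {mpoly R[n]}) m :
  (forall k, (mdeg k <= mdeg m)%N -> p@_k = p'@_k) ->
  (forall k, (mdeg k <= mdeg m)%N -> q@_k = q'@_k) ->
  (p * q)@_m = (p' * q')@_m.
Proof.
move=> pp qq; rewrite !mcoeffM; apply: eq_bigr => -[[k1 k1m] [k2 k2m]] _ /=.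
by rewrite pp // qq.
Qed.

Let ser_mulE d F G m : (mdeg m < d)%N ->
  ser_mul F G m = (trunc d F * trunc d G)@_m.
Proof.
move=> ltmd; rewrite mcoeffM /=; apply: eq_bigr => -[[k1 k1m] [k2 k2m]] _ /=.
by rewrite !truncE // (leq_trans _ ltmd).
Qed.

Let ser_addA : associative ser_add.
Proof. by move=> F G H; apply: mpserP => m /=; rewrite addrA. Qed.

Let ser_addC : commutative ser_add.
Proof. by move=> F G; apply: mpserP => m /=; rewrite addrC. Qed.

Let ser_add0 : left_id (ser_const 0) ser_add.
Proof. by move=> F; apply: mpserP => m /=; rewrite mul0rn add0r. Qed.

Let ser_addN : left_inverse (ser_const 0) ser_opp ser_add.
Proof. by move=> F; apply: mpserP => m /=; rewrite mul0rn addNr. Qed.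

HB.instance Definition _ :=
  GRing.isZmodule.Build (mpser R n) ser_addA ser_addC ser_add0 ser_addN.

Let ser_mulC : commutative ser_mul.
Proof.
by move=> F G; apply: mpserP => m; rewrite !(ser_mulE _ _ (ltnSn _)) mulrC.
Qed.

Let ser_mulA : associative ser_mul.
Proof.
move=> F G H; apply: mpserP => m; set d := (mdeg m).+1.
have Td F' G' k : (mdeg k <= mdeg m)%N ->
    (trunc d (ser_mul F' G'))@_k = (trunc d F' * trunc d G')@_k.
  by move=> km; rewrite truncE // (ser_mulE _ _ (_ : (mdeg k < d)%N)).
rewrite !(ser_mulE _ _ (ltnSn _)) -/d.
transitivity ((trunc d F * (trunc d G * trunc d H))@_m).
  by apply: eq_mcoeffM => // k km; rewrite Td.
by rewrite mulrA; apply: eq_mcoeffM => // k km; rewrite Td.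
Qed.

Let trunc_const d c m : (mdeg m < d)%N -> (trunc d (ser_const c))@_m = c%:MP@_m.
Proof.
move=> md; rewrite truncE // mcoeffC /= eq_sym.
by case: eqP; rewrite ?mulr1 ?mulr0.
Qed.

Let ser_mul1 : left_id (ser_const 1) ser_mul.
Proof.
move=> F; apply: mpserP => m; rewrite (ser_mulE _ _ (ltnSn _)).
transitivity ((1%:MP * trunc (mdeg m).+1 F)@_m); last by rewrite mul1r truncE.
by apply: eq_mcoeffM => // k km; rewrite trunc_const.
Qed.

Let ser_mulDl : left_distributive ser_mul +%R.
Proof.
move=> F G H; apply: mpserP => m /=; rewrite -big_split /=.
by apply: eq_bigr => k _; rewrite mulrDl.
Qed.

Let ser1_neq0 : ser_const 1 != 0.
Proof.
by apply/eqP => /(congr1 (fun F : mpser R n => F 0%MM))/eqP /=; rewrite eqxx mul0rn oner_eq0.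
Qed.

HB.instance Definition _ := GRing.Zmodule_isComNzRing.Build (mpser R n)
  ser_mulA ser_mulC ser_mul1 ser_mulDl ser1_neq0.

Let ser_const_additive : {morph ser_const : c d / c - d}.
Proof. by move=> c d; apply: mpserP => m /=; rewrite mulrnBl. Qed.

Let ser_const_multiplicative : monoid_morphism ser_const.
Proof.
split=> // c d; apply: mpserP => m; rewrite (ser_mulE _ _ (ltnSn _)).
have -> : ser_const (c * d) m = (c%:MP * d%:MP : {mpoly R[n]})@_m.
  by rewrite -mpolyCM mcoeffC /= eq_sym; case: eqP; rewrite ?mulr1 ?mulr0.
by apply: eq_mcoeffM => k km; rewrite trunc_const.
Qed.

HB.instance Definition _ :=
  GRing.isZmodMorphism.Build R (mpser R n) ser_const ser_const_additive.
HB.instance Definition _ :=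
  GRing.isMonoidMorphism.Build R (mpser R n) ser_const ser_const_multiplicative.

End SeriesRing.

Definition map_ser (R S : Type) (n : nat) (u : R -> S) (F : mpser R n) : mpser S n :=
  MPSer (fun m => u (F m)).

Definition serX (R : comNzRingType) : mpser R 2 := ser_var R 0.
Definition serY (R : comNzRingType) : mpser R 2 := ser_var R 1.

(* K[[s_1, ..., s_N, x, y]] read as K[[s]][[x, y]]: the coefficient of        *)
(* s^a x^i y^j becomes the coefficient at a of that of x^i y^j.               *)
Definition ser_split (K : Type) (N : nat) (F : mpser K (N + 2)) :
    mpser (mpser K N) 2 :=
  MPSer (fun m => MPSer (fun a => F [multinom of cat_tuple a m])).

(* F mod <s_1, ..., s_N>.                                                     *)
Definition ser_special (K : Type) (N : nat) (F : mpser K (N + 2)) : mpser K 2 :=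
  MPSer (fun m => ser_split F m 0%MM).

Section Ideals.
Variable R : comNzRingType.

Definition ideal_gen (S : R -> Prop) (z : R) : Prop :=
  exists2 l : seq (R * R), (forall p, p \in l -> S p.2) &
    z = \sum_(p <- l) p.1 * p.2.

Definition ideal_pow (I : R -> Prop) (n : nat) : R -> Prop :=
  ideal_gen (fun z => exists2 t : 'I_n -> R,
    (forall i, I (t i)) & z = \prod_(i < n) t i).

Definition ideal2 (u v : R) : R -> Prop := ideal_gen (fun z => z = u \/ z = v).

Definition divides (u v : R) : Prop := exists w, v = u * w.
Definition is_unit (u : R) : Prop := divides u 1.
Definition square_free (u : R) : Prop :=
  forall v, divides (v ^+ 2) u -> is_unit v.

(* This is the maximal ideal when R is a local ring.                          *)
Definition max_ideal (z : R) : Prop := ~ is_unit z.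

Definition adic_limit (u : nat -> R) (l : R) : Prop :=
  forall t, exists k0, forall k, (k0 <= k)%N ->
    ideal_pow max_ideal t (l - u k).

End Ideals.

(* H = F(g, h), for R complete local and g, h in the maximal ideal of         *)
(* R[[x, y]]: limit of the partial sums for the topology of the complete      *)
(* local ring R[[x, y]].  The constants of g and h need not vanish, only lie  *)
(* in the maximal ideal of R.                                                 *)
Definition is_subst (R : comNzRingType) (F g h H : mpser R 2) : Prop :=
  adic_limit (fun k => \sum_(m : 'X_{1..2 < k})
    ser_const 2 (F m) * g ^+ m 0 * h ^+ m 1) H.

Section PlaneCurve.
Variable K : closedFieldType.
Implicit Types f g : mpser K 2.

Definition is_ord f (n : nat) : Prop :=
  (forall m, (mdeg m < n)%N -> f m = 0) /\ exists2 m, mdeg m = n & f m != 0.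

(* The order of f, with junk value 0 at f = 0.                                *)
Definition ord f : nat :=
  if pselect (exists n, `[< is_ord f n >]) is left fn then ex_minn fn else 0.

Definition init_form f : mpser K 2 :=
  MPSer (fun m => if mdeg m == ord f then f m else 0).

Definition smooth f : Prop := ord f = 1%N.

(* (u, v) is a system of coordinates of K[[x, y]] iff it generates <x, y>.    *)
Definition node f : Prop := exists u v e : mpser K 2,
  [/\ (forall z, ideal2 u v z <-> ideal2 (serX K) (serY K) z),
      is_unit e & f = e * u * v].

Definition tangent_slope f (c : K) : Prop :=
  divides (serY K - ser_const 2 c * serX K) (init_form f).
Definition tangent_vertical f : Prop := divides (serX K) (init_form f).

End PlaneCurve.

(* G = x F(x, x(y + c)) / x^n, resp. G = y F(xy, y) / y^n.                    *)
Definition total_transform_slope (R : comNzRingType) (n : nat) (c : R)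
    (F G : mpser R 2) : Prop :=
  exists2 H, is_subst F (serX R) (serX R * (serY R + ser_const 2 c)) H &
    serX R ^+ n * G = serX R * H.
Definition total_transform_vertical (R : comNzRingType) (n : nat)
    (F G : mpser R 2) : Prop :=
  exists2 H, is_subst F (serX R * serY R) (serY R) H &
    serY R ^+ n * G = serY R * H.

(* Here B is meant to be a complete local Noetherian K-algebra with residue   *)
(* field K and structure map iota.                                            *)
Section Equisingular.
Variables (K : closedFieldType) (B : comNzRingType) (iota : {rmorphism K -> B}).

Definition is_deformation (f : mpser K 2) (F : mpser B 2) : Prop :=
  forall m, max_ideal (F m - iota (f m)).

Definition section_ideal (a b : B) : mpser B 2 -> Prop :=
  ideal2 (serX B - ser_const 2 a) (serY B - ser_const 2 b).

Definition is_section (F : mpser B 2) (a b : B) : Prop :=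
  [/\ max_ideal a, max_ideal b & section_ideal a b F].

Definition equimultiple (f : mpser K 2) (F : mpser B 2) (a b : B) : Prop :=
  ideal_pow (section_ideal a b) (ord f) F.

(* The deformation F of {f = 0} is equisingular along the section (a, b).     *)
(* The least fixed point encodes the induction on the number of blowing ups.  *)
(* F' is F in coordinates in which the section is trivial.                    *)
Inductive equisingular :
    mpser K 2 -> mpser B 2 -> B -> B -> Prop :=
| EquisingularBase f F a b of
    smooth f \/ node f & is_deformation f F & is_section F a b &
    equimultiple f F a b :
    equisingular f F a b
| EquisingularBlowup f F a b F' of
    ~ (smooth f \/ node f) & is_deformation f F & is_section F a b &
    equimultiple f F a b &
    is_subst F (serX B + ser_const 2 a) (serY B + ser_const 2 b) F' &
    (forall c, tangent_slope f c -> exists g G a' b',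
      [/\ total_transform_slope (ord f) c f g,
          total_transform_slope (ord f) (iota c) F' G &
          equisingular g G a' b']) &
    (tangent_vertical f -> exists g G a' b',
      [/\ total_transform_vertical (ord f) f g,
          total_transform_vertical (ord f) F' G &
          equisingular g G a' b']) :
    equisingular f F a b.

End Equisingular.

(* The ring K[[s]] / I, its structure map, and the deformation over it        *)
(* induced by F.                                                              *)
Section Quotients.
Variables (K : closedFieldType) (N : nat) (I : idealr (mpser K N)).

Definition base_ring : comNzRingType := {ideal_quot I}.

Definition base_proj : {rmorphism mpser K N -> base_ring} :=
  \pi_{ideal_quot I}.

Variable J : idealr base_ring.

Definition quot_ring : comNzRingType := {ideal_quot J}.

Definition quot_proj : {rmorphism base_ring -> quot_ring} :=
  \pi_{ideal_quot J}.

Definition quot_const : {rmorphism K -> quot_ring} :=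
  quot_proj \o (base_proj \o @ser_const K N).

Definition induced (F : mpser K (N + 2)) : mpser quot_ring 2 :=
  map_ser (fun c => quot_proj (base_proj c)) (ser_split F).

Definition equisingular_mod (F : mpser K (N + 2)) : Prop :=
  equisingular quot_const (ser_special F) (induced F) 0 0.

End Quotients.

(* Model of computation: while programs over binary trees whose leaves are    *)
(* elements of K or nil.  Programs use exact field arithmetic, equality tests *)
(* and root extraction in K, and they read their power series arguments one   *)
(* coefficient at a time.                                                     *)

Inductive tree (K : Type) : Type :=
| Nil
| Atom of K
| Cons of tree K & tree K.
Arguments Nil {K}.

Inductive prog : Type :=
| PId | PNil | PHead | PTail
| PCons of prog & prog
| PSeq of prog & prog
| PIf of prog & prog & prog
| PWhile of prog & prog
| POne | PAdd | POpp | PMul | PInv | PEq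
| PRoot
| PCoef.

Section Semantics.
Variable K : fieldType.
Implicit Types u v w : tree K.

Fixpoint enc_nat (k : nat) : tree K :=
  if k is k'.+1 then Cons Nil (enc_nat k') else Nil.

Fixpoint enc_seq (T : Type) (enc : T -> tree K) (s : seq T) : tree K :=
  if s is x :: s' then Cons (enc x) (enc_seq enc s') else Nil.

Definition head v : tree K := if v is Cons u _ then u else Nil.
Definition tail v : tree K := if v is Cons _ u then u else Nil.
Definition truthy v : bool := if v is Nil then false else true.

(* A root selector; programs must work for each of them, so that no           *)
(* information is hidden in the choice of a root.                             *)
Definition root_finder (rt : {poly K} -> K) : Prop :=
  forall p : {poly K}, size p != 1%N -> root p (rt p).

Variables (rt : {poly K} -> K) (input : nat -> seq nat -> K).

(* exec p v w: on argument v the program p halts with result w.               *)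
Inductive exec : prog -> tree K -> tree K -> Prop :=
| ExecId v : exec PId v v
| ExecNil v : exec PNil v Nil
| ExecHead v : exec PHead v (head v)
| ExecTail v : exec PTail v (tail v)
| ExecCons p q v u w of exec p v u & exec q v w : exec (PCons p q) v (Cons u w)
| ExecSeq p q v u w of exec p v u & exec q u w : exec (PSeq p q) v w
| ExecIfTrue t p q v u w of exec t v u & truthy u & exec p v w :
    exec (PIf t p q) v w
| ExecIfFalse t p q v u w of exec t v u & ~~ truthy u & exec q v w :
    exec (PIf t p q) v w
| ExecWhileStop t p v u of exec t v u & ~~ truthy u : exec (PWhile t p) v v
| ExecWhileStep t p v u v' w of exec t v u & truthy u & exec p v v' &
    exec (PWhile t p) v' w : exec (PWhile t p) v w
| ExecOne v : exec POne v (Atom 1)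
| ExecAdd a b : exec PAdd (Cons (Atom a) (Atom b)) (Atom (a + b))
| ExecOpp a : exec POpp (Atom a) (Atom (- a))
| ExecMul a b : exec PMul (Cons (Atom a) (Atom b)) (Atom (a * b))
| ExecInv a : exec PInv (Atom a) (Atom a^-1)
| ExecEq a b :
    exec PEq (Cons (Atom a) (Atom b)) (if a == b then Cons Nil Nil else Nil)
| ExecRoot (s : seq K) : exec PRoot (enc_seq (@Atom K) s) (Atom (rt (Poly s)))
| ExecCoef k e :
    exec PCoef (Cons (enc_nat k) (enc_seq enc_nat e)) (Atom (input k e)).

End Semantics.

(* The coefficient of F at the exponent sequence e, 0 if size e <> n.         *)
Definition coef_at (K : fieldType) (n : nat) (F : mpser K n) (e : seq nat) : K :=
  if insub e is Some t then F [multinom t] else 0.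

(* Power series number 0 is F, number j.+1 is the j-th generator of I.        *)
Definition series_input (K : fieldType) (N : nat) (F : mpser K (N + 2))
    (gs : seq (mpser K N)) (k : nat) (e : seq nat) : K :=
  if k is j.+1 then coef_at (nth 0 gs j) e else coef_at F e.

(* An algorithm returning a finite list of power series: one program computes *)
(* the length of the list, the other one the coefficient with a given         *)
(* exponent of the member with a given index.                                 *)
Record algorithm : Type := Algorithm { alg_size : prog; alg_coef : prog }.

Definition returns (K : fieldType) (rt : {poly K} -> K) (P : algorithm) (N : nat)
    (F : mpser K (N + 2)) (gs hs : seq (mpser K N)) : Prop :=
  let run := exec rt (series_input F gs) in
  let dims := Cons (enc_nat K N) (enc_nat K (size gs)) in
  run (alg_size P) dims (enc_nat K (size hs)) /\
  forall (i : nat) (a : 'X_{1..N}), (i < size hs)%N ->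
    run (alg_coef P) (Cons dims (Cons (enc_nat K i) (enc_seq (enc_nat K) a)))
        (Atom (nth 0 hs i a)).

Definition generates (R : comNzRingType) (gs : seq R) (I : idealr R) : Prop :=
  forall z, z \in I <-> ideal_gen (fun g => g \in gs) z.

(* Main.v *)
Require Import Defs.
From HB Require Import structures.
From mathcomp Require Import all_boot all_order all_algebra.
From mathcomp Require Import ring_quotient.
From mathcomp Require Import boolp.
From mathcomp Require Import zify ring.
From mathcomp Require Import mpoly.

(* Let R = K[[s]].  All deformations are lifted to R[[x, y]], where blowing ups
   and translations act linearly on coefficient families; since ideals of R are
   closed, a family over R/J is equimultiple along the trivial section iff J
   contains the coefficients of low order of its lift.

   The sections through the infinitely near points are forced.  At a crossing of
   two exceptional curves it is the crossing point.  Otherwise it moves along the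
   exceptional curve x = 0, say; if the residual curve has contact k with it,
   equisingularity modulo J forces J to contain the coefficient of x y^(k-1) in
   coordinates along the section.  As k <= ord f is invertible, Newton iteration
   produces over R a unique section with this coefficient equal to 0, and every
   section that is equisingular modulo J agrees with it modulo J.  Hence a single
   tree of lifted blowing ups serves all J, and ES(F) is generated by the
   coefficients of low order at its vertices.

   The tree is finite: as f is square-free and ord f! is invertible, powers of x
   and y lie in the ideal (f, f_x, f_y).  For a strict transform h with
   exceptional curves E, some monomial in the equations of E remains in
   (h, h_x, h_y), and its exponents (or, at a crossing, the contact of h with one
   axis) drop as long as the order of h does not.

   The shape of the tree only depends on f, so it can be explored with exact
   arithmetic in K.  A coefficient of a generator is computed modulo a power of
   the maximal ideal, where finitely many Newton steps suffice. *)

Set Implicit Arguments.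
Unset Strict Implicit.
Unset Printing Implicit Defensive.

Import GRing.Theory.

Local Open Scope ring_scope.

(** * Formal power series *)

(** The definition of equisingularity chooses sections over each quotient separately, so a priori
    different ideals [J] lead to different families at later points; the proof must remove this
    choice. That a section stays on an exceptional curve is not part of the definition, and
    equimultiplicity at one point does not give it. It is obtained by following the curve through
    all later points: the restriction of the total transform to the curve is controlled modulo two
    nested ideals [D] and [C] with [m C] inside [D]. For [C = J + (a)] and [D = J + m a], where [a]
    is the transversal coordinate of the section, Nakayama's lemma then puts [a] in [J]. Closedness
    of ideals lets membership in [J] be tested on limits, without a theory of complete Noetherian
    quotients. *)

Section Order.
Variables (A : comNzRingType) (n : nat).
Implicit Types F G H : mpser A n.

Lemma serD F G m : (F + G) m = F m + G m. Proof. by []. Qed.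
Lemma serN F m : (- F) m = - F m. Proof. by []. Qed.
Lemma serB F G m : (F - G) m = F m - G m. Proof. by []. Qed.
Lemma ser0 m : (0 : mpser A n) m = 0. Proof. by rewrite /= mul0rn. Qed.
Lemma ser1 m : (1 : mpser A n) m = (m == 0%MM)%:R. Proof. by []. Qed.

Lemma ser_sum I (r : seq I) (P : pred I) (f : I -> mpser A n) m :
  (\sum_(i <- r | P i) f i) m = \sum_(i <- r | P i) f i m.
Proof. by elim/big_rec2: _ => [|i y x _ <-] //; rewrite ser0. Qed.

Lemma serME F G m :
  (F * G) m = \sum_(k : 'X_{1..n < (mdeg m).+1} | (k <= m)%MM) F k * G (m - k)%MM.
Proof.
transitivity (\sum_(k : 'X_{1..n < (mdeg m).+1, (mdeg m).+1}
   | m == (k.1 + k.2)%MM) F k.1 * G k.2); first by [].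
rewrite -(pair_big_dep xpredT (fun (i j : 'X_{1..n < (mdeg m).+1}) => m == (i + j)%MM)
  (fun i j => F i * G j)) /=.
rewrite (bigID (fun k : 'X_{1..n < (mdeg m).+1} => (k <= m)%MM)) /= [X in _ + X]big1 ?addr0.
  apply: eq_bigr => k km.
  have md : (mdeg (m - k)%MM < (mdeg m).+1)%N by rewrite ltnS mdegB.
  rewrite (big_pred1 (BMultinom md)) // => l.
  rewrite [RHS]bmeqP /= -(eqm_add2l k l) eq_sym.
  by rewrite [(k + (m - k))%MM]addmC submK.
move=> k nkm; rewrite big_pred0 // => l; apply/negbTE/eqP => e.
by case/negP: nkm; rewrite [X in (_ <= X)%MM]e lem_addr.
Qed.

Lemma serM0 F G : (F * G) 0%MM = F 0%MM * G 0%MM.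
Proof.
rewrite serME (big_pred1 (bm0 : 'X_{1..n < (mdeg (0%MM : 'X_{1..n})).+1})) ?subm0 // => k.
rewrite [RHS]bmeqP /=; apply/idP/eqP => [/mnm_lepP h|->]; last by apply/mnm_lepP.
by apply/mnmP => i; move: (h i); rewrite mnm0E; case: (_ i).
Qed.

Lemma ser_constE (c : A) m : ser_const n c m = c *+ (m == 0%MM). Proof. by []. Qed.

Definition mono (e : 'X_{1..n}) : mpser A n := MPSer (fun m => (m == e)%:R).

Lemma serMmono e F m : (mono e * F) m = if (e <= m)%MM then F (m - e)%MM else 0.
Proof.
rewrite serME; case: ifP => em.
  have md : (mdeg e < (mdeg m).+1)%N.
    by rewrite ltnS -(submK em) mdegD leq_addl.
  rewrite (bigD1 (BMultinom md)) //= eqxx mul1r big1 ?addr0 // => k /andP[_].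
  by rewrite bmeqP /= => /negbTE ->; rewrite mul0r.
rewrite big1 // => k km /=; case: eqP => [ek|]; last by rewrite mul0r.
by rewrite -ek km in em.
Qed.

Lemma serMconst c F m : (ser_const n c * F) m = c * F m.
Proof.
rewrite serME (bigD1 bm0) /= ?lem0 //; last by apply/mnm_lepP => i; rewrite mnm0E.
rewrite eqxx mulr1n subm0 big1 ?addr0 // => k /andP[_].
by rewrite bmeqP /= => /negbTE ->; rewrite mulr0n mul0r.
Qed.

Lemma mono0 : mono 0%MM = 1. Proof. exact: mpserP. Qed.

Lemma monoD e1 e2 : mono (e1 + e2)%MM = mono e1 * mono e2.
Proof.
apply: mpserP => m; rewrite serMmono /=.
case: ifP => [h|/negbT h].
  by rewrite -(eqm_add2r e1 (m - e1)%MM e2) submK // addmC.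
by case: eqP => // e; rewrite e lem_addr in h.
Qed.

(** This is membership in the t-th power of the ideal generated by the variables. Convergence is
    phrased with it throughout, so that the order of 0 needs no convention. *)
Definition ordge (t : nat) F : Prop := forall m, (mdeg m < t)%N -> F m = 0.

Lemma ordge0 t : ordge t 0. Proof. by move=> m _; rewrite ser0. Qed.
Lemma ordge_0 F : ordge 0 F. Proof. by []. Qed.
Lemma ordgeD t F G : ordge t F -> ordge t G -> ordge t (F + G).
Proof. by move=> hF hG m mt; rewrite serD hF // hG // addr0. Qed.
Lemma ordgeN t F : ordge t F -> ordge t (- F).
Proof. by move=> hF m mt; rewrite serN hF // oppr0. Qed.
Lemma ordgeB t F G : ordge t F -> ordge t G -> ordge t (F - G).
Proof. by move=> hF hG; apply: ordgeD => //; apply: ordgeN. Qed.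
Lemma ordge_sum t I (r : seq I) (P : pred I) (f : I -> mpser A n) :
  (forall i, P i -> ordge t (f i)) -> ordge t (\sum_(i <- r | P i) f i).
Proof. by move=> h; elim/big_rec: _ => [|i x Pi]; [exact: ordge0|exact/ordgeD/h]. Qed.
Lemma ordge_le s t F : (s <= t)%N -> ordge t F -> ordge s F.
Proof. by move=> st hF m ms; apply: hF; apply: leq_trans st. Qed.

Lemma ordgeM s t F G : ordge s F -> ordge t G -> ordge (s + t) (F * G).
Proof.
move=> hF hG m mst; rewrite serME big1 // => k km.
have [ks|sk] := ltnP (mdeg k) s; first by rewrite hF ?mul0r.
rewrite [G _]hG ?mulr0 // -(ltn_add2l (mdeg k)) -mdegD addmC submK //.
by apply: leq_trans mst _; rewrite leq_add2r.
Qed.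

Lemma ordgeMl t F G : ordge t G -> ordge t (F * G).
Proof. by move=> h; rewrite -[t]add0n; apply: ordgeM. Qed.
Lemma ordgeMr t F G : ordge t F -> ordge t (F * G).
Proof. by rewrite mulrC; apply: ordgeMl. Qed.
Lemma ordgeX t F k : ordge t F -> ordge (k * t) (F ^+ k).
Proof. by move=> h; elim: k => [//|k IH]; rewrite exprS mulSn; apply: ordgeM. Qed.

Lemma ordgeP F : (forall t, ordge t F) -> F = 0.
Proof. by move=> h; apply: mpserP => m; rewrite ser0 (h (mdeg m).+1). Qed.

Lemma ordge1P F : ordge 1 F <-> F 0%MM = 0.
Proof.
split=> [h|h m]; first by apply: h; rewrite mdeg0.
by rewrite ltnS leqn0 mdeg_eq0 => /eqP ->.
Qed.

Lemma ordge_sub_const F : ordge 1 (F - ser_const n (F 0%MM)).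
Proof. by apply/ordge1P; rewrite serB /= eqxx subrr. Qed.

Definition contraction (T : mpser A n -> mpser A n) : Prop :=
  forall t F G, ordge t (F - G) -> ordge t.+1 (T F - T G).

(** For a contraction, coefficients of degree [mdeg m] are stable after [mdeg m + 1] iterations, so
    the limit can be read off coefficient by coefficient. *)
Definition ser_fix (T : mpser A n -> mpser A n) : mpser A n :=
  MPSer (fun m => iter (mdeg m).+1 T 0 m).

Lemma iter_contraction T k l : contraction T -> (k <= l)%N ->
  ordge k (iter l T 0 - iter k T 0).
Proof.
move=> hT; elim: k l => [//|k IH] [//|l] kl.
exact: hT (IH _ kl).
Qed.

Lemma ser_fix_iter T k : contraction T -> ordge k (ser_fix T - iter k T 0).
Proof.
move=> hT m mk; rewrite serB [ser_fix T m]/=.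
have := iter_contraction hT mk => /(_ m (ltnSn _)).
by rewrite serB => /eqP; rewrite subr_eq0 eq_sym => /eqP ->; rewrite subrr.
Qed.

Lemma ser_fixP T : contraction T -> T (ser_fix T) = ser_fix T.
Proof.
move=> hT; apply/subr0_eq/ordgeP => t.
have -> : T (ser_fix T) - ser_fix T =
   (T (ser_fix T) - T (iter t T 0)) - (ser_fix T - iter t.+1 T 0).
  by rewrite iterS; ring.
apply: ordgeB; last exact: (ordge_le (leqnSn t) (@ser_fix_iter _ t.+1 hT)).
exact: (ordge_le (leqnSn t) (hT _ _ _ (@ser_fix_iter _ t hT))).
Qed.

(** With [c] the constant part of [F], the inverse is the fixed point of [W -> u (1 - (F - c) W)], a
    contraction because [F - c] has no constant term. *)
Lemma ser_inv (F : mpser A n) (u : A) : F 0%MM * u = 1 -> exists G, F * G = 1.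
Proof.
move=> Fu; pose c := ser_const n (F 0%MM).
pose T (W : mpser A n) := ser_const n u * (1 - (F - c) * W).
have hT : contraction T.
  move=> t W W' h; rewrite /T -mulrBr.
  have -> : 1 - (F - c) * W - (1 - (F - c) * W') = - ((F - c) * (W - W')) by ring.
  by apply: ordgeMl; apply: ordgeN; rewrite -add1n; apply: ordgeM => //; apply: ordge_sub_const.
pose W := ser_fix T; exists W.
have e : c * W = 1 - (F - c) * W.
  rewrite {1}/W -(ser_fixP hT) -/W /T mulrA -[c * _]rmorphM /= Fu.
  by rewrite [ser_const n 1]rmorph1 mul1r.
by rewrite -[F in LHS](subrK c) mulrDl e addrC subrK.
Qed.

End Order.
Arguments mono {A n} e.

Section MapSer.
Variables (A B : comNzRingType) (u : {rmorphism A -> B}) (n : nat).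

Lemma map_serE (F : mpser A n) m : map_ser u F m = u (F m). Proof. by []. Qed.
Lemma map_serD : {morph (@map_ser A B n u) : F G / F + G}.
Proof. by move=> F G; apply: mpserP => m; rewrite /= rmorphD. Qed.
Lemma map_serM : {morph (@map_ser A B n u) : F G / F * G}.
Proof.
move=> F G; apply: mpserP => m; rewrite map_serE !serME rmorph_sum.
by apply: eq_bigr => k _; rewrite rmorphM.
Qed.
Lemma map_ser1 : @map_ser A B n u 1 = 1.
Proof. by apply: mpserP => m; rewrite map_serE !ser1 rmorph_nat. Qed.
Lemma map_ser_mono e : @map_ser A B n u (mono e) = mono e.
Proof. by apply: mpserP => m; rewrite /= rmorph_nat. Qed.
Lemma map_ser_const c : map_ser u (ser_const n c) = ser_const n (u c).
Proof. by apply: mpserP => m; rewrite /= rmorphMn. Qed.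
End MapSer.

Section Two.
Variable A : comNzRingType.
Implicit Types F G H : mpser A 2.

Definition mn (i j : nat) : 'X_{1..2} := [multinom [tuple i; j]].
Definition cf F (i j : nat) : A := F (mn i j).
Definition mk (g : nat -> nat -> A) : mpser A 2 := MPSer (fun m => g (m 0) (m 1)).

Lemma mn0 i j : mn i j 0 = i. Proof. by []. Qed.
Lemma mn1 i j : mn i j 1 = j. Proof. by []. Qed.
Lemma mnE (m : 'X_{1..2}) : m = mn (m 0) (m 1).
Proof.
apply/mnmP => -[[|[|//]] h]; [rewrite [RHS]/=|rewrite [RHS]/=].
  by rewrite (_ : Ordinal h = 0%R) //; apply: val_inj.
by rewrite (_ : Ordinal h = 1%R) //; apply: val_inj.
Qed.
Lemma mn_eq i j k l : (mn i j == mn k l) = (i == k) && (j == l).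
Proof.
apply/eqP/andP => [e|[/eqP -> /eqP -> //]].
by rewrite -(mn0 i j) -{2}(mn1 i j) e mn0 mn1 !eqxx.
Qed.
Lemma mn00 : mn 0 0 = 0%MM.
Proof. by rewrite [RHS]mnE !mnm0E. Qed.
Lemma mdeg_mn i j : mdeg (mn i j) = (i + j)%N.
Proof. by rewrite /mdeg /= big_cons big_seq1. Qed.
Lemma mdeg2 (m : 'X_{1..2}) : mdeg m = (m 0%R + m 1%R)%N.
Proof. by rewrite {1}[m]mnE mdeg_mn. Qed.
Lemma le_mn i j (m : 'X_{1..2}) : (mn i j <= m)%MM = (i <= m 0%R)%N && (j <= m 1%R)%N.
Proof.
apply/mnm_lepP/andP => [h|[h1 h2] k]; first by split; [exact: (h 0%R)|exact: (h 1%R)].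
case: k => -[|[|//]] h; first by rewrite (_ : Ordinal h = 0%R) //; apply: val_inj.
by rewrite (_ : Ordinal h = 1%R) //; apply: val_inj.
Qed.
Lemma sub_mn i j k l : (mn i j - mn k l)%MM = mn (i - k) (j - l).
Proof. by rewrite [LHS]mnE !mnmBE !mn0 !mn1. Qed.
Lemma add_mn i j k l : (mn i j + mn k l)%MM = mn (i + k) (j + l).
Proof. by rewrite [LHS]mnE !mnmDE !mn0 !mn1. Qed.

Lemma cfE F m : F m = cf F (m 0) (m 1). Proof. by rewrite /cf -mnE. Qed.
Lemma cf_mk g i j : cf (mk g) i j = g i j. Proof. by []. Qed.
Lemma cfP F G : (forall i j, cf F i j = cf G i j) -> F = G.
Proof. by move=> h; apply: mpserP => m; rewrite !cfE. Qed.
Lemma cfD F G i j : cf (F + G) i j = cf F i j + cf G i j. Proof. by []. Qed.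
Lemma cfB F G i j : cf (F - G) i j = cf F i j - cf G i j. Proof. by []. Qed.
Lemma cf0 i j : cf 0 i j = 0. Proof. exact: ser0. Qed.
Lemma cf_sum I (r : seq I) (P : pred I) (f : I -> mpser A 2) i j :
  cf (\sum_(k <- r | P k) f k) i j = \sum_(k <- r | P k) cf (f k) i j.
Proof. exact: ser_sum. Qed.
Lemma cf_constM c F i j : cf (ser_const 2 c * F) i j = c * cf F i j.
Proof. exact: serMconst. Qed.
Lemma cf_const c i j : cf (ser_const 2 c) i j = c *+ ((i == 0%N) && (j == 0%N)).
Proof. by rewrite /cf /= -mn00 mn_eq. Qed.
Lemma cf1 i j : cf 1 i j = ((i == 0%N) && (j == 0%N))%:R.
Proof. by rewrite /cf ser1 -mn00 mn_eq. Qed.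
Lemma cf_mono a b i j : cf (mono (mn a b)) i j = ((i == a) && (j == b))%:R.
Proof. by rewrite /cf /= mn_eq. Qed.
Lemma cf_monoM a b F i j : cf (mono (mn a b) * F) i j =
  if (a <= i)%N && (b <= j)%N then cf F (i - a) (j - b) else 0.
Proof. by rewrite /cf serMmono le_mn mn0 mn1 sub_mn. Qed.

Lemma cfM F G i j : cf (F * G) i j =
  \sum_(a < i.+1) \sum_(b < j.+1) cf F a b * cf G (i - a) (j - b).
Proof.
rewrite {1}/cf serME pair_big /=.
have hd (p : 'I_i.+1 * 'I_j.+1) : (mdeg (mn p.1 p.2) < (mdeg (mn i j)).+1)%N.
  by rewrite !mdeg_mn ltnS leq_add // -ltnS.
pose h p := BMultinom (hd p).
rewrite (reindex h) /=.
  apply: eq_big => [[a b]|[a b] _] /=.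
    by rewrite le_mn mn0 mn1 !leq_ord.
  by rewrite sub_mn.
exists (fun k : 'X_{1..2 < (mdeg (mn i j)).+1} => (inord (k 0%R) : 'I_i.+1, inord (k 1%R) : 'I_j.+1)).
  move=> [a b] _ /=; congr (_, _); apply: val_inj; rewrite /= inordK ?mn0 ?mn1 //.
move=> k; rewrite inE [bmnm k]mnE le_mn !mn0 !mn1 => /andP[h1 h2].
by apply: val_inj; rewrite /= !inordK ?ltnS // -mnE.
Qed.

Lemma ordge2P t F : ordge t F <-> forall i j, (i + j < t)%N -> cf F i j = 0.
Proof.
split=> h; first by move=> i j ij; apply: h; rewrite mdeg_mn.
by move=> m mt; rewrite cfE h // -mdeg2.
Qed.

Lemma serX_mono : serX A = mono (mn 1 0).
Proof. by apply: cfP => i j; rewrite /cf /=; congr (_ == _)%:R; rewrite [LHS]mnE !mnm1E. Qed.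
Lemma serY_mono : serY A = mono (mn 0 1).
Proof. by apply: cfP => i j; rewrite /cf /=; congr (_ == _)%:R; rewrite [LHS]mnE !mnm1E. Qed.
Lemma monoXY a b : serX A ^+ a * serY A ^+ b = mono (mn a b).
Proof.
have X k : serX A ^+ k = mono (mn k 0).
  elim: k => [|k IH]; first by rewrite mn00 mono0.
  by rewrite exprS IH serX_mono -monoD add_mn.
have Y k : serY A ^+ k = mono (mn 0 k).
  elim: k => [|k IH]; first by rewrite mn00 mono0.
  by rewrite exprS IH serY_mono -monoD add_mn.
by rewrite X Y -monoD add_mn addn0.
Qed.
Lemma cf_XnM k F i j : cf (serX A ^+ k * F) i j = if (k <= i)%N then cf F (i - k) j else 0.
Proof. by rewrite -[_ ^+ k]mulr1 -(expr0 (serY A)) monoXY cf_monoM /= andbT subn0. Qed.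
Lemma cf_YnM k F i j : cf (serY A ^+ k * F) i j = if (k <= j)%N then cf F i (j - k) else 0.
Proof. by rewrite -[_ ^+ k]mul1r -(expr0 (serX A)) monoXY cf_monoM /= subn0. Qed.
Lemma cf_XM F i j : cf (serX A * F) i j = if i is i'.+1 then cf F i' j else 0.
Proof. by rewrite -[serX A]expr1 cf_XnM; case: i => // i; rewrite subn1. Qed.
Lemma cf_YM F i j : cf (serY A * F) i j = if j is j'.+1 then cf F i j' else 0.
Proof. by rewrite -[serY A]expr1 cf_YnM; case: j => // j; rewrite subn1. Qed.
Lemma serXn_inj k F G : serX A ^+ k * F = serX A ^+ k * G -> F = G.
Proof.
move=> e; apply: cfP => i j; have := congr1 (fun H => cf H (i + k) j) e.
by rewrite !cf_XnM leq_addl addnK.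
Qed.
Lemma serYn_inj k F G : serY A ^+ k * F = serY A ^+ k * G -> F = G.
Proof.
move=> e; apply: cfP => i j; have := congr1 (fun H => cf H i (j + k)) e.
by rewrite !cf_YnM leq_addl addnK.
Qed.
End Two.

(** * Ideals of power series rings are closed *)

Section IdealTheory.
Variable R : comNzRingType.
Implicit Types (P Q S : R -> Prop) (x y z : R).

Record is_ideal P : Prop := IsIdeal {
  ideal0 : P 0;
  idealD : forall x y, P x -> P y -> P (x + y);
  idealM : forall x y, P y -> P (x * y) }.

Lemma idealN P x : is_ideal P -> P x -> P (- x).
Proof. by move=> hP Px; rewrite -mulN1r; apply: idealM. Qed.
Lemma idealB P x y : is_ideal P -> P x -> P y -> P (x - y).
Proof. by move=> hP Px Py; apply: idealD => //; apply: idealN. Qed.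
Lemma ideal_mulr P x y : is_ideal P -> P x -> P (x * y).
Proof. by move=> hP Px; rewrite mulrC; apply: idealM. Qed.
Lemma ideal_sum P I (r : seq I) (p : pred I) (f : I -> R) :
  is_ideal P -> (forall i, p i -> P (f i)) -> P (\sum_(i <- r | p i) f i).
Proof.
move=> hP h; elim/big_rec: _ => [|i x pi]; first exact: ideal0.
by apply: idealD => //; apply: h.
Qed.
Lemma idealDr P x y : is_ideal P -> P y -> P (x + y) <-> P x.
Proof.
move=> hP Py; split=> [h|h]; last exact: idealD.
by rewrite -[x](addrK y); apply: idealB.
Qed.

Lemma ideal_gen_ideal S : is_ideal (ideal_gen S).
Proof.
split.
- by exists [::] => //; rewrite big_nil.
- move=> x y [l hl ->] [k hk ->]; exists (l ++ k); last by rewrite big_cat.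
  by move=> p; rewrite mem_cat => /orP[/hl|/hk].
- move=> x y [l hl ->]; exists [seq (x * p.1, p.2) | p <- l].
    by move=> p /mapP[q /hl ? ->].
  by rewrite big_map mulr_sumr; apply: eq_bigr => p _; rewrite mulrA.
Qed.

Lemma ideal_gen_sub S x : S x -> ideal_gen S x.
Proof.
move=> Sx; exists [:: (1, x)]; last by rewrite big_seq1 mul1r.
by move=> p; rewrite inE => /eqP ->.
Qed.

Lemma ideal_gen_min P S : is_ideal P -> (forall x, S x -> P x) ->
  forall x, ideal_gen S x -> P x.
Proof.
move=> hP SP _ [l hl ->]; rewrite big_seq; apply: ideal_sum => // p /hl /SP.
exact: idealM.
Qed.

Lemma ideal2P u v z : ideal2 u v z <-> exists a b, z = a * u + b * v.
Proof.
split=> [|[a [b ->]]]; last first.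
  by apply: (idealD (ideal_gen_ideal _)); apply: (idealM (ideal_gen_ideal _));
    apply: ideal_gen_sub; auto.
apply: (@ideal_gen_min (fun z => exists a b, z = a * u + b * v)); last first.
  by move=> x [->|->]; [exists 1, 0|exists 0, 1]; ring.
split; first by exists 0, 0; ring.
  by move=> x y [a [b ->]] [c [d ->]]; exists (a + c), (b + d); ring.
by move=> x y [a [b ->]]; exists (x * a), (x * b); ring.
Qed.

Lemma ideal_pow_ideal S t : is_ideal (ideal_pow S t).
Proof. exact: ideal_gen_ideal. Qed.

Lemma ideal_pow0 S z : ideal_pow S 0 z.
Proof.
rewrite -[z]mulr1; apply: (idealM (ideal_pow_ideal _ _)); apply: ideal_gen_sub.
by exists (fun _ => 1); [case|rewrite big_ord0].
Qed.

Lemma ideal_powS S t x z : S x -> ideal_pow S t z -> ideal_pow S t.+1 (x * z).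
Proof.
move=> Sx; apply: (@ideal_gen_min (fun z => ideal_pow S t.+1 (x * z))).
  have h := ideal_pow_ideal S t.+1; split; first by rewrite mulr0; apply: ideal0.
    by move=> a b; rewrite mulrDr; apply: idealD.
  by move=> a b; rewrite mulrCA; apply: idealM.
move=> _ [s hs ->]; apply: ideal_gen_sub.
exists (fun i => if unlift ord0 i is Some j then s j else x).
  by move=> i; case: unliftP.
by rewrite big_ord_recl unlift_none; congr (_ * _); apply: eq_bigr => i _; rewrite liftK.
Qed.

Lemma ideal_pow_ind (S : R -> Prop) (P : nat -> R -> Prop) :
  (forall t, is_ideal (P t)) -> (forall z, P 0 z) ->
  (forall t x z, S x -> P t z -> P t.+1 (x * z)) ->
  forall t z, ideal_pow S t z -> P t z.
Proof.
move=> hP P0 PS t; apply: ideal_gen_min => // _ [s hs ->].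
elim: t s hs => [|t IH] s hs; first by [].
by rewrite big_ord_recl; apply: PS => //; apply: IH.
Qed.

Lemma ideal_pow1 S z : is_ideal S -> ideal_pow S 1 z -> S z.
Proof.
move=> hS; apply: ideal_gen_min => // _ [s hs ->].
by rewrite big_ord1.
Qed.

Lemma ideal_pow_le S t s z : (s <= t)%N -> ideal_pow S t z -> ideal_pow S s z.
Proof.
elim: t s z => [|t IH] s z; first by rewrite leqn0 => /eqP ->.
case: s => [_ _|s st]; first exact: ideal_pow0.
apply: ideal_gen_min; first exact: ideal_pow_ideal.
move=> _ [u hu ->]; rewrite big_ord_recl; apply: ideal_powS => //.
by apply: IH => //; apply: ideal_gen_sub; exists (fun i => u (lift ord0 i)).
Qed.

End IdealTheory.

Section VarSplit.
Variables (A : comNzRingType) (n : nat).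

(** Each monomial is allotted to the first variable that occurs in it. *)
Lemma ordge_split t (F : mpser A n) : ordge t.+1 F ->
  exists2 G : 'I_n -> mpser A n, (forall i, ordge t (G i)) &
    F = \sum_i ser_var A i * G i.
Proof.
move=> hF.
pose fst (i : 'I_n) (m : 'X_{1..n}) := (m i != 0%N) && [forall j : 'I_n, (j < i)%N ==> (m j == 0%N)].
pose G i : mpser A n := MPSer (fun m => F (m + U_(i))%MM *+ fst i (m + U_(i))%MM).
exists G => [i m mt|]; first by rewrite /= hF ?mul0rn // mdegD mdeg1 addn1.
have var i : ser_var A i = mono U_(i) by [].
apply: mpserP => m; rewrite ser_sum.
have [m0|m0] := eqVneq m 0%MM.
  rewrite m0 hF ?mdeg0 // big1 // => i _.
  by rewrite var serMmono lep1mP mnm0E.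
have [i mi] : exists i, m i != 0%N.
  apply: contrapT => h; case/eqP: m0; apply/mnmP => i; rewrite mnm0E.
  by apply/eqP; apply: contrapT => /negP hi; apply: h; exists i.
have [j mj jmin] := @arg_minnP _ i (fun j => m j != 0%N) (fun j : 'I_n => nat_of_ord j) mi.
rewrite (bigD1 j) // var serMmono lep1mP mj [G j _]/= submK ?lep1mP //.
have -> : fst j m.
  rewrite /fst mj; apply/forallP => k; apply/implyP => kj.
  by apply: contraLR kj => /jmin; rewrite -leqNgt.
rewrite mulr1n big1 => [|k kj]; first by rewrite [RHS]addr0.
rewrite var serMmono lep1mP; case: ifP => // mk; rewrite [LHS]/= submK ?lep1mP //.
case: (boolP (fst k m)) => [/andP[_ /forallP /(_ j) /implyP h]|]; last by rewrite mulr0n.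
have := jmin k mk; rewrite leq_eqVlt => /orP[/eqP e|jk].
  by case/eqP: kj; apply: val_inj.
by move: (h jk); rewrite (negbTE mj).
Qed.

End VarSplit.

Section Dickson.
Variable n : nat.

(** Induction on the set [D] of coordinates in which members of [L] may differ. An exponent that is
    not above a fixed [e0] in [L] has some coordinate [i] with a value below [e0 i], so it lies in
    one of finitely many slices, on which the [i]-th coordinate is constant. *)
Lemma dickson (L : 'X_{1..n} -> Prop) : exists2 l : seq 'X_{1..n},
  (forall e, e \in l -> L e) & forall e, L e -> exists2 d, d \in l & (d <= e)%MM.
Proof.
have [k] := ubnP #|[set: 'I_n]|.
have agree : forall e e' : 'X_{1..n}, L e -> L e' -> forall i, i \notin [set: 'I_n] -> e i = e' i.
  by move=> e e' _ _ i; rewrite inE.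
elim: k [set: 'I_n] L agree => // k IH D L agree Dk.
have [[e0 Le0]|nL] := pselect (exists e, L e); last first.
  by exists [::] => // e Le; case: nL; exists e.
have /choice[f hf] : forall p : 'I_n * nat, exists l : seq 'X_{1..n}, p.1 \in D ->
    (forall e, e \in l -> L e /\ e p.1 = p.2) /\
    (forall e, L e -> e p.1 = p.2 -> exists2 d, d \in l & (d <= e)%MM).
  move=> [i v] /=; have [iD|] := boolP (i \in D); last by exists [::].
  have [||l h1 h2] := IH (D :\ i) (fun e => L e /\ e i = v).
  - move=> e e' [Le ev] [Le' ev'] j; rewrite !inE negb_and negbK.
    by case/orP => [/eqP ->|jD]; [rewrite ev ev'|exact: agree].
  - by rewrite -ltnS (leq_trans _ Dk) // ltnS [X in (_ < X)%N](cardsD1 i) iD.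
  by exists l => _; split=> [//|e Le ev]; apply: h2.
pose l := e0 :: flatten [seq flatten [seq f (i, v) | v <- iota 0 (e0 i)] | i <- enum D].
exists l => [e|e Le].
  rewrite inE => /orP[/eqP ->//|/flattenP[_ /mapP[i iD ->]]].
  rewrite mem_enum in iD.
  case/flattenP=> _ /mapP[v _ ->] ev.
  by have [/(_ e ev)[]] := hf (i, v) iD.
have [le|/mnm_lepP nle] := boolP (e0 <= e)%MM; first by exists e0; rewrite ?mem_head.
have [i hi] : exists i, (e i < e0 i)%N.
  by apply: contrapT => h; apply: nle => i; rewrite leqNgt; apply/negP => hi; apply: h; exists i.
have iD : i \in D.
  by apply: contrapT => /negP iD; move: hi; rewrite (agree _ _ Le Le0 i iD) ltnn.
have [_ /(_ e Le erefl)[d dl de]] := hf (i, e i) iD.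
exists d => //; rewrite inE; apply/orP; right; apply/flattenP.
exists (flatten [seq f (i, v) | v <- iota 0 (e0 i)]); first by apply: map_f; rewrite mem_enum.
by apply/flattenP; exists (f (i, e i)) => //; apply: map_f; rewrite mem_iota.
Qed.

End Dickson.

(** * Standard bases and the closedness of ideals of K[[s]] *)

Section Krull.
Variables (K : fieldType) (n : nat).
Local Notation R := (mpser K n).
Implicit Types r h w : R.

Lemma is_unit_ser r : is_unit r <-> r 0%MM != 0.
Proof.
split=> [[w /(congr1 (fun z : R => z 0%MM))]|r0].
  by rewrite serM0 ser1 eqxx => e; apply/eqP => r0; move/eqP: e; rewrite r0 mul0r oner_eq0.
by have [G hG] := ser_inv (divff r0); exists G.
Qed.

Lemma max_ideal_ser r : max_ideal r <-> r 0%MM = 0.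
Proof.
rewrite /max_ideal is_unit_ser; split=> [/negP|->]; last by rewrite eqxx.
by rewrite negbK => /eqP.
Qed.

Lemma ideal_pow_max t r : ideal_pow (@max_ideal R) t r <-> ordge t r.
Proof.
split.
  apply: ideal_pow_ind => [s|//|s x z /max_ideal_ser /ordge1P hx hz].
    by split; [exact: ordge0|exact: ordgeD|move=> x y; exact: ordgeMl].
  by rewrite -add1n; apply: ordgeM.
elim: t r => [|t IH] r; first by move=> _; apply: ideal_pow0.
case/ordge_split=> G hG ->; apply: ideal_sum (ideal_pow_ideal _ _) _ => i _.
apply: ideal_powS; last exact: IH.
by apply/max_ideal_ser; rewrite /= eq_sym mnm1_eq0.
Qed.

(** Recursion along the monomial order: a coefficient of the solution is computed from those at
    strictly smaller monomials. Contractions for the degree do not suffice, as tails of a basis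
    element may have the degree of its leading monomial. *)
Lemma wf_fix (T : R -> R) :
  (forall w w' m, (forall k, (k < m)%O -> w k = w' k) -> T w m = T w' m) ->
  exists w, T w = w.
Proof.
move=> hT.
pose F m (rec : forall k, (k < m)%O -> K) : K :=
  T (MPSer (fun k => if pselect ((k < m)%O : Prop) is left h then rec k h else 0)) m.
pose f := Fix (@ltom_wf n) (fun _ => K) F.
have fE m : f m = F m (fun k _ => f k).
  apply: (Fix_eq _ (fun _ => K)) => k g g' gg'.
  by congr (T (MPSer _) k); apply: funext => j; case: pselect.
exists (MPSer f); apply: mpserP => m; rewrite [RHS]/= fE /F.
by apply: hT => k km /=; case: pselect.
Qed.

Definition lead r (e : 'X_{1..n}) : Prop := r e != 0 /\ forall k, (k < e)%O -> r k = 0.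

Lemma leadP r : r != 0 -> exists e, lead r e.
Proof.
move=> /eqP r0; apply: contrapT => h; apply: r0; apply: mpserP => m; rewrite ser0.
move: m; apply: ltmwf => m IH; apply/eqP; apply: contrapT => /negP rm.
by apply: h; exists m.
Qed.

(* Division of [h] by a standard basis of [J]: the leading exponent of the
   remainder is not divisible by those of the basis, while it is the leading
   exponent of an element of [J], since [J] meets [h + m^t] for all [t]. *)
Theorem ideal_closed (J : R -> Prop) h : is_ideal J ->
  (forall t, exists2 j, J j & ordge t (h - j)) -> J h.
Proof.
move=> hJ hh.
have [l lL lmin] := dickson (fun e => exists2 j, J j & lead j e).
pose r := size l; pose e (i : 'I_r) := nth 0%MM l i.
have /choice[g hg] : forall i : 'I_r, exists j, [/\ J j, j (e i) = 1 & forall k, (k < e i)%O -> j k = 0].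
  move=> i; have [j Jj [je jk]] := lL _ (mem_nth 0%MM (ltn_ord i)).
  exists (ser_const n (j (e i))^-1 * j); split; first exact: idealM.
    by rewrite serMconst mulVf.
  by move=> k ki; rewrite serMconst (jk k ki) mulr0.
pose div m i := (e i <= m)%MM.
pose c (m : 'X_{1..n}) : option 'I_r := [pick i | div m i].
pose Q i w : R := MPSer (fun b => if c (b + e i)%MM == Some i then w (b + e i)%MM else 0).
(* The part of [w] supported on multiples of the leading exponents is the sum of the
   [mono (e i) * Q i w]. At a fixed point of [T], removing it leaves [h - \sum_i Q i w * g i], which
   is therefore a remainder. [T w m] only reads [w] below [m] because the tails [g i - mono (e i)]
   lie strictly above [e i]. *)
pose T w : R := h - \sum_i Q i w * (g i - mono (e i)).
have [w ww'] : exists w, T w = w.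
  apply: wf_fix => w w' m ww'; rewrite /T !serB !ser_sum; congr (_ - _).
  apply: eq_bigr => i _; rewrite !serME; apply: eq_bigr => k km.
  have [lt|ge] := boolP ((k + e i)%MM < m)%O; first by rewrite [Q i w k]/= [Q i w' k]/= ww'.
  suff gm : (g i - mono (e i)) (m - k)%MM = 0 by rewrite gm !mulr0.
  have [_ g1 g0] := hg i; rewrite serB [mono _ _]/=.
  have le : ((m - k)%MM <= e i)%O.
    by rewrite -(lemc_add2r k) addmC submK // Order.TotalTheory.leNgt.
  have [->|ne] := eqVneq (m - k)%MM (e i); first by rewrite g1 subrr.
  by rewrite g0 ?subr0 // Order.POrderTheory.lt_neqAle ne.
pose q := \sum_i Q i w * g i.
have Jq : J q by apply: ideal_sum => // i _; apply: idealM => //; have [] := hg i.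
have rem m : (exists i, div m i) -> (h - q) m = 0.
  move=> dm.
  have -> : h - q = w - \sum_i mono (e i) * Q i w.
    rewrite -{1}ww' /T -addrA; congr (_ + _).
    rewrite -opprD -big_split /=; congr (- _).
    by apply: eq_bigr => i _; ring.
  rewrite serB ser_sum; apply/eqP; rewrite subr_eq0; apply/eqP.
  have [i ci di] : exists2 i, c m = Some i & div m i.
    rewrite /c; case: pickP => [i di|h0]; first by exists i.
    by have [i] := dm; rewrite h0.
  rewrite (bigD1 i) // serMmono (di : (e i <= m)%MM) [Q i w _]/= submK // ci eqxx big1 => [|k ki]; first by rewrite [RHS]addr0.
  rewrite serMmono; case: ifP => // dk; rewrite [LHS]/= submK // ci.
  by case: eqP => // -[ik]; rewrite ik eqxx in ki.
suff e0 : h - q = 0 by rewrite (subr0_eq e0).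
apply: contrapT => /eqP /leadP[m [m1 m0]].
have [j Jj jt] := hh (mdeg m).+1.
have ej k : (mdeg k <= mdeg m)%N -> (h - q) k = (j - q) k.
  by move=> km; have := jt k; rewrite ltnS => /(_ km) /eqP; rewrite !serB subr_eq0 => /eqP ->.
have [|d dl dm] := lmin m.
  exists (j - q); first exact: idealB.
  split=> [|k km]; first by rewrite -ej.
  by rewrite -ej ?m0 // lemc_mdeg // Order.POrderTheory.ltW.
case/eqP: m1; apply: rem.
have dr : (index d l < r)%N by rewrite index_mem.
by exists (Ordinal dr); rewrite /div /e nth_index.
Qed.

End Krull.

(** * Substitutions and blowing ups *)

Section Adic.
Variable S : comNzRingType.
Implicit Types (u v : nat -> S) (l x y z : S).
Local Notation pow := (ideal_pow (@max_ideal S)).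

Lemma alimD u v l x : adic_limit u l -> adic_limit v x ->
  adic_limit (fun k => u k + v k) (l + x).
Proof.
move=> hu hv t; have [a ha] := hu t; have [b hb] := hv t.
exists (maxn a b) => k; rewrite geq_max => /andP[/ha h1 /hb h2] /=.
rewrite opprD addrACA; apply: (idealD (ideal_pow_ideal _ _)) h1 h2.
Qed.

Lemma alimM u v l x : adic_limit u l -> adic_limit v x ->
  adic_limit (fun k => u k * v k) (l * x).
Proof.
move=> hu hv t; have [a ha] := hu t; have [b hb] := hv t.
exists (maxn a b) => k; rewrite geq_max => /andP[/ha h1 /hb h2] /=.
have -> : l * x - u k * v k = l * (x - v k) + v k * (l - u k) by ring.
by apply: (idealD (ideal_pow_ideal _ _)); apply: (idealM (ideal_pow_ideal _ _)).
Qed.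

Lemma alim_eq u v l : (forall t, exists k0, forall k, (k0 <= k)%N -> pow t (u k - v k)) ->
  adic_limit u l -> adic_limit v l.
Proof.
move=> huv hu t; have [a ha] := hu t; have [b hb] := huv t.
exists (maxn a b) => k; rewrite geq_max => /andP[/ha h1 /hb h2] /=.
by rewrite -[l](subrK (u k)) -addrA; apply: (idealD (ideal_pow_ideal _ _)).
Qed.

Lemma alim_uniq u l l' : (forall x, (forall t, pow t x) -> x = 0) ->
  adic_limit u l -> adic_limit u l' -> l = l'.
Proof.
move=> sep hl hl'; apply: subr0_eq; apply: sep => t.
have [a ha] := hl t; have [b hb] := hl' t.
have := idealB (ideal_pow_ideal _ _) (ha _ (leq_maxl a b)) (hb _ (leq_maxr a b)).
by rewrite opprB addrA subrK.
Qed.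

Lemma ideal_powXX g h a b : max_ideal g -> max_ideal h -> pow (a + b) (g ^+ a * h ^+ b).
Proof.
move=> hg hh; elim: a => [|a IH]; last by rewrite exprS -mulrA; apply: ideal_powS.
rewrite expr0 mul1r; elim: b => [|b IH]; first exact: ideal_pow0.
by rewrite exprS; apply: ideal_powS.
Qed.
End Adic.

Section Subst.
Variable B : comNzRingType.
Local Notation S := (mpser B 2).
Local Notation pow := (ideal_pow (@max_ideal S)).
Local Notation C := (ser_const 2).
Implicit Types F G H g h : S.

Definition psub g h k F : S := \sum_(m : 'X_{1..2 < k}) C (F m) * g ^+ m 0 * h ^+ m 1.

Lemma is_substE F g h H : is_subst F g h H = adic_limit (psub g h ^~ F) H.
Proof. by []. Qed.

Lemma psubD g h k F G : psub g h k (F + G) = psub g h k F + psub g h k G.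
Proof. by rewrite /psub -big_split; apply: eq_bigr => m _; rewrite serD rmorphD !mulrDl. Qed.

Lemma is_substD F G g h H H' : is_subst F g h H -> is_subst G g h H' ->
  is_subst (F + G) g h (H + H').
Proof.
move=> hF hG; rewrite is_substE (_ : psub g h ^~ _ = fun k => psub g h k F + psub g h k G).
  exact: alimD.
by apply: funext => k; rewrite psubD.
Qed.

Lemma psub_term g h k F (m0 : 'X_{1..2}) : (mdeg m0 < k)%N ->
  (forall m, m != m0 -> F m = 0) -> psub g h k F = C (F m0) * g ^+ m0 0 * h ^+ m0 1.
Proof.
move=> mk Fm; rewrite /psub (bigD1 (BMultinom mk)) //= big1 ?addr0 // => m.
by rewrite bmeqP /= => /Fm ->; rewrite rmorph0 !mul0r.
Qed.

Lemma is_subst_term F g h (m0 : 'X_{1..2}) : (forall m, m != m0 -> F m = 0) ->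
  is_subst F g h (C (F m0) * g ^+ m0 0 * h ^+ m0 1).
Proof.
move=> Fm t; exists (mdeg m0).+1 => k mk.
by rewrite -/(psub g h k F) (psub_term _ _ mk) // subrr; apply: (ideal0 (ideal_pow_ideal _ _)).
Qed.

Lemma is_subst_const c g h : is_subst (C c) g h (C c).
Proof.
have := @is_subst_term (C c) g h 0%MM; rewrite !mnm0E !expr0 !mulr1 /= eqxx mulr1n; apply.
by move=> m /negbTE ->.
Qed.
Lemma is_subst0 g h : is_subst 0 g h 0.
Proof. by have := is_subst_const 0 g h; rewrite rmorph0. Qed.
Lemma is_subst_mono i j g h : is_subst (mono (mn i j)) g h (g ^+ i * h ^+ j).
Proof.
have := @is_subst_term (mono (mn i j)) g h (mn i j); rewrite /= eqxx rmorph1 mul1r; apply.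
by move=> m /negbTE ->.
Qed.
Lemma is_substX g h : is_subst (serX B) g h g.
Proof. by rewrite serX_mono; have := is_subst_mono 1 0 g h; rewrite expr1 expr0 mulr1. Qed.
Lemma is_substY g h : is_subst (serY B) g h h.
Proof. by rewrite serY_mono; have := is_subst_mono 0 1 g h; rewrite expr1 expr0 mul1r. Qed.

(** Partial sums are evaluations of truncated polynomials, and evaluation is multiplicative. The
    product of two truncations and the truncation of the product differ only in degrees at least
    [k], which are sent into the k-th power of the maximal ideal. *)
Lemma psubM g h k F G : max_ideal g -> max_ideal h ->
  pow k (psub g h k F * psub g h k G - psub g h k (F * G)).
Proof.
move=> hg hh.
pose gh (i : 'I_2) : S := if i == 0 then g else h.
pose pk F : {mpoly B[2]} := \sum_(m : 'X_{1..2 < k}) F m *: 'X_[m].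
pose ev := mmap (ser_const 2 : {rmorphism B -> S}) gh.
have gh1 m : mmap1 gh m = g ^+ m 0 * h ^+ m 1.
  by rewrite /mmap1 !big_ord_recl big_ord0 mulr1 (_ : lift ord0 ord0 = 1) //; apply: val_inj.
have evE H : psub g h k H = ev (pk H).
  rewrite /ev /pk raddf_sum; apply: eq_bigr => m _.
  by rewrite [RHS]mmapZ mmapX gh1 mulrA.
have evM p q : ev (p * q) = ev p * ev q.
  have [] := @commr_mmap_is_multiplicative 2 B S gh (ser_const 2).
  - by move=> i x; apply: mulrC.
  - by move=> r m m'; apply: mulrC.
  - by move=> + _; apply.
rewrite !evE -evM -raddfB /= /ev /mmap big_seq; apply: ideal_sum (ideal_pow_ideal _ _) _ => m.
rewrite mcoeff_msupp mcoeffB => nz; apply: (idealM (ideal_pow_ideal _ _)); rewrite gh1.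
apply: ideal_pow_le (ideal_powXX _ _ hg hh); rewrite leqNgt; apply: contra nz.
rewrite -mdeg2 => mk; rewrite subr_eq0 (mcoeff_mpoly (F * G)) // mcoeffM.
apply/eqP; apply: eq_bigr => -[[k1 k1m] [k2 k2m]] _ /=.
by rewrite !mcoeff_mpoly // (leq_trans _ mk).
Qed.

Lemma is_substM F G g h H H' : max_ideal g -> max_ideal h ->
  is_subst F g h H -> is_subst G g h H' -> is_subst (F * G) g h (H * H').
Proof.
move=> hg hh hF hG; apply: alim_eq (alimM hF hG) => t; exists t => k tk.
exact: ideal_pow_le tk (psubM _ _ _ hg hh).
Qed.

Hypothesis sep : forall F, (forall t, pow t F) -> F = 0.

Lemma is_subst_uniq F g h H H' : is_subst F g h H -> is_subst F g h H' -> H = H'.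
Proof. exact: alim_uniq. Qed.

Section Hom.
Variables (g h : S) (s : S -> S).
Hypotheses (hg : max_ideal g) (hh : max_ideal h) (hs : forall F, is_subst F g h (s F)).

Lemma substD F G : s (F + G) = s F + s G.
Proof. exact: is_subst_uniq (hs _) (is_substD (hs F) (hs G)). Qed.
Lemma substM F G : s (F * G) = s F * s G.
Proof. exact: is_subst_uniq (hs _) (is_substM hg hh (hs F) (hs G)). Qed.
Lemma substC c : s (C c) = C c.
Proof. exact: is_subst_uniq (hs _) (is_subst_const c g h). Qed.
Lemma substX : s (serX B) = g.
Proof. exact: is_subst_uniq (hs _) (is_substX g h). Qed.
Lemma substY : s (serY B) = h.
Proof. exact: is_subst_uniq (hs _) (is_substY g h). Qed.
Lemma subst0 : s 0 = 0.
Proof. exact: is_subst_uniq (hs _) (is_subst0 g h). Qed.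
Lemma subst1 : s 1 = 1.
Proof. by rewrite -(rmorph1 (ser_const 2)) substC. Qed.
Lemma substX_n F k : s (F ^+ k) = s F ^+ k.
Proof. by elim: k => [|k IH]; rewrite ?expr0 ?subst1 // !exprS substM IH. Qed.
Lemma subst_ideal_pow (I I' : S -> Prop) t F : (forall x, I x -> I' (s x)) ->
  ideal_pow I t F -> ideal_pow I' t (s F).
Proof.
move=> hI; apply: (@ideal_pow_ind _ I (fun t F => ideal_pow I' t (s F))).
- move=> u; have hu := ideal_pow_ideal I' u; split; first by rewrite subst0; apply: ideal0.
    by move=> x y; rewrite substD; apply: idealD.
  by move=> x y; rewrite substM; apply: idealM.
- by move=> z; apply: ideal_pow0.
- by move=> u x z /hI Ix; rewrite substM; apply: ideal_powS.
Qed.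
Lemma substN F : s (- F) = - s F.
Proof. by apply/eqP; rewrite -addr_eq0 -substD addNr subst0. Qed.
Lemma substB F G : s (F - G) = s F - s G.
Proof. by rewrite substD substN. Qed.
Lemma subst_sum I (r : seq I) (P : pred I) (f : I -> S) :
  s (\sum_(i <- r | P i) f i) = \sum_(i <- r | P i) s (f i).
Proof. exact: (big_morph s substD subst0). Qed.
End Hom.

End Subst.

Section Transforms.
Variable A : comNzRingType.
Implicit Types (F G : mpser A 2) (c a b : A).

(** The series [F(x, x(y + c))]: the term [x^(i-l) y^l] becomes [x^i (y + c)^l], so every
    coefficient is a finite sum even when [c] is a unit. *)
Definition slopeS c F : mpser A 2 := mk (fun i j =>
  \sum_(l < i.+1) ('C(l, j))%:R * c ^+ (l - j) * cf F (i - l) l).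
Definition slopeT n c F : mpser A 2 := mk (fun i j =>
  if i is i'.+1 then cf (slopeS c F) (i' + n) j else 0).
Definition vertS F : mpser A 2 := mk (fun i j => if (i <= j)%N then cf F i (j - i) else 0).
Definition vertT n F : mpser A 2 := mk (fun i j =>
  if j is j'.+1 then cf (vertS F) i (j' + n) else 0).

Lemma cf_slopeS c F i j : cf (slopeS c F) i j =
  \sum_(l < i.+1) ('C(l, j))%:R * c ^+ (l - j) * cf F (i - l) l.
Proof. by []. Qed.
Lemma cf_vertS F i j : cf (vertS F) i j = if (i <= j)%N then cf F i (j - i) else 0.
Proof. by []. Qed.

Lemma slopeTP n c F : (forall i j, (i + j < n)%N -> cf F i j = 0) ->
  serX A ^+ n * slopeT n c F = serX A * slopeS c F.
Proof.
move=> F0.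
have S0 i j : (i < n)%N -> cf (slopeS c F) i j = 0.
  move=> ni; rewrite cf_slopeS big1 // => l _.
  by rewrite F0 ?mulr0 // subnK // -ltnS.
apply: cfP => i j; rewrite cf_XnM cf_XM; case: i => [|i].
  by rewrite leqn0; case: n F0 S0 => [|n].
case: ltngtP => [ni|ni|e].
- by rewrite subSn // cf_mk subnK.
- by rewrite S0 // ltnW.
- by rewrite e subnn cf_mk S0 // e.
Qed.

Lemma vertTP n F : (forall i j, (i + j < n)%N -> cf F i j = 0) ->
  serY A ^+ n * vertT n F = serY A * vertS F.
Proof.
move=> F0.
have S0 i j : (j < n)%N -> cf (vertS F) i j = 0.
  by move=> nj; rewrite cf_vertS; case: ifP => // ij; rewrite F0 // subnKC.
apply: cfP => i j; rewrite cf_YnM cf_YM; case: j => [|j].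
  by rewrite leqn0; case: n F0 S0 => [|n].
case: ltngtP => [nj|nj|e].
- by rewrite subSn // cf_mk subnK.
- by rewrite S0 // ltnW.
- by rewrite e subnn cf_mk S0 // e.
Qed.

Lemma cf_expXc a p i j : cf ((serX A + ser_const 2 a) ^+ p) i j =
  ('C(p, i))%:R * a ^+ (p - i) *+ (j == 0%N).
Proof.
elim: p i j => [|p IH] i j.
  by rewrite expr0 cf1 bin0n sub0n mulr1; case: i; case: j.
rewrite exprS mulrDl cfD cf_XM cf_constM; case: i => [|i].
  by rewrite add0r IH !bin0 !subn0 !mul1r exprS mulrnAr.
rewrite !IH binS natrD mulrDl mulrnDl subSS addrC; congr (_ + _).
case: (ltnP i p) => [ip|pi].
  by rewrite mulrnAr mulrCA -exprS subnSK.
by rewrite bin_small // !mul0r mul0rn mulr0.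
Qed.

Lemma cf_expYc a p i j : cf ((serY A + ser_const 2 a) ^+ p) i j =
  ('C(p, j))%:R * a ^+ (p - j) *+ (i == 0%N).
Proof.
elim: p i j => [|p IH] i j.
  by rewrite expr0 cf1 bin0n sub0n mulr1 andbC; case: i; case: j.
rewrite exprS mulrDl cfD cf_YM cf_constM; case: j => [|j].
  by rewrite add0r IH !bin0 !subn0 !mul1r exprS mulrnAr.
rewrite !IH binS natrD mulrDl mulrnDl subSS addrC; congr (_ + _).
case: (ltnP j p) => [ip|pi].
  by rewrite mulrnAr mulrCA -exprS subnSK.
by rewrite bin_small // !mul0r mul0rn mulr0.
Qed.

Lemma cf_expXYc a b p q i j :
  cf ((serX A + ser_const 2 a) ^+ p * (serY A + ser_const 2 b) ^+ q) i j =
  ('C(p, i))%:R * a ^+ (p - i) * (('C(q, j))%:R * b ^+ (q - j)).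
Proof.
rewrite cfM big_ord_recr /= [X in X + _]big1 ?add0r => [|k _]; last first.
  by apply: big1 => l _; rewrite cf_expYc subn_eq0 leqNgt ltn_ord mulr0.
rewrite big_ord_recl big1 /= ?addr0 => [|l _]; last by rewrite cf_expXc mul0r.
by rewrite cf_expXc cf_expYc !eqxx subnn subn0.
Qed.

Lemma cf_psub g h k F i j : cf (psub g h k F) i j =
  \sum_(m : 'X_{1..2 < k}) F m * cf (g ^+ m 0 * h ^+ m 1) i j.
Proof. by rewrite /psub cf_sum; apply: eq_bigr => m _; rewrite -mulrA cf_constM. Qed.

Lemma cf_psub_slope c k F i j : (i < k)%N ->
  cf (psub (serX A) (serX A * (serY A + ser_const 2 c)) k F) i j = cf (slopeS c F) i j.
Proof.
move=> ik; rewrite cf_psub.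
have E (m : 'X_{1..2}) : cf (serX A ^+ m 0 * (serX A * (serY A + ser_const 2 c)) ^+ m 1) i j =
   if mdeg m == i then ('C(m 1, j))%:R * c ^+ (m 1 - j) else 0.
  rewrite exprMn mulrA -exprD cf_XnM mdeg2 cf_expYc subn_eq0 eqn_leq.
  by case: (_ <= i)%N => //=; rewrite mulrb.
under eq_bigr do rewrite E; rewrite (bigID (fun m : 'X_{1..2 < k} => mdeg m == i)) /=.
rewrite [X in _ + X]big1 ?addr0; last by move=> m /negbTE ->; rewrite mulr0.
have hd (l : 'I_i.+1) : (mdeg (mn (i - l) l) < k)%N by rewrite mdeg_mn subnK // -ltnS.
rewrite (reindex_onto (fun l => BMultinom (hd l)) (fun m => inord (m 1%R))) /=; last first.
  move=> m /eqP mi; apply: val_inj; rewrite /= inordK; last by rewrite -mi mdeg2 ltnS leq_addl.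
  by rewrite -mi mdeg2 addnK -mnE.
apply: eq_big => [l|l _].
  by rewrite mdeg_mn subnK ?leq_ord // eqxx mn1 inord_val eqxx.
by rewrite mdeg_mn subnK ?leq_ord // eqxx mn1 -/(cf F (i - l) l) mulrC.
Qed.

Lemma cf_psub_vert k F i j : (j < k)%N ->
  cf (psub (serX A * serY A) (serY A) k F) i j = cf (vertS F) i j.
Proof.
move=> jk; rewrite cf_psub.
have E (m : 'X_{1..2}) : cf ((serX A * serY A) ^+ m 0 * serY A ^+ m 1) i j =
   ((m 0 == i) && (mdeg m == j))%:R.
  by rewrite exprMn -mulrA -exprD monoXY cf_mono mdeg2 eq_sym [j == _]eq_sym.
under eq_bigr do rewrite E; rewrite cf_vertS; case: leqP => ij.
  have hd : (mdeg (mn i (j - i)) < k)%N by rewrite mdeg_mn subnKC.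
  rewrite (bigD1 (BMultinom hd)) //= mdeg_mn mn0 subnKC // !eqxx mulr1 big1 ?addr0 // => m.
  rewrite bmeqP /= [bmnm m]mnE mn_eq mdeg_mn mn0.
  have [<-|] := eqVneq; last by rewrite mulr0.
  by case: (eqVneq _ j) => [<-|]; rewrite ?mulr0 // addKn eqxx.
rewrite big1 // => m _; rewrite mdeg2.
case: eqP => [e|]; last by rewrite mulr0.
by case: eqP => [|]; rewrite ?mulr0 //; lia.
Qed.

End Transforms.

(** * Translations by elements of the maximal ideal *)

Section Sums.
Variables (K : fieldType) (N : nat).
Local Notation R := (mpser K N).
Implicit Types (a b r : R) (g : nat -> R) (F G : mpser R 2).

(* The sum of the a^k g_k, which converges for a in the maximal ideal. *)
Definition asum a g : R := MPSer (fun e => \sum_(k < (mdeg e).+1) (a ^+ k * g k) e).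

Lemma ordge_exp a k : ordge 1 a -> ordge k (a ^+ k).
Proof. by move=> /ordgeX -/(_ k); rewrite muln1. Qed.

Lemma asumE a g t : ordge 1 a -> ordge t (asum a g - \sum_(k < t) a ^+ k * g k).
Proof.
move=> ha e et; rewrite serB ser_sum [asum a g e]/=.
rewrite (big_ord_widen _ (fun k => (a ^+ k * g k) e) et) [X in _ - X](bigID (fun k : 'I_t => k < (mdeg e).+1)%N) /=.
rewrite [X in _ - (_ + X)]big1 ?addr0 ?subrr // => k; rewrite -leqNgt => ek.
exact: (@ordgeMr _ _ k _ (g k) (@ordge_exp a k ha)).
Qed.

Lemma asumW a g t s : ordge 1 a -> (t <= s)%N -> ordge t (asum a g - \sum_(k < s) a ^+ k * g k).
Proof. by move=> ha ts; apply: ordge_le ts _; apply: asumE. Qed.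

Lemma ordge_eq (x y : R) : (forall t, ordge t (x - y)) -> x = y.
Proof. by move=> h; apply/subr0_eq/ordgeP. Qed.

Lemma ordge_sym t (x y : R) : ordge t (x - y) -> ordge t (y - x).
Proof. by move=> h; rewrite -opprB; apply: ordgeN. Qed.
Lemma ordge_trans t (y x z : R) : ordge t (x - y) -> ordge t (y - z) -> ordge t (x - z).
Proof. by move=> h1 h2; rewrite -[x](subrK y) -addrA; apply: ordgeD. Qed.

Lemma asumS a g : ordge 1 a -> asum a g = g 0%N + a * asum a (fun k => g k.+1).
Proof.
move=> ha; apply: ordge_eq => t.
apply: ordge_trans (asumW g ha (leqnSn t)) _.
rewrite big_ord_recl expr0 mul1r opprD addrACA subrr add0r.
under eq_bigr do rewrite /= /bump leq0n add1n exprS -mulrA.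
by rewrite -mulr_sumr -mulrBr; apply: ordgeMl; apply: ordge_sym; apply: asumE.
Qed.

Lemma asum_ext a g g' : (forall k, g k = g' k) -> asum a g = asum a g'.
Proof. by move=> h; congr asum; apply: funext. Qed.

Lemma asum0 a g : (forall k, g k = 0) -> asum a g = 0.
Proof.
move=> g0; apply: mpserP => e; rewrite ser0; apply: big1 => k _.
by rewrite g0 mulr0 ser0.
Qed.

Lemma asum_mulr a g r : ordge 1 a -> asum a (fun k => r * g k) = r * asum a g.
Proof.
move=> ha; apply: ordge_eq => t; apply: ordge_trans (@asumE a _ t ha) _.
rewrite (eq_bigr (fun k : 'I_t => r * (a ^+ k * g k))) => [|k _]; last by rewrite mulrCA.
by rewrite -mulr_sumr -mulrBr; apply: ordgeMl; apply: ordge_sym; apply: asumE.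
Qed.

Lemma asumD a g g' : ordge 1 a -> asum a (fun k => g k + g' k) = asum a g + asum a g'.
Proof.
move=> ha; apply: ordge_eq => t; apply: ordge_trans (@asumE a _ t ha) _.
under eq_bigr do rewrite mulrDr.
by rewrite big_split opprD addrACA; apply: ordgeD; apply: ordge_sym; apply: asumE.
Qed.

Lemma asum_at0 a g : ordge 1 a -> (asum a g) 0%MM = (g 0%N) 0%MM.
Proof. by move=> ha; rewrite asumS // serD serM0 (ordge1P a).1 // mul0r addr0. Qed.

Lemma asumC a b (g : nat -> nat -> R) : ordge 1 a -> ordge 1 b ->
  asum a (fun i => asum b (g i)) = asum b (fun j => asum a (g ^~ j)).
Proof.
move=> ha hb; apply: ordge_eq => t.
apply: ordge_trans (@asumE a _ t ha) (ordge_sym _).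
apply: ordge_trans (@asumE b _ t hb) _.
have E c d (h : nat -> nat -> R) : ordge 1 c -> ordge t
   (\sum_(i < t) d ^+ i * asum c (h i) - \sum_(i < t) \sum_(j < t) c ^+ j * (d ^+ i * h i j)).
  move=> hc; rewrite -sumrB; apply: ordge_sum => i _.
  rewrite (eq_bigr (fun j : 'I_t => d ^+ i * (c ^+ j * h i j))) => [|j _]; last by rewrite mulrCA.
  by rewrite -mulr_sumr -mulrBr; apply: ordgeMl; apply: asumE.
apply: ordge_trans (E a b (fun j i => g i j) ha) (ordge_sym _).
apply: ordge_trans (E b a g hb) _.
rewrite [X in _ - X]exchange_big /= (eq_bigr (fun i : 'I_t => \sum_(j < t) a ^+ i * (b ^+ j * g i j))).
  by rewrite subrr; apply: ordge0.
by move=> i _; apply: eq_bigr => j _; rewrite mulrCA.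
Qed.

(** Taylor expansion of [F(x + a, y)]; the binomial coefficients stand for divided derivatives, so
    this is valid in every characteristic. *)
Definition PhiX a F : mpser R 2 := mk (fun i j =>
  asum a (fun l => ('C(i + l, i))%:R * cf F (i + l) j)).
Definition PhiY b F : mpser R 2 := mk (fun i j =>
  asum b (fun l => ('C(j + l, j))%:R * cf F i (j + l))).
Definition Phi a b F : mpser R 2 := PhiX a (PhiY b F).

Lemma PhiC a b F : ordge 1 a -> ordge 1 b -> PhiX a (PhiY b F) = PhiY b (PhiX a F).
Proof.
move=> ha hb; apply: cfP => i j; rewrite !cf_mk.
pose g l l' := ('C(i + l, i))%:R * (('C(j + l', j))%:R * cf F (i + l) (j + l')).
rewrite (asum_ext _ (g' := fun l => asum b (g l))) => [|l]; last by rewrite cf_mk asum_mulr.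
rewrite asumC //; apply: asum_ext => l'; rewrite cf_mk -asum_mulr //.
by apply: asum_ext => l; rewrite /g mulrCA.
Qed.

Lemma cf_PhiX0 a F i j : ordge 1 a -> (cf (PhiX a F) i j) 0%MM = (cf F i j) 0%MM.
Proof. by move=> ha; rewrite cf_mk asum_at0 // addn0 binn mul1r. Qed.
Lemma cf_PhiY0 a F i j : ordge 1 a -> (cf (PhiY a F) i j) 0%MM = (cf F i j) 0%MM.
Proof. by move=> ha; rewrite cf_mk asum_at0 // addn0 binn mul1r. Qed.

Lemma cf_Phi_sum a b F i j t : ordge 1 a -> ordge 1 b ->
  ordge t (cf (Phi a b F) i j - \sum_(l < t) \sum_(l' < t)
    (('C(i + l, i))%:R * a ^+ l * (('C(j + l', j))%:R * b ^+ l')) * cf F (i + l) (j + l')).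
Proof.
move=> ha hb; rewrite cf_mk; apply: ordge_trans (@asumE a _ t ha) _.
rewrite -sumrB; apply: ordge_sum => l _.
rewrite (eq_bigr (fun l' : 'I_t => a ^+ l * ('C(i + l, i))%:R *
   (b ^+ l' * (('C(j + l', j))%:R * cf F (i + l) (j + l'))))) => [|l' _]; last by ring.
rewrite -mulr_sumr mulrA -mulrBr; apply: ordgeMl; rewrite cf_mk; exact: asumE.
Qed.

(** Terms outside the box of exponents below [i + t] and [j + t] either have a vanishing binomial
    coefficient or carry a t-th power of [a] or [b]. The bound on [k] ensures that the truncation
    contains the whole box. *)
Lemma cf_psub_Phi a b F k t i j : ordge 1 a -> ordge 1 b -> (i + j + t + t <= k)%N ->
  ordge t (cf (Phi a b F) i j -
    cf (psub (serX R + ser_const 2 a) (serY R + ser_const 2 b) k F) i j).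
Proof.
move=> ha hb kt; apply: ordge_trans (@cf_Phi_sum a b F i j t ha hb) _.
have -> : cf (psub (serX R + ser_const 2 a) (serY R + ser_const 2 b) k F) i j =
    \sum_(m : 'X_{1..2 < k}) F m * (('C(m 0, i))%:R * a ^+ (m 0 - i) *
       (('C(m 1, j))%:R * b ^+ (m 1 - j))).
  by rewrite cf_psub; apply: eq_bigr => m _; rewrite cf_expXYc.
rewrite (bigID (fun m : 'X_{1..2 < k} =>
   (i <= m 0%R < i + t)%N && (j <= m 1%R < j + t)%N)) /= opprD addrA.
apply: ordgeB; last first.
  apply: ordge_sum => m nb; apply: ordgeMl.
  move: nb; rewrite !negb_and -!leqNgt -!ltnNge.
  case/orP => [/orP[lt|ge]|/orP[lt|ge]].
  - by rewrite bin_small // !mul0r; apply: ordge0.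
  - apply/ordgeMr/ordgeMl; apply: ordge_le (ordge_exp ha); lia.
  - by rewrite [X in _ * (X%:R * _)]bin_small // mul0r mulr0; apply: ordge0.
  - apply/ordgeMl/ordgeMl; apply: ordge_le (ordge_exp hb); lia.
have hd (p : 'I_t * 'I_t) : (mdeg (mn (i + p.1) (j + p.2)) < k)%N.
  by rewrite mdeg_mn; have := ltn_ord p.1; have := ltn_ord p.2; lia.
rewrite pair_big /=; case: t kt hd => [|t] kt hd; first exact: ordge_0.
pose m2p (m : 'X_{1..2 < k}) : 'I_t.+1 * 'I_t.+1 := (inord (m 0%R - i), inord (m 1%R - j)).
rewrite [X in _ - X](reindex_onto (fun p => BMultinom (hd p)) m2p) /=; last first.
  move=> m /andP[/andP[h1 h2] /andP[h3 h4]]; apply: val_inj => /=.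
  rewrite !inordK; [|lia|lia].
  by rewrite !subnKC // -mnE.
rewrite [X in _ - X](eq_bigl xpredT) => [|[p q]]; last first.
  by rewrite mn0 mn1 !leq_addr !ltn_add2l !ltn_ord /m2p /= !addKn !inord_val eqxx.
rewrite -sumrB; apply: ordge_sum => p _.
by rewrite !addKn mulrC subrr; apply: ordge0.
Qed.

End Sums.

(** * Series over a quotient B of K[[s]], studied on lifts *)

Section Base.
Variables (K : fieldType) (N : nat) (B : comNzRingType).
Local Notation R := (mpser K N).
Variable pi : {rmorphism R -> B}.
Hypothesis pi_surj : forall b, exists r, pi r = b.
Implicit Types (a b r : R) (F G H : mpser R 2).
Local Notation S := (mpser B 2).
Local Notation pow := (ideal_pow (@max_ideal S)).
Local Notation C := (ser_const 2).

Definition ker r : Prop := pi r = 0.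

Lemma ker_ideal : is_ideal ker.
Proof.
split; rewrite /ker; first exact: rmorph0.
  by move=> x y hx hy; rewrite rmorphD hx hy addr0.
by move=> x y hy; rewrite rmorphM hy mulr0.
Qed.

Lemma ker_closed r : (forall t, exists2 j, ker j & ordge t (r - j)) -> ker r.
Proof. exact: ideal_closed ker_ideal. Qed.

Lemma is_unit_pi r : r 0%MM != 0 -> is_unit (pi r).
Proof.
move=> r0; have [w rw] := ser_inv (divff r0).
by exists (pi w); rewrite -rmorphM rw rmorph1.
Qed.

Lemma ker_max r : ker r -> r 0%MM = 0.
Proof.
move=> kr; apply/eqP; apply: contrapT => /negP /is_unit_pi [w].
by rewrite kr mul0r => /eqP; rewrite oner_eq0.
Qed.

Lemma max_pi r : max_ideal (pi r) <-> r 0%MM = 0.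
Proof.
split=> [nu|r0 [w]]; first by apply: contrapT => /eqP /is_unit_pi.
have [v <-] := pi_surj w; rewrite -rmorphM -[1](rmorph1 pi) => e.
have /ker_max : ker (1 - r * v) by rewrite /ker rmorphB e subrr.
by rewrite serB serM0 r0 mul0r ser1 eqxx subr0 => /eqP; rewrite oner_eq0.
Qed.

Lemma max_ser2 (F : S) : max_ideal F <-> max_ideal (F 0%MM).
Proof.
split=> nu [w hw]; apply: nu; last by exists (w 0%MM); rewrite -serM0 -hw ser1 eqxx.
by have [G hG] := ser_inv (esym hw); exists G.
Qed.

Lemma max_serX : max_ideal (serX B).
Proof. by apply/max_ser2; rewrite cfE !mnm0E serX_mono cf_mono /= mulr0n -(rmorph0 pi); apply/max_pi; rewrite ser0. Qed.
Lemma max_serY : max_ideal (serY B).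
Proof. by apply/max_ser2; rewrite cfE !mnm0E serY_mono cf_mono /= mulr0n -(rmorph0 pi); apply/max_pi; rewrite ser0. Qed.

Lemma max_B_ideal : is_ideal (@max_ideal B).
Proof.
split; first by rewrite -(rmorph0 pi); apply/max_pi; rewrite ser0.
  move=> x y; have [u <-] := pi_surj x; have [v <-] := pi_surj y.
  rewrite -rmorphD => /max_pi hu /max_pi hv; apply/max_pi.
  by rewrite serD hu hv addr0.
move=> x y; have [u <-] := pi_surj x; have [v <-] := pi_surj y.
by rewrite -rmorphM => /max_pi hv; apply/max_pi; rewrite serM0 hv mulr0.
Qed.

Lemma max_S_ideal : is_ideal (@max_ideal S).
Proof.
have hB := max_B_ideal.
split; first by apply/max_ser2; rewrite ser0; apply: (ideal0 hB).
  by move=> x y /max_ser2 hx /max_ser2 hy; apply/max_ser2; rewrite serD; apply: (idealD hB).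
by move=> x y /max_ser2 hy; apply/max_ser2; rewrite serM0; apply: (idealM hB).
Qed.

(** Lifted form of the t-th power of the maximal ideal of B[[x, y]]: as [x] and [y] belong to that
    ideal, the coefficient of [x^i y^j] only has to come from order [t - (i + j)]. The truncated
    subtraction imposes nothing once [i + j >= t]. *)
Definition bord t (F : S) : Prop :=
  forall i j, exists2 r, ordge (t - (i + j)) r & pi r = cf F i j.

Lemma bord_sum t I (s : seq I) (P : pred I) (f : I -> B) :
  (forall i, P i -> exists2 r, ordge t r & pi r = f i) ->
  exists2 r, ordge t r & pi r = \sum_(i <- s | P i) f i.
Proof.
move=> h; elim/big_rec: _ => [|i x Pi [r hr <-]].
  by exists 0; [exact: ordge0|rewrite rmorph0].
by have [u hu <-] := h i Pi; exists (u + r); [exact: ordgeD|rewrite rmorphD].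
Qed.

Lemma pow_bord t (F : S) : pow t F <-> bord t F.
Proof.
split.
  apply: (@ideal_pow_ind S _ bord) => [s|z i j|s x z].
  - split; first by move=> i j; exists 0; [exact: ordge0|rewrite rmorph0 cf0].
      move=> x y hx hy i j; have [r hr er] := hx i j; have [u hu eu] := hy i j.
      by exists (r + u); [exact: ordgeD|rewrite rmorphD er eu].
    move=> x y hy i j; rewrite cfM; apply: bord_sum => a _; apply: bord_sum => b _.
    have [r hr <-] := hy (i - a)%N (j - b)%N; have [u <-] := pi_surj (cf x a b).
    exists (u * r); last by rewrite rmorphM.
    by apply: ordgeMl; apply: ordge_le hr; apply: leq_sub2l; rewrite leq_add ?leq_subr.
  - by have [r <-] := pi_surj (cf z i j); exists r.
  move=> /max_ser2 hx hz i j; rewrite cfM; apply: bord_sum => a _; apply: bord_sum => b _.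
  have [r hr <-] := hz (i - a)%N (j - b)%N; have [u eu] := pi_surj (cf x a b).
  exists (u * r); last by rewrite rmorphM eu.
  have ai := ltn_ord a; have bj := ltn_ord b.
  case: (posnP (a + b)%N) => [/eqP|ab]; last by apply: ordgeMl; apply: ordge_le hr; lia.
  rewrite addn_eq0 => /andP[/eqP a0 /eqP b0].
  have : ordge 1 u.
    by apply/ordge1P/max_pi; rewrite eu a0 b0 /cf mn00.
  by move/ordgeM => /(_ _ _ hr); apply: ordge_le; rewrite a0 b0; lia.
elim: t F => [|t IH] F hF; first exact: ideal_pow0.
pose G1 : S := mk (fun i j => cf F i.+1 j).
pose G2 : S := mk (fun i j => if i is 0%N then cf F 0 j.+1 else 0).
have -> : F = C (cf F 0 0) + serX B * G1 + serY B * G2.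
  apply: cfP => i j; rewrite !cfD cf_const cf_XM cf_YM.
  by case: i => [|i]; case: j => [|j]; rewrite /= ?mulr1n ?mulr0n ?addr0 ?add0r.
have hp := ideal_pow_ideal (@max_ideal S) t.+1.
apply: (idealD hp); first (apply: (idealD hp)).
- have [r hr <-] := hF 0%N 0%N; move/ideal_pow_max: hr.
  apply: (@ideal_pow_ind R _ (fun t r => pow t (C (pi r)))) => [s|z|s x z /max_ideal_ser x0 hz].
  + have hs := ideal_pow_ideal (@max_ideal S) s.
    split; first by rewrite !rmorph0; apply: ideal0.
      by move=> x y; rewrite !rmorphD; apply: idealD.
    by move=> x y; rewrite !rmorphM; apply: idealM.
  + exact: ideal_pow0.
  + by rewrite !rmorphM; apply: ideal_powS => //; apply/max_ser2; rewrite ser_constE eqxx mulr1n; apply/max_pi.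
- apply: ideal_powS (IH _ _); first exact: max_serX.
  by move=> i j; have [r hr er] := hF i.+1 j; exists r.
- apply: ideal_powS (IH _ _); first exact: max_serY.
  move=> [|i] j; last by exists 0; [exact: ordge0|rewrite rmorph0].
  by have [r hr er] := hF 0%N j.+1; exists r.
Qed.

(** Krull's intersection theorem for B[[x, y]], deduced from the closedness of the kernel of [pi].
    It makes limits, hence results of substitutions, unique. *)
Lemma pow_sep (F : S) : (forall t, pow t F) -> F = 0.
Proof.
move=> h; apply: cfP => i j; rewrite cf0; have [r er] := pi_surj (cf F i j).
rewrite -er; apply: ker_closed => t; have [] := (pow_bord (t + (i + j)) F).1 (h _) i j.
move=> r'; rewrite addnK => hr' er'; exists (r - r'); last by rewrite opprB addrC subrK.
by rewrite /ker rmorphB er er' subrr.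
Qed.

Lemma is_subst_of_cf (F g h H : S) :
  (forall t, exists k0, forall k, (k0 <= k)%N -> forall i j, (i + j < t)%N ->
     exists2 r, ordge (t - (i + j)) r & pi r = cf (H - psub g h k F) i j) ->
  is_subst F g h H.
Proof.
move=> hH t; have [k0 h0] := hH t; exists k0 => k /h0 hk; apply/pow_bord => i j.
have [/hk //|tij] := ltnP (i + j) t.
have [r <-] := pi_surj (cf (H - psub g h k F) i j); exists r => //.
by move: tij; rewrite -subn_eq0 => /eqP ->.
Qed.

Lemma slope_subst (c : B) (F : S) :
  is_subst F (serX B) (serX B * (serY B + C c)) (slopeS c F).
Proof.
apply: is_subst_of_cf => t; exists t => k tk i j ij.
exists 0; first exact: ordge0.
by rewrite rmorph0 cfB cf_psub_slope ?subrr //; lia.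
Qed.

Lemma vert_subst (F : S) : is_subst F (serX B * serY B) (serY B) (vertS F).
Proof.
apply: is_subst_of_cf => t; exists t => k tk i j ij.
exists 0; first exact: ordge0.
by rewrite rmorph0 cfB cf_psub_vert ?subrr //; lia.
Qed.

Local Notation mp := (@map_ser R B 2 pi).

Lemma mp_surj (F : S) : exists G, mp G = F.
Proof.
have /choice[s hs] := pi_surj.
by exists (map_ser s F); apply: mpserP => m; rewrite /= hs.
Qed.

Lemma mp_X : mp (serX R) = serX B. Proof. by rewrite !serX_mono; apply: map_ser_mono. Qed.
Lemma mp_Y : mp (serY R) = serY B. Proof. by rewrite !serY_mono; apply: map_ser_mono. Qed.

Lemma cf_mp F i j : cf (mp F) i j = pi (cf F i j). Proof. by []. Qed.

Lemma mp_sum I (s : seq I) (P : pred I) (f : I -> mpser R 2) :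
  mp (\sum_(i <- s | P i) f i) = \sum_(i <- s | P i) mp (f i).
Proof.
apply: (big_morph mp (@map_serD _ _ pi 2)).
by apply: cfP => i j; rewrite cf_mp !cf0 rmorph0.
Qed.

Lemma mp_exp F k : mp (F ^+ k) = mp F ^+ k.
Proof. by elim: k => [|k IH]; rewrite ?expr0 ?map_ser1 // !exprS map_serM IH. Qed.

Lemma mp_psub g h k F : mp (psub g h k F) = psub (mp g) (mp h) k (mp F).
Proof.
rewrite /psub mp_sum; apply: eq_bigr => m _.
by rewrite !map_serM map_ser_const !mp_exp.
Qed.

Lemma Phi_subst a b F : ordge 1 a -> ordge 1 b ->
  is_subst (mp F) (serX B + C (pi a)) (serY B + C (pi b)) (mp (Phi a b F)).
Proof.
move=> ha hb; apply: is_subst_of_cf => t; exists (t + t + t)%N => k tk i j ij.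
exists (cf (Phi a b F) i j - cf (psub (serX R + ser_const 2 a) (serY R + ser_const 2 b) k F) i j).
  by apply: ordge_le (cf_psub_Phi (t := t) _ ha hb _); [exact: leq_subr|lia].
have -> : serX B + C (pi a) = mp (serX R + ser_const 2 a) by rewrite map_serD mp_X map_ser_const.
have -> : serY B + C (pi b) = mp (serY R + ser_const 2 b) by rewrite map_serD mp_Y map_ser_const.
by rewrite -mp_psub rmorphB.
Qed.

Lemma max_Xa a : ordge 1 a -> max_ideal (serX B + C (pi a)).
Proof.
move=> /ordge1P ha; apply: (idealD max_S_ideal); first exact: max_serX.
by apply/max_ser2; rewrite ser_constE eqxx mulr1n; apply/max_pi.
Qed.
Lemma max_Yb a : ordge 1 a -> max_ideal (serY B + C (pi a)).
Proof.
move=> /ordge1P ha; apply: (idealD max_S_ideal); first exact: max_serY.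
by apply/max_ser2; rewrite ser_constE eqxx mulr1n; apply/max_pi.
Qed.

Section Translate.
Variables (a b : R).
Hypotheses (ha : ordge 1 a) (hb : ordge 1 b).

Let hNa : ordge 1 (- a). Proof. exact: ordgeN. Qed.
Let hNb : ordge 1 (- b). Proof. exact: ordgeN. Qed.
Let g := serX B + C (pi a).
Let h := serY B + C (pi b).
Let g' := serX B + C (pi (- a)).
Let h' := serY B + C (pi (- b)).

Let tr_ex (F : S) : exists H : S, is_subst F g h H.
Proof. by have [G <-] := mp_surj F; exists (mp (Phi a b G)); apply: Phi_subst. Qed.
Let tr'_ex (F : S) : exists H : S, is_subst F g' h' H.
Proof. by have [G <-] := mp_surj F; exists (mp (Phi (- a) (- b) G)); apply: Phi_subst. Qed.
Let tr (F : S) : S := projT1 (cid (tr_ex F)).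
Let tr' (F : S) : S := projT1 (cid (tr'_ex F)).
Let trP (F : S) : is_subst F g h (tr F). Proof. by rewrite /tr; case: cid. Qed.
Let tr'P (F : S) : is_subst F g' h' (tr' F). Proof. by rewrite /tr'; case: cid. Qed.
Let hg := max_Xa ha.
Let hh := max_Yb hb.
Let hg' := max_Xa hNa.
Let hh' := max_Yb hNb.

Let trX : tr (serX B) = g. Proof. exact: (substX pow_sep trP). Qed.
Let trY : tr (serY B) = h. Proof. exact: (substY pow_sep trP). Qed.
Let tr'X : tr' (serX B) = g'. Proof. exact: (substX pow_sep tr'P). Qed.
Let tr'Y : tr' (serY B) = h'. Proof. exact: (substY pow_sep tr'P). Qed.
Let trC c : tr (C c) = C c. Proof. exact: (substC pow_sep trP). Qed.
Let tr'C c : tr' (C c) = C c. Proof. exact: (substC pow_sep tr'P). Qed.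
Let trD (F G : S) : tr (F + G) = tr F + tr G. Proof. exact: (substD pow_sep trP). Qed.
Let tr'D (F G : S) : tr' (F + G) = tr' F + tr' G. Proof. exact: (substD pow_sep tr'P). Qed.
Let trM (F G : S) : tr (F * G) = tr F * tr G. Proof. exact: (substM pow_sep hg hh trP). Qed.
Let tr'M (F G : S) : tr' (F * G) = tr' F * tr' G. Proof. exact: (substM pow_sep hg' hh' tr'P). Qed.

Let tr'B (F G : S) : tr' (F - G) = tr' F - tr' G. Proof. exact: (substB pow_sep tr'P). Qed.

Let tr'_max x : max_ideal x -> max_ideal (tr' x).
Proof.
move=> hx; rewrite -[tr' x](subrK (psub g' h' 1 x)).
have hS := max_S_ideal.
have [k0 hk] := tr'P x 1; pose k := k0.+1.
rewrite -[tr' x](subrK (psub g' h' k x)) -[_ + _ - _]addrA -addrA subrK.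
apply: (idealD hS); first by apply: (ideal_pow1 hS); apply: hk; exact: leqnSn.
apply: (ideal_sum _ hS) => m _.
have [m0|m0] := eqVneq (bmnm m) 0%MM.
  by rewrite m0 !mnm0E !expr0 !mulr1; apply/max_ser2; rewrite ser_constE eqxx mulr1n -m0 m0; apply/max_ser2.
rewrite -mulrA; apply: (idealM hS).
have := ideal_powXX (m 0%R) (m 1%R) hg' hh'.
rewrite -mdeg2; move: m0; rewrite -mdeg_eq0 -lt0n => m0.
by move/(ideal_pow_le m0)/(ideal_pow1 hS).
Qed.

(** On partial sums the two translations cancel exactly, because there only their effect on [x], [y]
    and constants matters. The errors are in the t-th power of the maximal ideal, which [tr']
    preserves. *)
Let tr'K (F : S) : tr' (tr F) = F.
Proof.
apply: subr0_eq; apply: pow_sep => t.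
have idS : is_subst F (serX B) (serY B) F.
  apply: is_subst_of_cf => u; exists u => k uk i j ij.
  exists 0; first exact: ordge0.
  rewrite rmorph0 cfB cf_psub; apply/esym/subr0_eq/eqP; rewrite subr0 subr_eq0 eq_sym; apply/eqP.
  have hd : (mdeg (mn i j) < k)%N by rewrite mdeg_mn; lia.
  rewrite (bigD1 (BMultinom hd)) // big1 => [|m].
    by rewrite [bmnm _]/= monoXY cf_mono mn0 mn1 !eqxx mulr1; apply: addr0.
  rewrite bmeqP [X in _ != X]/= [X in X != _]mnE mn_eq => /negbTE nm.
  by rewrite monoXY cf_mono eq_sym [j == _]eq_sym nm mulr0.
have [k1 hk1] := trP F t; have [k2 hk2] := idS t.
pose k := maxn k1 k2.
have e : tr' (psub g h k F) = psub (serX B) (serY B) k F.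
  rewrite /psub (subst_sum pow_sep tr'P); apply: eq_bigr => m _.
  rewrite !tr'M tr'C !(substX_n pow_sep hg' hh' tr'P) !tr'D tr'X tr'Y !tr'C.
  by rewrite /g' /h' !rmorphN -!addrA !addNr !addr0.
have -> : tr' (tr F) - F = tr' (tr F - psub g h k F) - (F - psub (serX B) (serY B) k F).
  by rewrite tr'B e; ring.
apply: (idealB (ideal_pow_ideal _ _)); last by apply: hk2; rewrite leq_maxr.
apply: (subst_ideal_pow pow_sep hg' hh' tr'P tr'_max).
by apply: hk1; rewrite leq_maxl.
Qed.

Lemma ideal_pow_XY t (F : S) :
  ideal_pow (ideal2 (serX B) (serY B)) t F <-> forall i j, (i + j < t)%N -> cf F i j = 0.
Proof.
split.
  move=> hF i j; apply: (ordge2P t F).1; move: hF.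
  apply: ideal_pow_ind => [s|//|s x z /ideal2P[u [v ->]] hz].
    by split; [exact: ordge0|exact: ordgeD|move=> x y; exact: ordgeMl].
  rewrite -[s.+1]add1n; apply: ordgeM => //; apply/ordge1P; rewrite cfE !mnm0E cfD.
  by rewrite mulrC cf_XM mulrC cf_YM addr0.
move/(ordge2P t F).2; elim: t F => [|t IH] F hF; first exact: ideal_pow0.
have [G hG ->] := ordge_split hF.
apply: ideal_sum (ideal_pow_ideal _ _) _ => i _; apply: ideal_powS (IH _ (hG i)).
apply: ideal_gen_sub; case: i => -[|[|//]] hi; [left|right]; rewrite /serX /serY;
  by congr ser_var; apply: val_inj.
Qed.

(** The two inverse translations carry the ideal of the section to that of the trivial section and
    back, where membership in a power is a condition on coefficients. *)
Lemma equimult_Phi t F :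
  ideal_pow (section_ideal (pi a) (pi b)) t (mp F) <->
  forall i j, (i + j < t)%N -> ker (cf (Phi a b F) i j).
Proof.
have -> : mp F = tr' (mp (Phi a b F)).
  by rewrite -[mp F]tr'K; congr tr'; apply: is_subst_uniq pow_sep _ _ _ _ _ (trP _) (Phi_subst _ ha hb).
have trF : tr (mp F) = mp (Phi a b F).
  by apply: is_subst_uniq pow_sep _ _ _ _ _ (trP _) (Phi_subst _ ha hb).
split=> [hl i j|hl].
  rewrite /ker -cf_mp; apply: (ideal_pow_XY t _).1.
  have -> : mp (Phi a b F) = tr (tr' (mp (Phi a b F))) by rewrite -trF tr'K.
  apply: (subst_ideal_pow pow_sep hg hh trP) hl => x /ideal2P[u [v ->]].
  apply/ideal2P; exists (tr u), (tr v); rewrite trD !trM.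
  rewrite !(substB pow_sep trP) trX trY !trC.
  by rewrite /g /h !addrK.
apply: (subst_ideal_pow pow_sep hg' hh' tr'P (I := ideal2 (serX B) (serY B))).
  move=> x /ideal2P[u [v ->]]; apply/ideal2P; exists (tr' u), (tr' v).
  by rewrite tr'D !tr'M tr'X tr'Y /g' /h' !rmorphN.
by apply/ideal_pow_XY => i j ij; rewrite cf_mp; apply: hl.
Qed.

End Translate.
End Base.

(** * Orders, tangents and nodes *)

Section PlaneSeries.
Variable K : closedFieldType.
Implicit Types (f g : mpser K 2) (c : K).

Lemma is_ordE f n : is_ord f n <->
  (forall i j, (i + j < n)%N -> cf f i j = 0) /\ exists2 i, (i <= n)%N & cf f i (n - i) != 0.
Proof.
split=> [[f0 [m mn1 fm]]|[f0 [i ij fij]]].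
  split; first by move=> i j ij; apply: f0; rewrite mdeg_mn.
  by exists (m 0); rewrite -mn1 mdeg2 ?leq_addr // addKn -cfE.
split; first by move=> m mn1; rewrite cfE f0 // -mdeg2.
by exists (mn i (n - i)); rewrite ?mdeg_mn ?subnKC.
Qed.

Lemma is_ord_uniq f n n' : is_ord f n -> is_ord f n' -> n = n'.
Proof.
move=> [h0 [m md fm]] [h0' [m' md' fm']].
case: (ltngtP n n') => // lt.
  by move: fm; rewrite h0' ?eqxx // md.
by move: fm'; rewrite h0 ?eqxx // md'.
Qed.

Lemma ordE f n : is_ord f n -> ord f = n.
Proof.
move=> h; rewrite /ord; case: pselect => [e|[]]; last by exists n; apply/asboolP.
by case: ex_minnP => k /asboolP hk _; apply: is_ord_uniq hk h.
Qed.

Lemma ordP f : f != 0 -> is_ord f (ord f).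
Proof.
move=> f0; rewrite /ord; case: pselect => [e|[]].
  by case: ex_minnP => k /asboolP.
have [m fm] : exists m, f m != 0.
  apply: contrapT => h; case/eqP: f0; apply: mpserP => m; rewrite ser0.
  by apply/eqP; apply: contrapT => /negP hm; apply: h; exists m.
have ex : exists k, `[< exists2 m, mdeg m = k & f m != 0 >].
  by exists (mdeg m); apply/asboolP; exists m.
case: (ex_minnP ex) => k /asboolP[m' mk fm'] kmin.
exists k; apply/asboolP; split; last by exists m'.
move=> l lk; apply/eqP; apply: contrapT => /negP fl.
by have := kmin (mdeg l); rewrite leqNgt lk => /implyP; rewrite implybF => /negP; apply; apply/asboolP; exists l.
Qed.

Lemma ord_low f i j : (i + j < ord f)%N -> cf f i j = 0.
Proof.
have [->|/ordP/is_ordE[h _]] := eqVneq f 0; [by rewrite cf0|exact: h].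
Qed.

Lemma ord_le f i j : cf f i j != 0 -> (ord f <= i + j)%N.
Proof. by move=> fij; rewrite leqNgt; apply: contra fij => /ord_low ->. Qed.

Lemma ord_ge f n : f != 0 -> (forall i j, (i + j < n)%N -> cf f i j = 0) -> (n <= ord f)%N.
Proof.
move=> /ordP/is_ordE[_ [i ij fij]] h; rewrite leqNgt; apply/negP => lt.
by rewrite h ?eqxx // subnKC in fij.
Qed.

(* The initial form at x = 1, whose roots are the slopes of the tangents. *)
Definition cone f : {poly K} := \poly_(l < (ord f).+1) cf f (ord f - l) l.

Lemma cone_neq0 f : f != 0 -> cone f != 0.
Proof.
move=> /ordP/is_ordE[_ [i ij fij]]; apply/eqP => /polyP /(_ (ord f - i)%N).
by rewrite coef_poly coef0 ltnS leq_subr subKn // => e; rewrite e eqxx in fij.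
Qed.

Lemma cf_init f i j : cf (init_form f) i j = if (i + j == ord f)%N then cf f i j else 0.
Proof. by rewrite /cf /= mdeg_mn. Qed.

Lemma coneE f c : (cone f).[c] = \sum_(l < (ord f).+1) cf f (ord f - l) l * c ^+ l.
Proof. exact: horner_poly. Qed.

Lemma cf_linM c f i j : cf ((serY K - ser_const 2 c * serX K) * f) i j =
  (if j is j'.+1 then cf f i j' else 0) - c * (if i is i'.+1 then cf f i' j else 0).
Proof. by rewrite mulrBl -mulrA cfB cf_YM cf_constM cf_XM. Qed.

Lemma tangent_slopeE f c : tangent_slope f c <-> root (cone f) c.
Proof.
rewrite /tangent_slope rootE coneE; set n := ord f; split=> [[w hw]|/eqP hr].
  (* If [w] is the quotient by [y - c x], the terms of the value of the cone at [c] telescope. *)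
  apply/eqP; pose t l := if l is l'.+1 then cf w (n - l) l' * c ^+ l else 0.
  have E (l : 'I_n.+1) : cf f (n - l) l * c ^+ l = t l - t l.+1 *+ (l < n).
    have ln := ltn_ord l; have := cf_init f (n - l) l; rewrite subnK // eqxx => <-.
    rewrite hw cf_linM mulrBl; congr (_ - _); first by rewrite /t; case: (nat_of_ord l); rewrite ?mul0r.
    rewrite /t; case: ltnP => [lt|ge]; last by rewrite (eqP (_ : n - l == 0)%N) ?subn_eq0 // mulr0 mul0r mulr0n.
    by rewrite -[(n - l)%N]subSS subSn //= mulr1n exprS; ring.
  under eq_bigr do rewrite E.
  rewrite sumrB big_ord_recl add0r [X in _ - X]big_ord_recr /= ltnn mulr0n addr0.
  by rewrite -sumrB big1 // => l _; rewrite /= /bump leq0n add1n ltn_ord mulr1n subrr.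
(* The coefficients of the quotient of the cone by [y - c], as in Horner's scheme; homogenized in
   degree [n - 1] they give the quotient of the initial form. *)
pose s j := \sum_(l < n.+1 | (j < l)%N) cf f (n - l) l * c ^+ (l - j.+1).
have sS j : (j < n)%N -> s j = cf f (n - j.+1) j.+1 + c * s j.+1.
  move=> jn; rewrite /s (bigD1 (Ordinal (_ : j.+1 < n.+1)%N)) //= subnn expr0 mulr1; congr (_ + _).
  rewrite mulr_sumr; apply: eq_big => [l|l /andP[jl ne]].
    by rewrite -val_eqE /= [RHS]ltn_neqAle eq_sym andbC.
  have lt : (j.+1 < l)%N.
    by rewrite ltn_neqAle jl andbT; apply: contra ne => /eqP e; apply/eqP/val_inj.
  by rewrite mulrCA -exprS -subSn.
have sn : s n = 0 by rewrite /s big1 // => l; rewrite ltnNge -ltnS ltn_ord.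
exists (mk (fun i j => if (i + j.+1 == n)%N then s j else 0)).
apply: cfP => i j; rewrite cf_init cf_linM -/n.
case: i j => [|i] [|j]; rewrite ?cf_mk ?add0n ?addn0 ?mulr0 ?subr0 ?sub0r.
- by case: eqP => // n0; move: hr; rewrite -n0 big_ord1 expr0 mulr1 subn0.
- case: eqP => // jn; rewrite sS; last by rewrite -jn.
  by rewrite jn sn mulr0 addr0 subnn.
- rewrite addn1; case: eqP => [e|_]; last by rewrite mulr0 oppr0.
  rewrite e; apply/eqP; rewrite -addr_eq0; apply/eqP; rewrite -[RHS]hr big_ord_recl /= subn0 expr0 mulr1.
  congr (_ + _); rewrite /s big_mkcond big_ord_recl /= add0r mulr_sumr.
  by apply: eq_bigr => l _; rewrite /bump leq0n add1n subSS subn0 mulrCA -exprS.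
- rewrite [(i + _)%N]addnS -[(i + j.+1).+1]addSn; case: eqP => [e|_]; last by rewrite mulr0 subr0.
  rewrite sS; last by lia.
  by rewrite addrK; congr (cf f _ _); lia.
Qed.

Lemma tangent_verticalE f : tangent_vertical f <-> cf f 0 (ord f) = 0.
Proof.
split=> [[w /(congr1 (fun g => cf g 0 (ord f)))]|f0].
  by rewrite cf_init add0n eqxx cf_XM.
exists (mk (fun i j => cf (init_form f) i.+1 j)); apply: cfP => i j; rewrite cf_XM cf_init.
by case: i => [|i]; [case: eqP => // e; rewrite -f0 -e|rewrite cf_mk cf_init].
Qed.

Definition disc f : K := cf f 1 1 ^+ 2 - 4 * cf f 2 0 * cf f 0 2.

(** Decidable form of [smooth f \/ node f]. The discriminant of the quadratic part detects distinct
    factors in characteristic 2 as well, where it is the square of the mixed coefficient. *)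
Definition isbase f : bool := (ord f == 1%N) || (ord f == 2) && (disc f != 0).

Lemma cf_max2 f g : cf f 0 0 = 0 -> cf g 0 0 = 0 ->
  [/\ forall i j, (i + j < 2)%N -> cf (f * g) i j = 0,
      cf (f * g) 2 0 = cf f 1 0 * cf g 1 0,
      cf (f * g) 1 1 = cf f 1 0 * cf g 0 1 + cf f 0 1 * cf g 1 0 &
      cf (f * g) 0 2 = cf f 0 1 * cf g 0 1].
Proof.
move=> f0 g0; split; last 3 first.
- by rewrite cfM !big_ord_recl !big_ord0 /= /bump /= f0 g0; ring.
- by rewrite cfM !big_ord_recl !big_ord0 /= /bump /= f0 g0; ring.
- by rewrite cfM !big_ord_recl !big_ord0 /= /bump /= f0 g0; ring.
have h h' : cf h' 0 0 = 0 -> ordge 1 h' by move=> h0; apply/ordge1P; rewrite -mn00.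
by apply/(ordge2P 2); apply: (@ordgeM _ _ 1 1); apply: h.
Qed.

(** Coordinates [u], [v] generate the same ideal as [x], [y], so the determinant [D] of their linear
    parts is nonzero, and the discriminant of [e u v] is [e(0)^2 D^2]. *)
Lemma node_disc f : node f -> ord f = 2 /\ disc f != 0.
Proof.
move=> [u [v [e [gen ue fe]]]].
have XY00 z : ideal2 (serX K) (serY K) z -> cf z 0 0 = 0.
  by move=> /ideal2P[a [b ->]]; rewrite cfD mulrC cf_XM mulrC cf_YM addr0.
have u0 : cf u 0 0 = 0 by apply/XY00/gen/ideal2P; exists 1, 0; ring.
have v0 : cf v 0 0 = 0 by apply/XY00/gen/ideal2P; exists 0, 1; ring.
have /gen/ideal2P[a [b X]] : ideal2 (serX K) (serY K) (serX K).
  by apply/ideal2P; exists 1, 0; ring.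
have /gen/ideal2P[c [d Y]] : ideal2 (serX K) (serY K) (serY K).
  by apply/ideal2P; exists 0, 1; ring.
have lin (p q r s z : mpser K 2) i j : (i + j = 1)%N -> cf q 0 0 = 0 -> cf s 0 0 = 0 -> z = p * q + r * s ->
    cf z i j = cf p 0 0 * cf q i j + cf r 0 0 * cf s i j.
  move=> ij q0 s0 ->; rewrite cfD !cfM.
  by case: i j ij => [|[|//]] [|[|//]] // _; rewrite !big_ord_recl !big_ord0 /= /bump /= q0 s0; ring.
pose D := cf u 1 0 * cf v 0 1 - cf u 0 1 * cf v 1 0.
have D0 : D != 0.
  apply/eqP => D0.
  have := lin _ _ _ _ _ 1%N 0%N erefl u0 v0 X; have := lin _ _ _ _ _ 0%N 1%N erefl u0 v0 X.
  have := lin _ _ _ _ _ 1%N 0%N erefl u0 v0 Y; have := lin _ _ _ _ _ 0%N 1%N erefl u0 v0 Y.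
  rewrite !serX_mono !serY_mono !cf_mono !eqxx !mulr1n /= => y01 y10 x01 x10.
  have ee : (cf a 0 0 * cf d 0 0 - cf b 0 0 * cf c 0 0) * D =
      (cf a 0 0 * cf u 1 0 + cf b 0 0 * cf v 1 0) * (cf c 0 0 * cf u 0 1 + cf d 0 0 * cf v 0 1) -
      (cf a 0 0 * cf u 0 1 + cf b 0 0 * cf v 0 1) * (cf c 0 0 * cf u 1 0 + cf d 0 0 * cf v 1 0).
    by rewrite /D; ring.
  move: ee; rewrite -x10 -y01 -x01 -y10 D0 mulr0 mul0r subr0 mulr1 => /esym/eqP.
  by rewrite oner_eq0.
have [w /(congr1 (fun z : mpser K 2 => cf z 0 0))] := ue.
rewrite cf1 cfM !big_ord1 /= => ew.
have e0 : cf e 0 0 != 0 by apply/eqP => e0; move/eqP: ew; rewrite e0 mul0r oner_eq0.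
have [lo h20 h11 h02] := cf_max2 u0 v0.
have {}lin z i j : (i + j <= 2)%N -> (forall i j, (i + j < 2)%N -> cf z i j = 0) -> cf (e * z) i j = cf e 0 0 * cf z i j.
  move=> ij z0; rewrite cfM; case: i ij => [|[|[|//]]]; case: j => [|[|[|//]]] //= _;
  by rewrite !big_ord_recl !big_ord0 /= /bump /= ?(z0 0%N 0%N) ?(z0 1%N 0%N) ?(z0 0%N 1%N) //; ring.
rewrite -mulrA in fe.
have dE : disc f = cf e 0 0 ^+ 2 * D ^+ 2.
  by rewrite /disc fe !lin // h20 h11 h02 /D; ring.
have d0 : disc f != 0 by rewrite dE mulf_neq0 ?expf_neq0.
split=> //; apply: ordE; apply/is_ordE; split.
  by move=> i j ij; rewrite fe lin ?lo ?mulr0 // ltnW.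
apply: contrapT => h; case/eqP: d0; rewrite /disc.
have z i : (i <= 2)%N -> cf f i (2 - i) = 0.
  by move=> i2; apply/eqP; apply: contrapT => /negP hi; apply: h; exists i.
have z1 : cf f 1 1 = 0 := z 1%N isT; have z2 : cf f 2 0 = 0 := z 2 isT.
by rewrite z1 z2; ring.
Qed.

(** The quadratic part splits into independent linear forms [l1], [l2], and the factorization is
    lifted to [f = (l1 + a)(l2 + b)] with corrections of order at least 2. This requires
    [l1 b + l2 a + a b] to equal the rest [res], which is solved for [w = l1 b + l2 a]. *)
Lemma disc_node f : ord f = 2 -> disc f != 0 -> node f.
Proof.
move=> o2 d0.
have [p [q [r [s [fp fq fr D0]]]]] : exists p q r s,
   [/\ cf f 2 0 = p * r, cf f 1 1 = p * s + q * r, cf f 0 2 = q * s & p * s - q * r != 0].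
  have [f20|f20] := eqVneq (cf f 2 0) 0.
    exists 0, 1, (cf f 1 1), (cf f 0 2); rewrite f20; split; try by ring.
    move: d0; rewrite /disc f20 mulr0 mul0r subr0 expf_eq0 /= => d1.
    by rewrite sub0r mul1r oppr_eq0.
  pose P : {poly K} := Poly [:: cf f 0 2; cf f 1 1; cf f 2 0].
  have sP : size P = 3 by rewrite (PolyK (c := 0)).
  have [t /rootP] : exists t, root P t by apply/closed_rootP; rewrite sP.
  rewrite horner_Poly /= mul0r add0r => ht.
  move: d0; rewrite /disc; move: ht f20.
  set A := cf f 2 0; set B := cf f 1 1; set C := cf f 0 2 => ht A0 d0.
  have [u Bu] : exists u, B = A * u by exists (B / A); rewrite mulrCA divff ?mulr1.
  have CE : C = - ((A * t + B) * t) by apply/eqP; rewrite -addr_eq0 addrC; apply/eqP.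
  exists A, (- A * t), 1, (u + t); split; try by rewrite ?CE ?Bu; ring.
  apply: contra d0 => /eqP e0; have -> : B ^+ 2 - 4 * A * C = (A * (u + t) - - A * t * 1) ^+ 2.
    by rewrite CE Bu; ring.
  by rewrite e0 expr0n.
pose C := @ser_const K 2; pose X := serX K; pose Y := serY K.
pose l1 := C p * X + C q * Y; pose l2 := C r * X + C s * Y.
pose D := p * s - q * r.
pose zx (z : mpser K 2) : mpser K 2 := mk (fun i j => cf z i.+1 j).
pose zy (z : mpser K 2) : mpser K 2 := mk (fun i j => if i is 0%N then cf z 0 j.+1 else 0).
have zE z : cf z 0 0 = 0 -> z = X * zx z + Y * zy z.
  move=> z0; apply: cfP => i j; rewrite cfD cf_XM cf_YM.
  by case: i => [|i]; case: j => [|j]; rewrite /= ?addr0 ?add0r.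
pose E1 z := C D^-1 * (C s * zx z - C r * zy z).
pose E2 z := C D^-1 * (C p * zy z - C q * zx z).
have zxB z w : zx (z - w) = zx z - zx w by apply: cfP.
have zyB z w : zy (z - w) = zy z - zy w.
  by apply: cfP => -[|i] j; rewrite cfB !cf_mk // subrr.
have E1B z w : E1 (z - w) = E1 z - E1 w by rewrite /E1 zxB zyB; ring.
have E2B z w : E2 (z - w) = E2 z - E2 w by rewrite /E2 zxB zyB; ring.
have zxo t z : ordge t.+1 z -> ordge t (zx z).
  by move=> /ordge2P h; apply/ordge2P => i j ij; rewrite cf_mk h.
have zyo t z : ordge t.+1 z -> ordge t (zy z).
  by move=> /ordge2P h; apply/ordge2P => -[|i] j ij; rewrite cf_mk // h.
have E1o t z : ordge t.+1 z -> ordge t (E1 z).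
  by move=> h; apply/ordgeMl/ordgeB; apply: ordgeMl; [apply: zxo|apply: zyo].
have E2o t z : ordge t.+1 z -> ordge t (E2 z).
  by move=> h; apply/ordgeMl/ordgeB; apply: ordgeMl; [apply: zyo|apply: zxo].
have CD : C D^-1 * C D = 1 by rewrite /C -rmorphM mulVf // rmorph1.
have CDE : C D = C p * C s - C q * C r by rewrite /C /D rmorphB !rmorphM.
have E12 z : cf z 0 0 = 0 -> z = l1 * E1 z + l2 * E2 z.
  move=> z0; rewrite {1}(zE z z0) -[LHS]mul1r -CD CDE /l1 /l2 /E1 /E2; ring.
(* Cutting off the terms of order below 3 makes [T] a contraction on all series, not only on those
   of order at least 3. *)
pose P3 (z : mpser K 2) : mpser K 2 := mk (fun i j => if (i + j < 3)%N then 0 else cf z i j).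
have P3o z : ordge 3 (P3 z) by apply/ordge2P => i j ij; rewrite cf_mk ij.
have P3B t z w : ordge t (z - w) -> ordge t (P3 z - P3 w).
  move=> /ordge2P h; apply/ordge2P => i j ij; rewrite cfB !cf_mk.
  by case: ifP => _; [rewrite subrr|rewrite -cfB h].
have P3id z : ordge 3 z -> P3 z = z.
  by move=> /ordge2P h; apply: cfP => i j; rewrite cf_mk; case: ifP => // /h ->.
pose res := f - l1 * l2.
have l10 : cf l1 0 0 = 0 by rewrite cfD !cf_constM /X /Y serX_mono serY_mono !cf_mono /= !mulr0 addr0.
have l20 : cf l2 0 0 = 0 by rewrite cfD !cf_constM /X /Y serX_mono serY_mono !cf_mono /= !mulr0 addr0.
have lc a b : (cf (C a * X + C b * Y) 1 0 = a) * (cf (C a * X + C b * Y) 0 1 = b).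
  by rewrite !cfD !cf_constM /X /Y serX_mono serY_mono !cf_mono /= !mulr0 !mulr1 addr0 add0r.
have reso : ordge 3 res.
  have [lo h20 h11 h02] := cf_max2 l10 l20.
  apply/ordge2P => i j ij; rewrite cfB; have [lt|ge] := ltnP (i + j) 2.
    by rewrite lo // ord_low ?subrr // o2.
  have {ij ge} : (i + j = 2)%N by lia.
  case: i => [|[|[|//]]]; case: j => [|[|[|//]]] // _; rewrite ?h20 ?h11 ?h02 !lc.
  - by rewrite fr subrr.
  - by rewrite fq subrr.
  - by rewrite fp subrr.
(* Here [E1] and [E2] give the coordinates of a series in the basis [l1], [l2], so [b = E1 w] and
   [a = E2 w]. Each of them lowers the order by 1 only, hence their product gains an order on terms
   of order at least 3. *)
pose T w := res - E2 (P3 w) * E1 (P3 w).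
have hT : contraction T.
  move=> [|t] z w h; first by apply: ordgeB; apply: ordgeB; [apply: ordge_le reso|apply: ordgeMl; apply: ordge_le (E1o _ _ (P3o _))|apply: ordge_le reso|apply: ordgeMl; apply: ordge_le (E1o _ _ (P3o _))].
  have -> : T z - T w = - (E2 (P3 z - P3 w) * E1 (P3 z) + E2 (P3 w) * E1 (P3 z - P3 w)).
    by rewrite /T E1B E2B; ring.
  apply: ordgeN; apply: ordgeD.
    by rewrite -[t.+2]addn2; apply: ordgeM; [apply/E2o/P3B|apply/E1o/P3o].
  by rewrite -[t.+2]add2n; apply: ordgeM; [apply/E2o/P3o|apply/E1o/P3B].
pose w := ser_fix T.
have wE : w = res - E2 (P3 w) * E1 (P3 w) by rewrite {1}/w -(ser_fixP hT).
have wo : ordge 3 w.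
  rewrite wE; apply: ordgeB => //; apply: (@ordge_le _ _ 3 4) => //.
  by apply: (@ordgeM _ _ 2 2); [apply/E2o/P3o|apply/E1o/P3o].
rewrite P3id // in wE.
pose a := E2 w; pose b := E1 w.
have ao : ordge 2 a by apply: E2o. have bo : ordge 2 b by apply: E1o.
have fE : f = 1 * (l1 + a) * (l2 + b).
  have w0 : cf w 0 0 = 0 by apply: (ordge2P 3 w).1.
  have := E12 w w0; rewrite -/a -/b {1}wE -/a -/b => e.
  have -> : f = res - a * b + l1 * l2 + a * b by rewrite /res; ring.
  by rewrite e; ring.
exists (l1 + a), (l2 + b), 1; split=> //; last by exists 1; rewrite mulr1.
have a0 : cf a 0 0 = 0 by apply: (ordge2P 2 a).1.
have b0 : cf b 0 0 = 0 by apply: (ordge2P 2 b).1.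
have lE z : ordge 2 z -> [/\ z = X * zx z + Y * zy z, cf (zx z) 0 0 = 0 & cf (zy z) 0 0 = 0].
  by move=> /ordge2P h; split; [apply: zE; apply: h|rewrite cf_mk h|rewrite cf_mk h].
have [ea ax0 ay0] := lE _ ao; have [eb bx0 by0] := lE _ bo.
(* The determinant of the matrix that expresses the new coordinates in [x] and [y]. Its constant
   term is [p s - q r], so Cramer's rule shows that they generate the same ideal. *)
pose dl := (C p + zx a) * (C s + zy b) - (C q + zy a) * (C r + zx b).
have [di ddi] : exists G, dl * G = 1.
  have h0 (F : mpser K 2) : F 0%MM = cf F 0 0 by rewrite /cf mn00.
  apply: (@ser_inv _ _ dl D^-1); rewrite /dl serB !serM0 !serD !h0 ax0 ay0 bx0 by0 !addr0.
  by rewrite /C !cf_const !mulr1n mulfV.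
have uE : l1 + a = (C p + zx a) * X + (C q + zy a) * Y by rewrite {1}ea /l1; ring.
have vE : l2 + b = (C r + zx b) * X + (C s + zy b) * Y by rewrite {1}eb /l2; ring.
move=> z; split=> /ideal2P[x [y ->]]; apply/ideal2P.
  rewrite -/X -/Y uE vE; exists (x * (C p + zx a) + y * (C r + zx b)), (x * (C q + zy a) + y * (C s + zy b)); ring.
exists (di * (x * (C s + zy b) - y * (C r + zx b))), (di * (y * (C p + zx a) - x * (C q + zy a))).
have -> : x * serX K + y * serY K = dl * di * (x * X + y * Y) by rewrite ddi mul1r.
by rewrite uE vE /dl; ring.
Qed.

Lemma baseE f : smooth f \/ node f <-> isbase f.
Proof.
rewrite /smooth /isbase; split.
  by case=> [->//|/node_disc[-> ->]].
by case/orP => [/eqP|/andP[/eqP o2 d0]]; [left|right; apply: disc_node].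
Qed.

End PlaneSeries.

(** * Equisingularity in terms of lifts to K[[s]] *)

Section Eval0.
Variables (K : fieldType) (N : nat).
Definition ev0 (r : mpser K N) : K := r 0%MM.
Lemma ev0_is_additive : {morph ev0 : x y / x - y}. Proof. by []. Qed.
Lemma ev0_is_multiplicative : monoid_morphism ev0.
Proof. by split=> [|x y]; [rewrite /ev0 ser1 eqxx|exact: serM0]. Qed.
HB.instance Definition _ := GRing.isZmodMorphism.Build (mpser K N) K ev0 ev0_is_additive.
HB.instance Definition _ := GRing.isMonoidMorphism.Build (mpser K N) K ev0 ev0_is_multiplicative.
Lemma ev0_surj (c : K) : exists r, ev0 r = c.
Proof. by exists (ser_const N c); rewrite /ev0 ser_constE eqxx. Qed.
Lemma ev0_const (c : K) : ev0 (ser_const N c) = c.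
Proof. by rewrite /ev0 ser_constE eqxx. Qed.
End Eval0.

Section MapTransforms.
Variables (A B : comNzRingType) (u : {rmorphism A -> B}).
Local Notation mp := (@map_ser A B 2 u).

Let mpE F i j : cf (mp F) i j = u (cf F i j). Proof. by []. Qed.

Lemma mp_slopeS c F : mp (slopeS c F) = slopeS (u c) (mp F).
Proof.
apply: cfP => i j; rewrite mpE !cf_slopeS rmorph_sum.
by apply: eq_bigr => l _; rewrite !rmorphM rmorphXn rmorph_nat.
Qed.
Lemma mp_slopeT n c F : mp (slopeT n c F) = slopeT n (u c) (mp F).
Proof.
apply: cfP => i j; rewrite mpE !cf_mk.
by case: i => [|i]; rewrite ?rmorph0 // -mp_slopeS.
Qed.
Lemma mp_vertS F : mp (vertS F) = vertS (mp F).
Proof.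
apply: cfP => i j; rewrite mpE !cf_vertS.
by case: ifP; rewrite ?rmorph0.
Qed.
Lemma mp_vertT n F : mp (vertT n F) = vertT n (mp F).
Proof.
apply: cfP => i j; rewrite mpE !cf_mk.
by case: j => [|j]; rewrite ?rmorph0 // -mp_vertS.
Qed.
End MapTransforms.

Section Children.
Variable K : closedFieldType.
Implicit Types (f g : mpser K 2) (c : K).

Lemma coef_expXaddC c p i : (('X + c%:P) ^+ p)`_i = ('C(p, i))%:R * c ^+ (p - i).
Proof.
elim: p i => [|p IH] i.
  by rewrite expr0 coef1 bin0n sub0n mulr1 eq_sym.
rewrite exprS mulrDl coefD coefXM coefCM; case: i => [|i].
  by rewrite add0r IH !bin0 !subn0 !mul1r exprS.
rewrite !IH binS natrD mulrDl subSS addrC; congr (_ + _).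
case: (ltnP i p) => [ip|pi].
  by rewrite mulrCA -exprS subnSK.
by rewrite bin_small // !mul0r mulr0.
Qed.

Lemma slopeT_cone f c j : cf (slopeT (ord f) c f) 1 j = (cone f \Po ('X + c%:P))`_j.
Proof.
rewrite cf_mk add0n cf_slopeS /cone poly_def linear_sum coef_sum.
apply: eq_bigr => l _; rewrite linearZ /= coefZ comp_Xn_poly mulrC; congr (_ * _).
by rewrite coef_expXaddC.
Qed.

Lemma comp_XaddC_neq0 (p : {poly K}) c : p != 0 -> p \Po ('X + c%:P) != 0.
Proof. by move=> p0; rewrite comp_poly_eq0 // size_XaddC. Qed.

Lemma slopeT_row0 n f c j : cf (slopeT n c f) 0 j = 0. Proof. by []. Qed.

(* The multiplicity of c as a root of the cone is the intersection
   multiplicity of the strict transform with the new exceptional curve. *)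
Lemma slopeT_row1 f c : f != 0 -> root (cone f) c -> exists k,
  [/\ (0 < k <= ord f)%N, cf (slopeT (ord f) c f) 1 k != 0 &
      forall j, (j < k)%N -> cf (slopeT (ord f) c f) 1 j = 0].
Proof.
move=> f0 rc; set g := slopeT _ _ _.
have ex : exists k, cf g 1 k != 0.
  apply: contrapT => h; case/eqP: (comp_XaddC_neq0 c (cone_neq0 f0)).
  apply/polyP => j; rewrite -slopeT_cone coef0; apply/eqP; apply: contrapT => /negP hj.
  by apply: h; exists j.
case: (ex_minnP ex) => k gk kmin; exists k; split=> //; last first.
  by move=> j jk; apply/eqP; apply: contrapT => /negP /kmin; rewrite leqNgt jk.
apply/andP; split.
  rewrite lt0n; apply: contra gk => /eqP ->.
  by rewrite slopeT_cone -horner_coef0 horner_comp !hornerE (rootP rc).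
rewrite leqNgt; apply: contra gk => kn; rewrite slopeT_cone nth_default //.
rewrite size_comp_poly2 ?size_XaddC //; apply: leq_trans (size_poly _ _) _; exact: kn.
Qed.

(** The total transform is [x] times a series that vanishes at the new point, since [c] is a root of
    the cone. *)
Lemma slopeT_ord f c : f != 0 -> root (cone f) c ->
  slopeT (ord f) c f != 0 /\ (2 <= ord (slopeT (ord f) c f))%N.
Proof.
move=> f0 rc; have [k [/andP[k0 _] gk g0]] := slopeT_row1 f0 rc.
have nz : slopeT (ord f) c f != 0 by apply: contra gk => /eqP ->; rewrite cf0.
split=> //; apply: ord_ge => // i j ij.
case: i ij => [|[|//]] ij; first by rewrite slopeT_row0.
by apply: g0; case: j ij.
Qed.

Lemma vertT_col0 n f i : cf (vertT n f) i 0 = 0. Proof. by []. Qed.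

Lemma vertT_col1 f i : (i <= ord f)%N -> cf (vertT (ord f) f) i 1 = cf f i (ord f - i).
Proof. by move=> h; rewrite cf_mk add0n cf_vertS h. Qed.

Lemma vertT_ord f : f != 0 -> cf f 0 (ord f) = 0 ->
  vertT (ord f) f != 0 /\ (2 <= ord (vertT (ord f) f))%N.
Proof.
move=> f0 fv; have /is_ordE[_ [i io fi]] := ordP f0.
have nz : vertT (ord f) f != 0.
  by apply: contra fi => /eqP e; rewrite -vertT_col1 // e cf0.
split=> //; apply: ord_ge => // k j kj.
case: j kj => [|[|j]] kj; [by rewrite vertT_col0| |lia].
by case: k kj => [|k] kj; [rewrite vertT_col1 ?subn0|lia].
Qed.

End Children.

Section RelativeES.
Variables (K : closedFieldType) (N : nat).
Local Notation R := (mpser K N).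
Implicit Types (F G T : mpser R 2).

Definition sp F : mpser K 2 := map_ser (@ev0 K N) F.
Lemma cf_sp F i j : cf (sp F) i j = ev0 (cf F i j). Proof. by []. Qed.

Lemma sp_slopeT n c F : sp (slopeT n (ser_const N c) F) = slopeT n c (sp F).
Proof. by rewrite /sp mp_slopeT; congr slopeT; apply: ev0_const. Qed.
Lemma sp_vertT n F : sp (vertT n F) = vertT n (sp F).
Proof. exact: mp_vertT. Qed.
Lemma sp_PhiX a F : ordge 1 a -> sp (PhiX a F) = sp F.
Proof. by move=> ha; apply: cfP => i j; rewrite !cf_sp /ev0 cf_PhiX0. Qed.
Lemma sp_PhiY a F : ordge 1 a -> sp (PhiY a F) = sp F.
Proof. by move=> ha; apply: cfP => i j; rewrite !cf_sp /ev0 cf_PhiY0. Qed.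
Lemma sp_Phi a b F : ordge 1 a -> ordge 1 b -> sp (Phi a b F) = sp F.
Proof. by move=> ha hb; rewrite /Phi sp_PhiX // sp_PhiY. Qed.

Definition low (J : R -> Prop) F : Prop :=
  forall i j, (i + j < ord (sp F))%N -> J (cf F i j).

(* Equisingularity modulo J of the family F along the trivial section. *)
Inductive ESR (J : R -> Prop) : mpser R 2 -> Prop :=
| ESRbase F of isbase (sp F) & low J F : ESR J F
| ESRblowup F (a b : K -> R) (a' b' : R) of ~~ isbase (sp F) & low J F &
   (forall c, root (cone (sp F)) c -> ordge 1 (a c) /\ ordge 1 (b c)) &
   (cf (sp F) 0 (ord (sp F)) = 0 -> ordge 1 a' /\ ordge 1 b') &
   (forall c, root (cone (sp F)) c ->
      ESR J (Phi (a c) (b c) (slopeT (ord (sp F)) (ser_const N c) F))) &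
   (cf (sp F) 0 (ord (sp F)) = 0 ->
      ESR J (Phi a' b' (vertT (ord (sp F)) F))) : ESR J F.

End RelativeES.

Section EquisingularInd.
Variables (K : closedFieldType) (B : comNzRingType) (iota : {rmorphism K -> B}).
Variable P : mpser K 2 -> mpser B 2 -> B -> B -> Prop.
Hypothesis Pbase : forall f F a b, smooth f \/ node f -> is_deformation iota f F ->
  is_section F a b -> equimultiple f F a b -> P f F a b.
Hypothesis Pblow : forall f F a b F', ~ (smooth f \/ node f) -> is_deformation iota f F ->
  is_section F a b -> equimultiple f F a b ->
  is_subst F (serX B + ser_const 2 a) (serY B + ser_const 2 b) F' ->
  (forall c, tangent_slope f c -> exists g G a' b',
      [/\ total_transform_slope (ord f) c f g,
          total_transform_slope (ord f) (iota c) F' G & P g G a' b']) ->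
  (tangent_vertical f -> exists g G a' b',
      [/\ total_transform_vertical (ord f) f g,
          total_transform_vertical (ord f) F' G & P g G a' b']) -> P f F a b.

(** The recursive occurrences of [equisingular] are nested under existential quantifiers and
    conjunctions, where the automatically generated principle gives no induction hypothesis. *)
Fixpoint equisingular_nested_ind f F a b (h : equisingular iota f F a b) : P f F a b :=
  match h in equisingular _ f F a b return P f F a b with
  | EquisingularBase _ _ _ _ h1 h2 h3 h4 => Pbase h1 h2 h3 h4
  | EquisingularBlowup _ _ _ _ _ h1 h2 h3 h4 h5 h6 h7 =>
      Pblow h1 h2 h3 h4 h5
        (fun c tc => match h6 c tc with
           ex_intro g (ex_intro G (ex_intro a' (ex_intro b' (And3 e1 e2 e3)))) =>
             ex_intro _ g (ex_intro _ G (ex_intro _ a' (ex_intro _ b'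
               (And3 e1 e2 (equisingular_nested_ind e3))))) end)
        (fun tv => match h7 tv with
           ex_intro g (ex_intro G (ex_intro a' (ex_intro b' (And3 e1 e2 e3)))) =>
             ex_intro _ g (ex_intro _ G (ex_intro _ a' (ex_intro _ b'
               (And3 e1 e2 (equisingular_nested_ind e3))))) end)
  end.
End EquisingularInd.

Section Link.
Variables (K : closedFieldType) (N : nat) (B : comNzRingType).
Local Notation R := (mpser K N).
Variable pi : {rmorphism R -> B}.
Hypothesis pi_surj : forall b, exists r, pi r = b.
Variable iota : {rmorphism K -> B}.
Hypothesis pi_const : forall c, pi (ser_const N c) = iota c.
Local Notation mp := (@map_ser R B 2 pi).
Local Notation S := (mpser B 2).

Let sepB := pow_sep pi_surj.
Let sepK := pow_sep (@ev0_surj K N).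

Lemma total_slope_uniq n (c : B) (F G : S) : (forall i j, (i + j < n)%N -> cf F i j = 0) ->
  total_transform_slope n c F G <-> G = slopeT n c F.
Proof.
move=> F0; split=> [[H hH]|->]; last first.
  by exists (slopeS c F); [apply: (slope_subst pi_surj)|apply: slopeTP].
by rewrite (is_subst_uniq sepB hH (slope_subst pi_surj c F)) -(slopeTP (n := n)) // => /serXn_inj.
Qed.
Lemma total_vert_uniq n (F G : S) : (forall i j, (i + j < n)%N -> cf F i j = 0) ->
  total_transform_vertical n F G <-> G = vertT n F.
Proof.
move=> F0; split=> [[H hH]|->]; last first.
  by exists (vertS F); [apply: (vert_subst pi_surj)|apply: vertTP].
by rewrite (is_subst_uniq sepB hH (vert_subst pi_surj F)) -(vertTP (n := n)) // => /serYn_inj.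
Qed.
Lemma total_slope_uniqK n (c : K) (f g : mpser K 2) : (forall i j, (i + j < n)%N -> cf f i j = 0) ->
  total_transform_slope n c f g <-> g = slopeT n c f.
Proof.
move=> F0; split=> [[H hH]|->]; last first.
  by exists (slopeS c f); [apply: (slope_subst (@ev0_surj K N))|apply: slopeTP].
by rewrite (is_subst_uniq sepK hH (slope_subst (@ev0_surj K N) c f)) -(slopeTP (n := n)) // => /serXn_inj.
Qed.
Lemma total_vert_uniqK n (f g : mpser K 2) : (forall i j, (i + j < n)%N -> cf f i j = 0) ->
  total_transform_vertical n f g <-> g = vertT n f.
Proof.
move=> F0; split=> [[H hH]|->]; last first.
  by exists (vertS f); [apply: (vert_subst (@ev0_surj K N))|apply: vertTP].
by rewrite (is_subst_uniq sepK hH (vert_subst (@ev0_surj K N) f)) -(vertTP (n := n)) // => /serYn_inj.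
Qed.

(** By uniqueness of substitutions, the transforms over [B] are the images of the lifted ones; only
    the sections are real data, and they are lifted arbitrarily along [pi]. *)
Lemma ESR_of_equisingular f (F : S) a b : equisingular iota f F a b ->
  forall Ft at' bt, mp Ft = F -> sp Ft = f -> pi at' = a -> pi bt = b ->
  f != 0 -> (0 < ord f)%N ->
  [/\ ordge 1 at', ordge 1 bt & ESR (ker pi) (Phi at' bt Ft)].
Proof.
have key g (G : S) a0 b0 : is_section G a0 b0 -> equimultiple g G a0 b0 ->
  forall Ft at' bt, mp Ft = G -> sp Ft = g -> pi at' = a0 -> pi bt = b0 ->
  [/\ ordge 1 at', ordge 1 bt, sp (Phi at' bt Ft) = g & low (ker pi) (Phi at' bt Ft)].
  move=> [ma mb _] em Ft at' bt eF ef ea eb.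
  have ha : ordge 1 at' by apply/ordge1P/(max_pi pi_surj); rewrite ea.
  have hb : ordge 1 bt by apply/ordge1P/(max_pi pi_surj); rewrite eb.
  have hs : sp (Phi at' bt Ft) = g by rewrite sp_Phi.
  split=> //; rewrite /low hs; apply/(equimult_Phi pi_surj ha hb).
  by rewrite eF ea eb.
elim/equisingular_nested_ind: F a b / => {f}.
  move=> f F a b bf _ sec em Ft at' bt eF ef ea eb _ _.
  have [ha hb hs hl] := key _ _ _ _ sec em _ _ _ eF ef ea eb.
  by split=> //; apply: ESRbase => //; rewrite hs; apply/baseE.
move=> f F a b F' nbf _ sec em sub hsl hv Ft at' bt eF ef ea eb f0 n0.
have [ha hb hs hl] := key _ _ _ _ sec em _ _ _ eF ef ea eb.
split=> //; move: hs hl; set T := Phi at' bt Ft => hs hl.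
have eF' : F' = mp T.
  by apply: (is_subst_uniq sepB sub); rewrite -eF -ea -eb; apply: (Phi_subst pi_surj).
have F'0 i j : (i + j < ord f)%N -> cf F' i j = 0.
  by rewrite -hs eF' => /hl.
have fl i j : (i + j < ord f)%N -> cf f i j = 0 by apply: ord_low.
(* [ESR] takes the sections as functions of the slope, so one has to be selected for each [c]; at
   slopes that are not tangents the value is a dummy. *)
have /choice[a1 h1] : forall c : K, exists ab : R * R, root (cone f) c ->
    [/\ ordge 1 ab.1, ordge 1 ab.2 & ESR (ker pi) (Phi ab.1 ab.2 (slopeT (ord f) (ser_const N c) T))].
  move=> c; have [rc|] := boolP (root (cone f) c); last by exists (0, 0).
  have [g [G [a' [b' [tg tG IH]]]]] := hsl c ((tangent_slopeE f c).2 rc).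
  move/(total_slope_uniqK _ _ fl): tg => eg; move/(total_slope_uniq _ _ F'0): tG => eG.
  have [at1 eat] := pi_surj a'; have [bt1 ebt] := pi_surj b'.
  have e1 : mp (slopeT (ord f) (ser_const N c) T) = G by rewrite mp_slopeT pi_const -eF' eG.
  have e2 : sp (slopeT (ord f) (ser_const N c) T) = g by rewrite sp_slopeT hs eg.
  have [g0 g2] := slopeT_ord f0 rc; rewrite -eg in g0 g2.
  by exists (at1, bt1) => _; apply: IH e1 e2 eat ebt g0 (ltnW g2).
have [a2 [b2 h2]] : exists a b : R, cf f 0 (ord f) = 0 ->
    [/\ ordge 1 a, ordge 1 b & ESR (ker pi) (Phi a b (vertT (ord f) T))].
  have [rc|] := pselect (cf f 0 (ord f) = 0); last by exists 0, 0.
  have [g [G [a' [b' [tg tG IH]]]]] := hv ((tangent_verticalE f).2 rc).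
  move/(total_vert_uniqK _ fl): tg => eg; move/(total_vert_uniq _ F'0): tG => eG.
  have [at1 eat] := pi_surj a'; have [bt1 ebt] := pi_surj b'.
  have e1 : mp (vertT (ord f) T) = G by rewrite mp_vertT -eF' eG.
  have e2 : sp (vertT (ord f) T) = g by rewrite sp_vertT hs eg.
  have [g0 g2] := vertT_ord f0 rc; rewrite -eg in g0 g2.
  by exists at1, bt1 => _; apply: IH e1 e2 eat ebt g0 (ltnW g2).
apply: (@ESRblowup _ _ _ _ (fun c => (a1 c).1) (fun c => (a1 c).2) a2 b2); rewrite ?hs //.
- by apply/negP => /baseE.
- by move=> c /h1[].
- by move=> /h2[].
- by move=> c /h1[].
- by move=> /h2[].
Qed.

(** The vertices of [ESR] are already translated to the trivial section whereas [equisingular] keeps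
    the section apart. Stating the claim for every presentation [T = Phi a b Ft] makes the induction
    pass. *)
Lemma equisingular_of_ESR T : ESR (ker pi) T ->
  forall Ft a b, T = Phi a b Ft -> ordge 1 a -> ordge 1 b ->
  sp Ft != 0 -> (0 < ord (sp Ft))%N ->
  equisingular iota (sp Ft) (mp Ft) (pi a) (pi b).
Proof.
have hdef Ft : is_deformation iota (sp Ft) (mp Ft).
  move=> m; rewrite -pi_const /= -rmorphB; apply/(max_pi pi_surj).
  by rewrite serB ser_constE eqxx mulr1n subrr.
have heq Ft a b : ordge 1 a -> ordge 1 b -> (0 < ord (sp Ft))%N -> low (ker pi) (Phi a b Ft) ->
    is_section (mp Ft) (pi a) (pi b) /\ equimultiple (sp Ft) (mp Ft) (pi a) (pi b).
  move=> ha hb n0 hl.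
  have em : equimultiple (sp Ft) (mp Ft) (pi a) (pi b).
    by apply/(equimult_Phi pi_surj ha hb) => i j ij; apply: hl; rewrite sp_Phi.
  split=> //; split; try by apply/(max_pi pi_surj)/ordge1P.
  by apply: (ideal_pow1 (ideal_gen_ideal _)); apply: ideal_pow_le em.
elim=> {T} [T bT lT|T a b a' b' nb lT ha hb _ IHs _ IHv] Ft a0 b0 eT ha0 hb0 f0 n0.
  rewrite eT in lT; have [sec em] := heq _ _ _ ha0 hb0 n0 lT.
  by apply: EquisingularBase => //; apply/baseE; rewrite -(sp_Phi Ft ha0 hb0) -eT.
rewrite eT in lT; have [sec em] := heq _ _ _ ha0 hb0 n0 lT.
have es : sp T = sp Ft by rewrite eT sp_Phi.
rewrite es in nb ha hb IHs IHv.
have T0 i j : (i + j < ord (sp Ft))%N -> cf (mp T) i j = 0.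
  by rewrite -es eT => /lT.
have fl i j : (i + j < ord (sp Ft))%N -> cf (sp Ft) i j = 0 by apply: ord_low.
apply: (@EquisingularBlowup _ _ _ _ _ _ _ (mp T)) => //.
- by move/baseE; apply/negP.
- by rewrite eT; apply: (Phi_subst pi_surj).
- move=> c /tangent_slopeE rc; have [ac bc] := ha c rc.
  pose Gt := slopeT (ord (sp Ft)) (ser_const N c) T.
  exists (sp Gt), (mp Gt), (pi (a c)), (pi (b c)).
  have sG : sp Gt = slopeT (ord (sp Ft)) c (sp Ft) by rewrite sp_slopeT es.
  have [g0 g2] := slopeT_ord f0 rc; rewrite -sG in g0 g2.
  split.
  + by apply/(total_slope_uniqK _ _ fl).
  + by apply/(total_slope_uniq _ _ T0); rewrite mp_slopeT pi_const.
  + exact: (IHs c rc Gt _ _ erefl ac bc g0 (ltnW g2)).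
- move=> /tangent_verticalE rc; have [ac bc] := hb rc.
  pose Gt := vertT (ord (sp Ft)) T.
  exists (sp Gt), (mp Gt), (pi a'), (pi b').
  have sG : sp Gt = vertT (ord (sp Ft)) (sp Ft) by rewrite sp_vertT es.
  have [g0 g2] := vertT_ord f0 rc; rewrite -sG in g0 g2.
  split.
  + by apply/(total_vert_uniqK _ fl).
  + by apply/(total_vert_uniq _ T0); rewrite mp_vertT.
  + exact: (IHv rc Gt _ _ erefl ac bc g0 (ltnW g2)).
Qed.
End Link.

(** * Sections through infinitely near points *)

Section Directional.
Variable A : comNzRingType.
Implicit Types (F : mpser A 2) (d : bool).

(* Coefficients, exchanging the roles of x and y when [d] holds. *)
Definition cfd d F i j : A := if d then cf F j i else cf F i j.

(** The transform at the infinitely near point through which the strict transform of the chosen axis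
    passes: the vertical chart for [x = 0], slope 0 for [y = 0]. The other axis is then the new
    exceptional curve. *)
Definition childT d n F : mpser A 2 := if d then slopeT n 0 F else vertT n F.

Lemma cfdC d F i j : cfd (~~ d) F i j = cfd d F j i. Proof. by case: d. Qed.

Lemma cfd_childT0 d n F i : cfd d (childT d n F) i 0 = 0.
Proof. by case: d. Qed.

Lemma cfd_childTS d n F i j : cfd d (childT d n F) i j.+1 =
  if (i <= j + n)%N then cfd d F i (j + n - i) else 0.
Proof.
case: d; rewrite /cfd /childT cf_mk ?cf_vertS // cf_slopeS.
have [ij|ij] := leqP.
  rewrite (bigD1 (Ordinal (_ : i < (j + n).+1)%N)) //= binn subnn expr0 !mul1r big1 ?addr0 // => l.
  rewrite -val_eqE /= => li; case: (ltngtP l i) li => // lt _.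
    by rewrite bin_small // !mul0r.
  by rewrite -[(l - i)%N]prednK ?subn_gt0 // expr0n /= mulr0 mul0r.
by rewrite big1 // => l _; rewrite bin_small ?mul0r // (leq_trans _ ij) // ltnS leq_ord.
Qed.

End Directional.

Section Uniqueness.
Variables (K : closedFieldType) (N : nat).
Local Notation R := (mpser K N).
Implicit Types (F G T : mpser R 2) (a b r u : R) (d : bool).

(** The parameter [a] moves the point off the axis selected by [d], and [b] moves it along this
    axis. *)
Definition Phid d a b F : mpser R 2 := if d then Phi b a F else Phi a b F.

Lemma PhidC d a b F : Phid (~~ d) a b F = Phid d b a F. Proof. by case: d. Qed.

Lemma cfd_Phid d a b F i j : ordge 1 a -> ordge 1 b -> cfd d (Phid d a b F) i j =
  asum a (fun l => ('C(i + l, i))%:R * asum b (fun l' => ('C(j + l', j))%:R * cfd d F (i + l) (j + l'))).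
Proof. by move=> ha hb; case: d; rewrite /cfd /Phid /Phi; [rewrite PhiC|]. Qed.

Lemma cfd_sp d F i j : cfd d (sp F) i j = ev0 (cfd d F i j). Proof. by case: d. Qed.
Lemma sp_Phid d a b F : ordge 1 a -> ordge 1 b -> sp (Phid d a b F) = sp F.
Proof. by move=> ha hb; case: d; rewrite /= sp_Phi. Qed.
Lemma sp_childT d n F : sp (childT d n F) = childT d n (sp F).
Proof. by case: d; rewrite /= ?sp_vertT // -sp_slopeT rmorph0. Qed.
Lemma ord_lowd d f i j : (i + j < ord f)%N -> cfd d f i j = 0 :> K.
Proof. by case: d => h; apply: ord_low; rewrite // addnC. Qed.
Lemma cfd_ord d f : f != 0 -> exists2 i, (i <= ord f)%N & cfd d f i (ord f - i) != 0 :> K.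
Proof.
move=> /ordP/is_ordE[_ [i ij fi]]; case: d; last by exists i.
by exists (ord f - i)%N; rewrite ?leq_subr // subKn.
Qed.

Lemma ideal_unit (C : R -> Prop) u a : is_ideal C -> u 0%MM != 0 -> C (a * u) -> C a.
Proof.
move=> hC u0 h; have [w uw] := ser_inv (divff u0).
by rewrite -[a]mulr1 -uw mulrA; apply: (ideal_mulr _ hC).
Qed.

Section FixedIdeal.
Variable J : R -> Prop.
Hypotheses (Jid : is_ideal J) (Jmax : forall r, J r -> r 0%MM = 0).

(** An infinite sum of elements of an ideal stays in it because ideals of K[[s]] are closed. *)
Lemma asum_ideal (C : R -> Prop) a g : is_ideal C -> ordge 1 a -> (forall k, C (g k)) -> C (asum a g).
Proof.
move=> hC ha hg; apply: ideal_closed => // t.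
exists (\sum_(k < t) a ^+ k * g k); last exact: asumE.
by apply: ideal_sum => // k _; apply: idealM.
Qed.

Lemma asum_modJ a g : J a -> J (asum a g - g 0%N).
Proof.
move=> ja; have ha : ordge 1 a by apply/ordge1P/Jmax.
by rewrite asumS // addrC addKr; apply: ideal_mulr.
Qed.

Lemma Phid_modJ d a b F i j : J a -> J b -> J (cfd d (Phid d a b F) i j - cfd d F i j).
Proof.
move=> ja jb; have ha : ordge 1 a by apply/ordge1P/Jmax.
have hb : ordge 1 b by apply/ordge1P/Jmax.
rewrite cfd_Phid //.
pose g l := ('C(i + l, i))%:R * asum b (fun l' => ('C(j + l', j))%:R * cfd d F (i + l) (j + l')).
rewrite -/(asum a g) -[asum a g](subrK (g 0%N)) -addrA; apply: (idealD Jid); first exact: asum_modJ.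
rewrite /g addn0 binn mul1r; pose g' l' := ('C(j + l', j))%:R * cfd d F i (j + l').
rewrite -/(asum b g'); have -> : cfd d F i j = g' 0%N by rewrite /g' addn0 binn mul1r.
exact: asum_modJ.
Qed.

Lemma Phi_cong a b F F' : ordge 1 a -> ordge 1 b ->
  (forall i j, J (cf F i j - cf F' i j)) -> forall i j, J (cf (Phi a b F) i j - cf (Phi a b F') i j).
Proof.
have E c (g g' : nat -> R) (n : nat -> nat) : ordge 1 c -> (forall k, J (g k - g' k)) ->
    J (asum c (fun l => (n l)%:R * g l) - asum c (fun l => (n l)%:R * g' l)).
  move=> hc h; have -> : asum c (fun l => (n l)%:R * g l) - asum c (fun l => (n l)%:R * g' l) =
      asum c (fun l => (n l)%:R * (g l - g' l)).
    apply/eqP; rewrite subr_eq -asumD //; apply/eqP; apply: asum_ext => k.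
    by rewrite -mulrDr subrK.
  by apply: asum_ideal => // k; apply: idealM.
move=> ha hb h i j; rewrite !cf_mk; apply: (E a) => // k.
by rewrite !cf_mk; apply: (E b).
Qed.

Lemma slopeT_cong n c F F' : (forall i j, J (cf F i j - cf F' i j)) ->
  forall i j, J (cf (slopeT n c F) i j - cf (slopeT n c F') i j).
Proof.
move=> h [|i] j; first by rewrite subrr; apply: ideal0.
rewrite -[cf (slopeT n c F) _ _]/(cf (slopeS c F) (i + n) j).
rewrite -[cf (slopeT n c F') _ _]/(cf (slopeS c F') (i + n) j).
rewrite !cf_slopeS -sumrB; apply: ideal_sum => // l _.
by rewrite -mulrBr; apply: idealM.
Qed.

Lemma vertT_cong n F F' : (forall i j, J (cf F i j - cf F' i j)) ->
  forall i j, J (cf (vertT n F) i j - cf (vertT n F') i j).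
Proof.
move=> h i [|j]; first by rewrite subrr; apply: ideal0.
rewrite -[cf (vertT n F) _ _]/(cf (vertS F) i (j + n)).
rewrite -[cf (vertT n F') _ _]/(cf (vertS F') i (j + n)).
by rewrite !cf_vertS; case: ifP => _ //; rewrite subrr; apply: ideal0.
Qed.

Lemma sp_cong F F' : (forall i j, J (cf F i j - cf F' i j)) -> sp F = sp F'.
Proof.
move=> h; apply: cfP => i j; rewrite !cf_sp; have /Jmax := h i j.
by rewrite serB => /eqP; rewrite subr_eq0 => /eqP.
Qed.

Lemma ESR_cong F F' : (forall i j, J (cf F i j - cf F' i j)) -> ESR J F -> ESR J F'.
Proof.
have hl G G' : (forall i j, J (cf G i j - cf G' i j)) -> low J G -> low J G'.
  move=> h l i j; rewrite -(sp_cong h) => /l jG.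
  by rewrite -[cf G' i j](subKr (cf G i j)); apply: idealB.
move=> h E; elim: E F' h => {F} [F bF lF|F a b a' b' nb lF ha hb _ IHs _ IHv] F' h.
  by apply: ESRbase; rewrite -?(sp_cong h) //; apply: hl h lF.
apply: (@ESRblowup _ _ _ _ a b a' b'); rewrite -?(sp_cong h) //.
- exact: hl h lF.
- move=> c rc; apply: (IHs c rc); have [h1 h2] := ha c rc; apply: Phi_cong => //; exact: slopeT_cong.
- move=> rc; apply: (IHv rc); have [h1 h2] := hb rc; apply: Phi_cong => //; exact: vertT_cong.
Qed.

Lemma ESR_low F : ESR J F -> low J F. Proof. by case. Qed.

Lemma root_cone0 (f : mpser K 2) : cfd true f 0 (ord f) = 0 -> root (cone f) 0.
Proof. by move=> h; rewrite rootE horner_coef0 coef_poly subn0 -[X in X == 0]/(cfd true f 0 (ord f)) h. Qed.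

(* k is the intersection multiplicity of the axis x = 0 (y = 0 when [d] holds)
   with the residual curve. *)
Definition axis_mult d (f : mpser K 2) k : Prop :=
  cfd d f 1 k != 0 /\ forall j, (j < k)%N -> cfd d f 1 j = 0.

(** The ideal [C + (a)]; its companion [mspan] is [C + m a]. Membership in the latter of an element
    that is a unit times [a] modulo [C] forces [a] into [C], which is the form of Nakayama's lemma
    used below. *)
Definition span (C : R -> Prop) a (z : R) : Prop := exists r, C (z - r * a).
Definition mspan (C : R -> Prop) a (z : R) : Prop := exists2 r : R, r 0%MM = 0 & C (z - r * a).

Lemma span_ideal C a : is_ideal C -> is_ideal (span C a).
Proof.
move=> hC; split.
- by exists 0; rewrite mul0r subr0; apply: ideal0.
- move=> x y [r hr] [s hs]; exists (r + s).
  by rewrite mulrDl opprD addrACA; apply: idealD.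
- move=> x y [r hr]; exists (x * r); rewrite -mulrA -mulrBr; exact: idealM.
Qed.
Lemma mspan_ideal C a : is_ideal C -> is_ideal (mspan C a).
Proof.
move=> hC; split.
- by exists 0; rewrite ?ser0 // mul0r subr0; apply: ideal0.
- move=> x y [r r0 hr] [s s0 hs]; exists (r + s); first by rewrite serD r0 s0 addr0.
  by rewrite mulrDl opprD addrACA; apply: idealD.
- move=> x y [r r0 hr]; exists (x * r); first by rewrite serM0 r0 mulr0.
  by rewrite -mulrA -mulrBr; apply: idealM.
Qed.
Lemma mspan_in (C : R -> Prop) a (z : R) : C z -> mspan C a z.
Proof. by move=> h; exists 0; rewrite ?ser0 // mul0r subr0. Qed.
Lemma mspan_span C a (z : R) : mspan C a z -> span C a z.
Proof. by case=> r _ h; exists r. Qed.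

(** The coefficients on the axis, known to lie in [C], improve to [D] up to the contact order [k].
    The ideals are kept abstract because passing to an infinitely near point enlarges both of them
    by the unknown section. The bound includes [k] itself: there the coefficient multiplying the
    transversal coordinate is a unit. *)
Definition axis_bound F : Prop := forall d (C D : R -> Prop) k, is_ideal C -> is_ideal D ->
  (forall z, J z -> D z) -> (forall z, D z -> C z) ->
  (forall r z : R, r 0%MM = 0 -> C z -> D (r * z)) ->
  (forall j, C (cfd d F 0 j)) -> (forall j, cfd d (sp F) 0 j = 0) ->
  axis_mult d (sp F) k -> forall j, (j <= k)%N -> D (cfd d F 0 j).

(** Expansion to second order in the transversal parameter [a]. The constant term of [V] is a
    coefficient of the residual curve on the axis, so the contact order decides where [V] is a
    unit. *)
Lemma cfd_Phid0 d a b G j : ordge 1 a -> ordge 1 b -> exists V W,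
  [/\ cfd d (Phid d a b G) 0 j = asum b (fun l' => ('C(j + l', j))%:R * cfd d G 0 (j + l')) + a * V,
      V = asum b (fun l' => ('C(j + l', j))%:R * cfd d G 1 (j + l')) + a * W &
      V 0%MM = cfd d (sp G) 1 j].
Proof.
move=> ha hb; rewrite cfd_Phid //.
pose g l := ('C(0 + l, 0))%:R * asum b (fun l' => ('C(j + l', j))%:R * cfd d G (0 + l) (j + l')).
have g0 : g 0%N = asum b (fun l' => ('C(j + l', j))%:R * cfd d G 0 (j + l')).
  by rewrite /g add0n binn mul1r.
have g1 : g 1%N = asum b (fun l' => ('C(j + l', j))%:R * cfd d G 1 (j + l')).
  by rewrite /g add0n bin0 mul1r.
exists (asum a (fun l => g l.+1)), (asum a (fun l => g l.+2)); split.
- by rewrite [LHS](asumS g ha) g0.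
- by rewrite asumS // g1.
- by rewrite asum_at0 // g1 asum_at0 // addn0 binn mul1r cfd_sp.
Qed.

(** On the axis the translated family vanishes modulo [J + (a)], so [axis_bound] puts its k-th
    coefficient in [J + m a]. Modulo [J] this coefficient is [a] times a unit. *)
Lemma section_on_axis d a b G k : ordge 1 a -> ordge 1 b -> axis_bound (Phid d a b G) ->
  (forall j, J (cfd d G 0 j)) -> axis_mult d (sp G) k -> J a.
Proof.
move=> ha hb ab G0 hk.
have sp0 j : cfd d (sp G) 0 j = 0 by rewrite cfd_sp; apply: Jmax.
have H0 j : J (asum b (fun l' => ('C(j + l', j))%:R * cfd d G 0 (j + l'))).
  by apply: asum_ideal => // l; apply: idealM.
have := ab d (span J a) (mspan J a) k (span_ideal _ Jid) (mspan_ideal _ Jid).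
rewrite !(sp_Phid d G ha hb).
have [V [W [TE _ V0]]] := cfd_Phid0 d G k ha hb.
move=> /(_ (@mspan_in _ _) (@mspan_span _ _)) h.
have {h} : mspan J a (cfd d (Phid d a b G) 0 k).
  apply: h => // [r z r0 [s hs]|j].
    by exists (r * s); rewrite ?serM0 ?r0 ?mul0r // -mulrA -mulrBr; apply: idealM.
  have [V' [W' [-> _ _]]] := cfd_Phid0 d G j ha hb.
  by exists V'; rewrite mulrC addrK.
case=> r r0; rewrite TE -addrA [a * V]mulrC -mulrBl => h.
apply: (@ideal_unit J (V - r)) => //.
  by rewrite serB V0 r0 subr0; case: hk.
by rewrite mulrC; move: h; rewrite addrC => /(idealDr _ Jid (H0 k)).1.
Qed.

(** If the axis is a component, then [k = 0] at a smooth point and [k = 1] at a node. Hence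
    equimultiplicity already controls the relevant coefficients. *)
Lemma axis_mult_base d F k : isbase (sp F) -> (forall j, cfd d (sp F) 0 j = 0) ->
  axis_mult d (sp F) k -> (k < ord (sp F))%N.
Proof.
move=> bF F0 [fk fmin]; set f := sp F in bF F0 fk fmin *.
have f0 : f != 0 by apply: contra fk => /eqP ->; rewrite /cfd !cf0 if_same.
case/orP: bF => [/eqP o1|/andP[/eqP o2 d0]].
  have [i] := cfd_ord d f0; rewrite o1; case: i => [|[|//]] _; first by rewrite F0 eqxx.
  by rewrite ltnNge; move=> nz; apply: contra nz => /fmin ->.
rewrite o2 ltnNge; apply: contra d0 => /fmin f1.
have e1 : cf f 1 1 = 0 by move: f1; case: (d).
have e2 : cf f 2 0 * cf f 0 2 = 0.
  by move: (F0 2); case: (d); rewrite /cfd => ->; rewrite ?mulr0 ?mul0r.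
by rewrite /disc e1 -mulrA e2 expr0n mulr0 subr0.
Qed.

(** Noether's formula: the blowing up lowers the contact by the multiplicity [ord f - 1] of the
    residual curve, and the new exceptional curve, which joins the residual curve, adds 1. *)
Lemma axis_mult_child d f k : f != 0 -> (1 < ord f)%N -> axis_mult d f k ->
  axis_mult d (childT d (ord f) f) (k.+2 - ord f).
Proof.
move=> f0 n1 [fk fmin].
have kn : (ord f <= k.+1)%N.
  by rewrite leqNgt; apply: contra fk => lt; rewrite ord_lowd.
split=> [|[|j] jk]; last 2 first.
- exact: cfd_childT0.
- rewrite cfd_childTS; case: ifP => // _; apply: fmin; lia.
have -> : (k.+2 - ord f = (k.+1 - ord f).+1)%N by rewrite subSn.
rewrite cfd_childTS subnK //= (_ : k.+1 - 1 = k)%N //; lia.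
Qed.

Lemma axis_mult_cross d f : f != 0 -> exists k, axis_mult (~~ d) (childT d (ord f) f) k.
Proof.
move=> f0; have [i io fi] := cfd_ord d f0.
have ex : exists k, cfd (~~ d) (childT d (ord f) f) 1 k != 0.
  by exists i; rewrite cfdC cfd_childTS add0n io.
case: (ex_minnP ex) => k gk kmin; exists k; split=> // j jk.
by apply/eqP; apply: contrapT => /negP /kmin; rewrite leqNgt jk.
Qed.

Lemma nonbase_ord d F k : ~~ isbase (sp F) -> (forall j, cfd d (sp F) 0 j = 0) ->
  axis_mult d (sp F) k -> sp F != 0 /\ (1 < ord (sp F))%N.
Proof.
move=> nb F0 [fk _].
have f0 : sp F != 0 by apply: contra fk => /eqP ->; rewrite /cfd !cf0 if_same.
split=> //; move: nb; rewrite /isbase; case e: (ord (sp F)) => [|[|//]] //.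
by have [i] := cfd_ord d f0; rewrite e leqn0 => /eqP ->; rewrite F0 eqxx.
Qed.

(** Induction along the infinitely near points of the axis. Coefficients of degree below the order
    lie in [J] by equimultiplicity; the others reappear, shifted by [n - 1], on the axis at the next
    point. *)
Lemma ESR_axis_bound F : ESR J F -> axis_bound F.
Proof.
have base T : isbase (sp T) -> low J T -> axis_bound T.
  move=> bT lT d C D k _ _ JD _ _ _ T0 hk j jk; apply: JD.
  have := axis_mult_base bT T0 hk => kn.
  by case: (d); apply: lT; rewrite ?addn0 ?add0n; apply: leq_ltn_trans kn.
elim=> {F} [|F a b a' b' nb lF ha hb hs IHs hv IHv]; first exact: base.
have child d : cfd d (sp F) 0 (ord (sp F)) = 0 -> exists a b, [/\ ordge 1 a, ordge 1 b &
    axis_bound (Phid d a b (childT d (ord (sp F)) F))].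
  case: d => h.
    have r0 := root_cone0 h.
    have [h1 h2] := ha _ r0; exists (b 0), (a 0); split=> //.
    by have := IHs _ r0; rewrite rmorph0.
  by have [h1 h2] := hb h; exists a', b'; split=> //; apply: IHv.
move=> d C D k hC hD JD DC mCD F0 f0 hk j jk.
have [fn0 n1] := nonbase_ord nb f0 hk; set n := ord (sp F) in child n1 *.
have [jn|nj] := ltnP j n.
  by apply: JD; case: (d); apply: lF; rewrite ?addn0 ?add0n.
have [al [be [hal hbe ab]]] := child d (f0 n); set G := childT d n F in ab.
have sG : sp G = childT d n (sp F) by rewrite sp_childT.
(* The section stays on the new exceptional curve: the same bound for the child, applied with the
   two axes exchanged. *)
have Jbe : J be.
  have [k2 hk2] := axis_mult_cross d fn0; rewrite -/n -sG in hk2.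
  apply: (@section_on_axis (~~ d) be al G k2) => //; rewrite ?PhidC // => i.
  by rewrite cfdC cfd_childT0; apply: ideal0.
have hkc := axis_mult_child fn0 n1 hk; rewrite -/n -sG in hkc.
have G0 i : C (cfd d G 0 i).
  case: i => [|i]; first by rewrite cfd_childT0; apply: ideal0.
  by rewrite cfd_childTS /= subn0.
have H0 i : J (asum be (fun l' => ('C(i + l', i))%:R * cfd d G 0 (i + l')) - cfd d G 0 i).
  have := asum_modJ (fun l' => ('C(i + l', i))%:R * cfd d G 0 (i + l')) Jbe.
  by rewrite addn0 binn mul1r.
have H0C i : C (asum be (fun l' => ('C(i + l', i))%:R * cfd d G 0 (i + l'))).
  by rewrite -[asum _ _](subrK (cfd d G 0 i)); apply: idealD => //; apply/DC/JD.
(* The induction hypothesis is used for the ideals [C + (al)] and [D + m al], since the translated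
   axis row is only known to lie in the first of them. *)
have T0 : forall i, (i <= k.+2 - n)%N -> mspan D al (cfd d (Phid d al be G) 0 i).
  apply: (ab d (span C al)); rewrite ?(sp_Phid d G hal hbe) //.
  - exact: span_ideal.
  - exact: mspan_ideal.
  - by move=> z Jz; apply: mspan_in; apply: JD.
  - by move=> z [r _ hr]; exists r; apply: DC.
  - move=> r z r0 [s hs']; exists (r * s); rewrite ?serM0 ?r0 ?mul0r //.
    by rewrite -mulrA -mulrBr; apply: mCD.
  - move=> i; have [V [W [-> _ _]]] := cfd_Phid0 d G i hal hbe.
    by exists V; rewrite mulrC addrK.
  - move=> [|i]; first by rewrite sG cfd_childT0.
    by rewrite sG cfd_childTS /= f0.
(* At the contact index [V] is a unit, so the Nakayama argument gives [al] in [C], though not yet in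
   [D]. *)
have Cal : C al.
  have [r r0] := T0 _ (leqnn _).
  have [V [W [-> _ V0]]] := cfd_Phid0 d G (k.+2 - n) hal hbe.
  rewrite -addrA [al * V]mulrC -mulrBl => /DC h.
  apply: (@ideal_unit C (V - r)) => //; first by rewrite serB V0 r0 subr0; case: hkc.
  by rewrite mulrC; move: h; rewrite addrC => /(idealDr _ hC (H0C _)).1.
have [i ij] : exists i, j = (i + n)%N by exists (j - n)%N; rewrite subnK.
have ik : (i.+1 < k.+2 - n)%N by lia.
have -> : cfd d F 0 j = cfd d G 0 i.+1 by rewrite cfd_childTS /= subn0 ij.
have [r r0] := T0 _ (ltnW ik).
have [V [W [-> VE V0]]] := cfd_Phid0 d G i.+1 hal hbe.
set H := asum be _ => h.
(* Below the contact index [V] lies in the maximal ideal, and [m C] is contained in [D]. *)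
have DV : D (al * V).
  rewrite mulrC; apply: mCD => //; rewrite V0; by case: hkc => _; apply.
have DH : D H.
  have -> : H = (H + al * V - r * al) + r * al - al * V by ring.
  by apply: idealB => //; apply: idealD => //; apply: mCD.
by rewrite -[cfd d G 0 i.+1](subKr H); apply: idealB => //; apply: JD; apply: H0.
Qed.

Lemma ESR_section d a b G k : ordge 1 a -> ordge 1 b -> ESR J (Phid d a b G) ->
  (forall j, J (cfd d G 0 j)) -> axis_mult d (sp G) k -> J a.
Proof. by move=> ha hb /ESR_axis_bound; apply: section_on_axis. Qed.

(** Modulo [J] the intersection of the residual curve with the axis stays concentrated at the
    section. Both coordinates of the next section along the axis lie in [J], so the coefficients can
    be compared with those of the untranslated child. The case [j = k - 1] is the equation that
    determines the moving section. *)
Lemma ESR_contact F : ESR J F -> forall d k, (forall j, J (cfd d F 0 j)) ->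
  axis_mult d (sp F) k -> forall j, (j < k)%N -> J (cfd d F 1 j).
Proof.
have low1 T d j : low J T -> (j.+1 < ord (sp T))%N -> J (cfd d T 1 j).
  by move=> lT jn; case: (d); apply: lT; rewrite ?add1n ?addn1.
have sp0 T d : (forall j, J (cfd d T 0 j)) -> forall j, cfd d (sp T) 0 j = 0.
  by move=> T0 j; rewrite cfd_sp; apply: Jmax.
elim=> {F} [F bF lF|F a b a' b' nb lF ha hb hs IHs hv IHv] d k F0 hk j jk.
  apply: low1 => //; apply: leq_ltn_trans (axis_mult_base bF (sp0 _ _ F0) hk).
  exact: jk.
have f0 := sp0 _ _ F0.
have [fn0 n1] := nonbase_ord nb f0 hk; set n := ord (sp F) in ha hb hs IHs hv IHv n1 *.
have [jn|nj] := ltnP j.+1 n; first exact: low1.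
have [al [be [hal hbe E IH]]] : exists al be, [/\ ordge 1 al, ordge 1 be,
    ESR J (Phid d al be (childT d n F)) &
    forall k, (forall j, J (cfd d (Phid d al be (childT d n F)) 0 j)) ->
      axis_mult d (sp (Phid d al be (childT d n F))) k ->
      forall j, (j < k)%N -> J (cfd d (Phid d al be (childT d n F)) 1 j)].
  case: (d) (f0 n) => h.
    have r0 := root_cone0 h.
    have [h1 h2] := ha _ r0; exists (b 0), (a 0); split=> //.
      by have := hs _ r0; rewrite rmorph0.
    by move=> k'; have := IHs _ r0 true k'; rewrite rmorph0.
  by have [h1 h2] := hb h; exists a', b'; split=> //; [apply: hv|move=> k'; apply: (IHv h false)].
set G := childT d n F in E IH.
have sG : sp G = childT d n (sp F) by rewrite sp_childT.
have G0 i : J (cfd d G 0 i).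
  case: i => [|i]; first by rewrite cfd_childT0; apply: ideal0.
  by rewrite cfd_childTS /= subn0.
have hkc := axis_mult_child fn0 n1 hk; rewrite -/n -sG in hkc.
have Jbe : J be.
  have [k2 hk2] := axis_mult_cross d fn0; rewrite -/n -sG in hk2.
  apply: (@ESR_section (~~ d) be al G k2) => //; rewrite ?PhidC // => i.
  by rewrite cfdC cfd_childT0; apply: ideal0.
have Jal : J al by apply: (@ESR_section d al be G (k.+2 - n)).
have [i ij] : exists i, j.+1 = (i + n)%N by exists (j.+1 - n)%N; rewrite subnK.
have -> : cfd d F 1 j = cfd d G 1 i.+1.
  by rewrite cfd_childTS -ij /= subSS subn0.
have TG i' j' := Phid_modJ d G i' j' Jal Jbe.
rewrite -[cfd d G 1 i.+1](subKr (cfd d (Phid d al be G) 1 i.+1)); apply: idealB => //.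
apply: (IH (k.+2 - n)%N); rewrite ?(sp_Phid d G hal hbe) //; last by lia.
move=> j'; rewrite -[cfd _ _ _ _](subrK (cfd d G 0 j')); exact: idealD.
Qed.

End FixedIdeal.
End Uniqueness.

Lemma iter_eq_in (X : Type) (P : X -> Prop) (f g : X -> X) x D :
  (forall y, P y -> f y = g y) -> (forall y, P y -> P (g y)) -> P x -> iter D f x = iter D g x.
Proof.
move=> fg Pg Px; suff [] : iter D f x = iter D g x /\ P (iter D g x) by [].
elim: D => [//|D [IH PD]]; rewrite !iterS IH; split; [exact: fg|exact: Pg].
Qed.

(** * Newton iteration for the moving section *)

Section Newton.
Variables (K : closedFieldType) (N : nat).
Local Notation R := (mpser K N).
Implicit Types (F G : mpser R 2) (a b r : R) (d : bool).

(** First order Taylor formula. The remainder is shown to lie in [m (b - b')] on partial sums, and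
    closedness of this ideal supplies the factor [r] without constructing it as a series. *)
Lemma asum_diff b b' (g : nat -> R) : ordge 1 b -> ordge 1 b' ->
  exists2 r : R, r 0%MM = 0 & asum b g - asum b' g = (b - b') * (g 1%N + r).
Proof.
move=> hb hb'; pose C (z : R) := exists2 r : R, r 0%MM = 0 & z = r * (b - b').
have hC : is_ideal C.
  split; first by exists 0; rewrite ?ser0 ?mul0r.
    move=> x y [r r0 ->] [s s0 ->]; exists (r + s); last by rewrite mulrDl.
    by rewrite serD r0 s0 addr0.
  by move=> x y [r r0 ->]; exists (x * r); rewrite ?mulrA // serM0 r0 mulr0.
suff [r r0 e] : C (asum b g - asum b' g - (b - b') * g 1%N).
  by exists r => //; apply/eqP; rewrite mulrDr -subr_eq0 opprD addrA subr_eq0 e mulrC.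
apply: (ideal_closed hC) => t; pose s := maxn t 2.
exists (\sum_(k < s) b ^+ k * g k - \sum_(k < s) b' ^+ k * g k - (b - b') * g 1%N).
  rewrite -sumrB /s; case: (maxn t 2) (leq_maxr t 2) => [|[|s']] // _.
  rewrite !big_ord_recl /= /bump /= !expr0 !mul1r subrr add0r !expr1 -mulrBl addrC addKr.
  apply: ideal_sum => // k _; rewrite -mulrBl subrXX mulrC; apply: idealM => //.
  exists (\sum_(i < k.+2) b ^+ (k.+1 - i) * b' ^+ i); last by rewrite mulrC; congr (_ * _); apply: eq_bigr.
  apply/ordge1P; apply: ordge_sum => i _; have [i0|i0] := posnP i.
    by apply: ordgeMr; rewrite i0 subn0; apply: ordge_le (ordge_exp hb).
  by apply: ordgeMl; apply: ordge_le (ordge_exp hb').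
have ts : (t <= s)%N by apply: leq_maxl.
set x := asum b g; set y := asum b' g; set z := _ * _.
set u := \sum_(k < s) _; set v := \sum_(k < s) _.
have -> : x - y - z - (u - v - z) = (x - u) - (y - v) by ring.
by apply: ordgeB; apply: asumW.
Qed.

(** The infinite sum is the coefficient of [x y^(k-1)] (in the direction [d]) after translation by
    [b] along the axis. The constant term of its derivative in [b] is [k] times that of the
    coefficient of [x y^k]; [w] is meant to be the inverse. *)
Definition newton_step d G k w b : R := b - ser_const N w *
  asum b (fun l => ('C(k.-1 + l, k.-1))%:R * cfd d G 1 (k.-1 + l)).
(* Newton iteration with constant slope 1/w, made total outside the maximal ideal. *)
Definition newton d G k w : R :=
  ser_fix (fun b => newton_step d G k w (b - ser_const N (b 0%MM))).

Section NewtonProps.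
Variables (d : bool) (G : mpser R 2) (k : nat) (w : K).
Hypotheses (k0 : (0 < k)%N) (Gk : (cfd d G 1 k.-1) 0%MM = 0)
  (hw : w * (k%:R * (cfd d G 1 k) 0%MM) = 1).
Let phi b := asum b (fun l => ('C(k.-1 + l, k.-1))%:R * cfd d G 1 (k.-1 + l)).
Let T b := newton_step d G k w (b - ser_const N (b 0%MM)).

Let phi_diff b b' : ordge 1 b -> ordge 1 b' -> exists2 u : R,
  w * u 0%MM = 1 & phi b - phi b' = (b - b') * u.
Proof.
move=> hb hb'; have [r r0 e] := asum_diff (fun l => ('C(k.-1 + l, k.-1))%:R * cfd d G 1 (k.-1 + l)) hb hb'.
eexists; last exact: e.
rewrite addn1 prednK // -[in 'C(k, _)](prednK k0) binSn prednK //.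
by rewrite serD r0 addr0 -[k%:R](rmorph_nat (@ser_const K N)) serMconst.
Qed.

Let step_max b : ordge 1 b -> ordge 1 (newton_step d G k w b).
Proof.
move=> hb; apply: ordgeB => //; apply: ordgeMl; apply/ordge1P.
by rewrite asum_at0 // addn0 binn mul1r.
Qed.

(** The step multiplies differences by [1 - w u], where [u] is the divided difference of the
    equation; its constant term vanishes since [w u(0) = 1]. *)
Let T_contr : contraction T.
Proof.
move=> t b b' h; rewrite /T; set c := b - _; set c' := b' - _.
have hc : ordge 1 c by apply: ordge_sub_const.
have hc' : ordge 1 c' by apply: ordge_sub_const.
have h' : ordge t (c - c').
  case: t h => [//|t] h; rewrite (_ : c - c' = b - b' - ser_const N ((b - b') 0%MM)).
    apply: ordgeB => // m mt /=; rewrite -serB (h 0%MM) ?mul0rn //.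
    by rewrite mdeg0.
  by rewrite serB rmorphB /c /c'; ring.
have [u wu e] := phi_diff hc hc'.
have -> : newton_step d G k w c - newton_step d G k w c' = (c - c') * (1 - ser_const N w * u).
  have -> : newton_step d G k w c - newton_step d G k w c' = (c - c') - ser_const N w * (phi c - phi c').
    have E x : newton_step d G k w x = x - ser_const N w * phi x by [].
    by rewrite !E; move: (phi c) (phi c') => p q; ring.
  by rewrite e; move: (c - c') => x; ring.
rewrite -[t.+1]addn1; apply: ordgeM => //; apply/ordge1P.
by rewrite serB ser1 eqxx serMconst wu subrr.
Qed.

Lemma newton_max : ordge 1 (newton d G k w).
Proof. by rewrite /newton -(ser_fixP T_contr); apply/step_max/ordge_sub_const. Qed.

Lemma newton_step_max b : ordge 1 b -> ordge 1 (newton_step d G k w b).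
Proof. exact: step_max. Qed.

Lemma newton_root : phi (newton d G k w) = 0.
Proof.
have := ser_fixP T_contr; rewrite -/(newton d G k w) {1}/T.
rewrite ((ordge1P _).1 newton_max).
rewrite rmorph0 subr0 /newton_step -/(phi _) => /eqP.
rewrite -subr_eq0 addrAC subrr add0r oppr_eq0 => /eqP e.
have w0 : w != 0 by apply/eqP => w0; move/eqP: hw; rewrite w0 mul0r eq_sym oner_eq0.
by rewrite -[phi _]mul1r -(rmorph1 (@ser_const K N)) -(mulVf w0) rmorphM -mulrA e mulr0.
Qed.

Lemma newton_iter D : ordge D (newton d G k w - iter D (newton_step d G k w) 0).
Proof.
have e : iter D (newton_step d G k w) 0 = iter D T 0.
  apply: (@iter_eq_in _ (ordge 1)) => [x x1|x x1|]; last exact: ordge0.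
    by rewrite /T ((ordge1P x).1 x1) rmorph0 subr0.
  exact/step_max/ordge_sub_const.
by rewrite e; apply: (@ser_fix_iter _ _ T D T_contr).
Qed.

(** The value at [b] is [b - newton d G k w] times a unit, so a solution modulo any ideal is
    congruent to the exact one. This is what makes one section over R serve all [J]. *)
Lemma newton_uniq (C : R -> Prop) b : is_ideal C -> ordge 1 b -> C (phi b) -> C (b - newton d G k w).
Proof.
move=> hC hb; have [u wu e] := phi_diff hb newton_max.
rewrite newton_root subr0 in e; rewrite e; apply: ideal_unit => //.
by apply: contraTneq (oner_neq0 K) => u0; rewrite -wu u0 mulr0 eqxx.
Qed.
End NewtonProps.
End Newton.

(** * The tree of infinitely near points *)

Section Tree.
Variables (K : closedFieldType) (N : nat).
Local Notation R := (mpser K N).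
Implicit Types (F G : mpser R 2) (f : mpser K 2) (a b r : R) (d : bool) (e : bool * bool).

(* A tangent direction: [Some c] is y = c x and [None] is x = 0. *)
Implicit Types (dir : option K).

Definition tangent dir f : bool :=
  if dir is Some c then root (cone f) c else cf f 0 (ord f) == 0.

Definition rawT dir n F : mpser R 2 :=
  if dir is Some c then slopeT n (ser_const N c) F else vertT n F.

Definition rawTK dir n f : mpser K 2 :=
  if dir is Some c then slopeT n c f else vertT n f.

(* [e] tells which of the axes x = 0 and y = 0 are exceptional; both are at a
   crossing point, whose section is the crossing point itself. *)
Definition flags dir e : bool * bool :=
  if dir is Some c then (true, e.2 && (c == 0)) else (e.1, true).

Definition newd dir : bool := if dir is Some _ then false else true.

Definition PhiT d b F : mpser R 2 := if d then PhiX b F else PhiY b F.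

Definition stepT dir n k w e F : mpser R 2 :=
  let G := rawT dir n F in
  if (flags dir e).1 && (flags dir e).2 then G else PhiT (newd dir) (newton (newd dir) G k w) G.

Definition weight d k f : K := (k%:R * cfd d f 1 k)^-1.

(** The contact [k] is determined by the special fibre ([axis_mult_uniq]), so each tangent direction
    has a single kid. *)
Inductive kid e F : bool * bool -> mpser R 2 -> Prop :=
| Kid dir k of ~~ isbase (sp F) & tangent dir (sp F) &
    axis_mult (newd dir) (rawTK dir (ord (sp F)) (sp F)) k :
    kid e F (flags dir e)
      (stepT dir (ord (sp F)) k (weight (newd dir) k (rawTK dir (ord (sp F)) (sp F))) e F).

Inductive reach e F : bool * bool -> mpser R 2 -> Prop :=
| ReachRefl : reach e F e F
| ReachStep e1 F1 e2 F2 of reach e F e1 F1 & kid e1 F1 e2 F2 : reach e F e2 F2.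

Lemma reach_kid e F e1 F1 e2 F2 : kid e F e1 F1 -> reach e1 F1 e2 F2 -> reach e F e2 F2.
Proof.
move=> k h; elim: h => {e2 F2}; first exact: ReachStep (ReachRefl e F) k.
by move=> e3 F3 e2 F2 _ IH k2; apply: ReachStep IH k2.
Qed.

Lemma sp_rawT dir n F : sp (rawT dir n F) = rawTK dir n (sp F).
Proof. by case: dir => [c|]; rewrite /= ?sp_slopeT ?sp_vertT. Qed.

Lemma rawT_axis dir n F j : cfd (newd dir) (rawT dir n F) 0 j = 0.
Proof. by case: dir. Qed.

Lemma Phid0 d b G : ordge 1 b -> Phid d 0 b G = PhiT d b G.
Proof.
move=> hb; have h0 : ordge 1 (0 : R) by apply: ordge0.
have X0 F : PhiX 0 F = F.
  by apply: cfP => i j; rewrite cf_mk asumS // mul0r addr0 addn0 binn mul1r.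
have Y0 F : PhiY 0 F = F.
  by apply: cfP => i j; rewrite cf_mk asumS // mul0r addr0 addn0 binn mul1r.
by case: d; rewrite /Phid /Phi /PhiT ?X0 ?Y0.
Qed.

Lemma Phid00 d G : Phid d 0 0 G = G.
Proof.
rewrite Phid0; last exact: ordge0.
by case: d; apply: cfP => i j; rewrite cf_mk asumS ?mul0r ?addr0 ?addn0 ?binn ?mul1r //; apply: ordge0.
Qed.

(** The order of the total transform exceeds that of the strict transform by the number of
    exceptional axes through the point, whence the bound. It keeps the contacts in Newton steps at
    most [n0], hence invertible. *)
Record node_inv (n0 : nat) e F : Prop := Inv {
  inv_neq0 : sp F != 0;
  inv_ord : (0 < ord (sp F) <= n0 + e.1 + e.2)%N;
  inv_x : e.1 -> (forall j, cf F 0 j = 0) /\ exists k, axis_mult false (sp F) k;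
  inv_y : e.2 -> (forall i, cf F i 0 = 0) /\ exists k, axis_mult true (sp F) k }.

Lemma axis_mult_ord d f k : axis_mult d f k -> f != 0 /\ (ord f <= k.+1)%N.
Proof.
move=> [fk _]; have f0 : f != 0 by apply: contra fk => /eqP ->; rewrite /cfd !cf0 if_same.
by split=> //; rewrite leqNgt; apply: contra fk => h; rewrite ord_lowd.
Qed.

Lemma axis_mult_uniq d f k l : axis_mult d f k -> axis_mult d f l -> k = l.
Proof.
move=> [fk hk] [fl hl]; case: (ltngtP k l) => // [/hl e|/hk e].
  by rewrite e eqxx in fk.
by rewrite e eqxx in fl.
Qed.

Lemma axis_mult_new dir f : f != 0 -> tangent dir f ->
  exists2 k, axis_mult (newd dir) (rawTK dir (ord f) f) k & (0 < k)%N.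
Proof.
move=> f0; case: dir => [c|] /= h.
  by have [k [/andP[k0 _] gk hk]] := slopeT_row1 f0 h; exists k.
have [k hk] := axis_mult_cross false f0.
exists k => //; rewrite lt0n; apply: contraNneq (hk.1) => ->.
by have := vertT_col1 (leq0n (ord f)); rewrite subn0 (eqP h) => e; apply/eqP.
Qed.

(* The strict part of the cone has degree m = ord f - e1 - e2, which bounds the
   contact of the strict transform with a new exceptional curve. *)
Lemma axis_mult_le dir f e k : f != 0 -> tangent dir f ->
  (e.1 -> forall j, cf f 0 j = 0) -> (e.2 -> forall i, cf f i 0 = 0) ->
  axis_mult (newd dir) (rawTK dir (ord f) f) k ->
  (k + (e.1 + e.2) <= ord f + ((flags dir e).1 && (flags dir e).2))%N.
Proof.
move=> f0 td e1 e2; case: dir td => [c|] /= rc hk; last first.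
  have [i io fi] := cfd_ord false f0.
  have [gk kmin] := hk.
  have kn : (k <= ord f)%N.
    rewrite leqNgt; apply: contra gk => kn; rewrite /cfd cf_mk cf_vertS add0n leqNgt kn //.
  have : (k + e.2 <= ord f)%N.
    case: (e.2) e2 => [/(_ isT) e2|_]; last by rewrite addn0.
    rewrite addn1 ltn_neqAle kn andbT; apply: contraNneq gk => kn'.
    by rewrite /cfd vertT_col1 // kn' subnn e2.
  by case: (e.1); case: (e.2); lia.
set p := cone f; pose P := p \Po ('X + c%:P).
have gP j : cfd false (slopeT (ord f) c f) 1 j = P`_j by apply: slopeT_cone.
have p0 : p != 0 by apply: cone_neq0.
have P0 : P != 0 by apply: comp_XaddC_neq0.
have sP : size P = size p by rewrite size_comp_poly2 // size_XaddC.
(* If [x = 0] is exceptional, [x] divides the initial form and the cone loses one degree. *)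
have sp1 : (size p + e.1 <= (ord f).+1)%N.
  case: (e.1) e1 => [/(_ isT) e1|_]; last by rewrite addn0 size_poly.
  rewrite addn1 ltn_neqAle size_poly andbT; apply: contraTneq p0 => sz.
  rewrite negbK -lead_coef_eq0 lead_coefE sz /= coef_poly ltnSn subnn e1 //.
have [gk kmin] := hk; rewrite gP in gk.
have kP : (k < size P)%N by rewrite ltnNge; apply: contra gk => h; rewrite nth_default.
have [e2c|ne2c] := boolP (e.2 && (c == 0)).
  by move: kP sp1 e2c; rewrite sP; case: (e.1); case: (e.2) => //=; lia.
(* If [y = 0] is exceptional, the cone has the root 0, which for [c != 0] becomes the root [-c] of
   the shifted cone. It is distinct from the k-fold root 0 and takes one more degree. *)
suff : (k + e.2 < size P)%N by move: sp1; rewrite sP; case: (e.1); case: (e.2) => //=; lia.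
case: (e.2) e2 ne2c => [/(_ isT) e2 /= c0|_ _]; last by rewrite addn0.
have pr : p.[0] = 0 by rewrite horner_coef0 coef_poly /= subn0 e2.
have PE : P = drop_poly k P * 'X^k.
  rewrite -[LHS](poly_take_drop k) (_ : take_poly k P = 0) ?add0r //.
  apply/polyP => j; rewrite coef_take_poly coef0; case: ifP => // jk.
  by rewrite -gP kmin.
have Q0 : drop_poly k P != 0 by apply: contra P0 => /eqP h; rewrite PE h mul0r.
have : root (drop_poly k P) (- c).
  have : P.[- c] = 0 by rewrite horner_comp !hornerE addNr.
  rewrite {1}PE hornerM hornerXn => /eqP; rewrite mulf_eq0 expf_eq0 oppr_eq0 (negbTE c0) andbF orbF.
  by rewrite rootE.
by move/(root_size_gt1 Q0); rewrite size_drop_poly addn1 -subn_gt0 => h; rewrite -subn_gt0; move: h; rewrite !subn_gt0 ltn_subRL addn1.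
Qed.

Lemma rawT_child dir e F n : (flags dir e).1 && (flags dir e).2 ->
  rawT dir n F = childT (~~ newd dir) n F /\ (if newd dir then e.1 else e.2).
Proof. by case: dir => [c|] /=; [move=> /andP[-> /eqP ->]; rewrite rmorph0|rewrite andbT]. Qed.

Lemma cfd_child_axis d n F j : (forall j, cfd d F 0 j = 0) -> cfd d (childT d n F) 0 j = 0.
Proof. by move=> h; case: j => [|j]; rewrite ?cfd_childT0 // cfd_childTS /= subn0. Qed.

Lemma PhiT_row0 d b G : ordge 1 b -> (forall j, cfd d G 0 j = 0) -> forall j, cfd d (PhiT d b G) 0 j = 0.
Proof.
move=> hb h j; rewrite -Phid0 // cfd_Phid //; last exact: ordge0.
rewrite asumS ?mul0r ?addr0; last exact: ordge0.
by rewrite add0n binn mul1r asum0 // => k; rewrite h mulr0.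
Qed.

Lemma sp_PhiT d b G : ordge 1 b -> sp (PhiT d b G) = sp G.
Proof. by move=> hb; case: d; rewrite /= ?sp_PhiX ?sp_PhiY. Qed.

Lemma inv_flags n0 e F d : node_inv n0 e F -> (if d then e.2 else e.1) ->
  (forall j, cfd d F 0 j = 0) /\ exists k, axis_mult d (sp F) k.
Proof. by case: d => h he; [have := inv_y h he|have := inv_x h he]. Qed.

Variable n0 : nat.
Hypothesis n0K : forall k, (0 < k <= n0)%N -> k%:R != 0 :> K.

(** Away from crossings, [axis_mult_le] and the invariant give [k <= n0], so [weight] is a genuine
    inverse and the hypotheses of Newton iteration hold. *)
Lemma kid_newton e F dir k (d := newd dir) (G := rawT dir (ord (sp F)) F) : node_inv n0 e F ->
  tangent dir (sp F) -> ~~ ((flags dir e).1 && (flags dir e).2) ->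
  axis_mult d (rawTK dir (ord (sp F)) (sp F)) k ->
  [/\ (0 < k)%N, (cfd d G 1 k.-1) 0%MM = 0 &
    weight d k (rawTK dir (ord (sp F)) (sp F)) * (k%:R * (cfd d G 1 k) 0%MM) = 1].
Proof.
move=> hi td nc hk.
have [k' hk' k0] := axis_mult_new (inv_neq0 hi) td; rewrite -(axis_mult_uniq hk hk') in k0.
have e1 : e.1 -> forall j, cf (sp F) 0 j = 0.
  by move=> he j; rewrite cf_sp (proj1 (inv_x hi he)) rmorph0.
have e2 : e.2 -> forall i, cf (sp F) i 0 = 0.
  by move=> he i; rewrite cf_sp (proj1 (inv_y hi he)) rmorph0.
have kle := axis_mult_le (inv_neq0 hi) td e1 e2 hk.
rewrite (negbTE nc) addn0 in kle.
have kn0 : k%:R != 0 :> K.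
  by apply: n0K; have /andP[_] := inv_ord hi; rewrite k0; lia.
have spG : sp G = rawTK dir (ord (sp F)) (sp F) by rewrite sp_rawT.
split=> //.
  rewrite -[LHS]/(ev0 (cfd d G 1 k.-1)) -cfd_sp spG; case: hk => _; apply.
  by rewrite prednK.
rewrite -[X in _ * (_ * X)]/(ev0 (cfd d G 1 k)) -cfd_sp spG /weight mulVf //.
by rewrite mulf_neq0 //; case: hk.
Qed.

Lemma kid_inv e F e' F' : node_inv n0 e F -> kid e F e' F' -> node_inv n0 e' F'.
Proof.
move=> hi [dir k nb td hk].
set d := newd dir in hk *; set f := sp F in nb td hk *.
have f0 := inv_neq0 hi; rewrite -/f in f0.
have e1 : e.1 -> forall j, cf f 0 j = 0.
  by move=> he j; rewrite cf_sp (proj1 (inv_x hi he)) rmorph0.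
have e2 : e.2 -> forall i, cf f i 0 = 0.
  by move=> he i; rewrite cf_sp (proj1 (inv_y hi he)) rmorph0.
have kle := axis_mult_le f0 td e1 e2 hk.
set G := rawT dir (ord f) F; set g := rawTK dir (ord f) f in hk *.
have spG : sp G = g by rewrite sp_rawT.
have [g0 gk] := axis_mult_ord hk.
have g1 : (1 < ord g)%N.
  by rewrite /g; case: (dir) td => [c|] /= rc; [have [] := slopeT_ord f0 rc|have [] := vertT_ord f0 (eqP rc)].
have /andP[fo1 fo] := inv_ord hi; rewrite -/f in fo1 fo.
have n1 : (1 < ord f)%N.
  by rewrite ltn_neqAle fo1 andbT eq_sym; move: nb; rewrite /isbase negb_or => /andP[].
have [cr|nc] := boolP ((flags dir e).1 && (flags dir e).2).
  rewrite /stepT cr -/G.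
  have [GE fl] := rawT_child F (ord f) cr.
  have fl' : if ~~ d then e.2 else e.1 by rewrite /d; case: (newd dir) fl.
  have [F0 [kF hkF]] := inv_flags hi fl'.
  have hk2 : axis_mult (~~ d) (sp G) (kF.+2 - ord f).
    by rewrite /G GE sp_childT; apply: axis_mult_child.
  have G0 d' j : cfd d' G 0 j = 0.
    have [->|->] : d' = d \/ d' = ~~ d by case: (d') (d) => -[]; auto.
      exact: rawT_axis.
    by rewrite /G GE; apply: cfd_child_axis.
  have hkd d' : exists k, axis_mult d' (sp G) k.
    have [->|->] : d' = d \/ d' = ~~ d by case: (d') (d) => -[]; auto.
      by exists k; rewrite spG.
    by exists (kF.+2 - ord f)%N.
  split; rewrite ?spG //.
  - rewrite (ltnW g1) /=; move: kle; rewrite cr; case/andP: cr => -> -> /=.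
    by case: (e.1) (e.2) fo => -[] /=; lia.
  - by split; [apply: (G0 false)|have [k2] := hkd false; rewrite spG; exists k2].
  - by split; [apply: (G0 true)|have [k2] := hkd true; rewrite spG; exists k2].
have [k0 Gk hw] := kid_newton hi td nc hk.
have hb : ordge 1 (newton d G k (weight d k g)) by apply: newton_max.
rewrite /stepT (negbTE nc) -/G -/d; set H := PhiT _ _ _.
have spH : sp H = g by rewrite /H sp_PhiT.
have H0 : (forall j, cfd d H 0 j = 0) /\ exists k, axis_mult d (sp H) k.
  split; first by apply: PhiT_row0 => //; apply: rawT_axis.
  by exists k; rewrite spH.
split; rewrite ?spH //.
- rewrite (ltnW g1) /=; move: kle; rewrite (negbTE nc) addn0.
  have fl1 : ((flags dir e).1 + (flags dir e).2 = 1)%N.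
    by move: nc; case: (dir) => [c|] /=; [move/negbTE ->|rewrite andbT; case: (e.1)].
  by rewrite -addnA fl1; lia.
- by rewrite spH in H0; move: nc H0; rewrite /d; case: (dir) => [c|] //= + + h; rewrite h.
- by rewrite spH in H0; move: nc H0; rewrite /d; case: (dir) => [c|] //= + + h; rewrite h.
Qed.

End Tree.

Section TreeIdeal.
Variables (K : closedFieldType) (N : nat).
Local Notation R := (mpser K N).
Implicit Types (F G T : mpser R 2) (a b r : R) (d : bool) (e : bool * bool) (dir : option K).

Definition kid_rel (y x : (bool * bool) * mpser R 2) : Prop := kid x.1 x.2 y.1 y.2.

Variable n0 : nat.
Hypothesis n0K : forall k, (0 < k <= n0)%N -> k%:R != 0 :> K.
Variable J : R -> Prop.
Hypotheses (Jid : is_ideal J) (Jmax : forall r, J r -> r 0%MM = 0).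

Lemma asum_cong a b (g h : nat -> R) : ordge 1 a -> ordge 1 b -> J (a - b) ->
  (forall k, J (g k - h k)) -> J (asum a g - asum b h).
Proof.
move=> ha hb Jab gh; rewrite -[asum a g](subrK (asum b g)) -addrA.
apply: (idealD Jid).
  by have [r _ ->] := asum_diff g ha hb; apply: (ideal_mulr _ Jid).
have -> : asum b g - asum b h = asum b (fun k => g k - h k).
  apply/eqP; rewrite subr_eq -asumD //; apply/eqP; apply: asum_ext => k.
  by rewrite subrK.
exact: asum_ideal.
Qed.

Lemma Phid_cong_section d a b a' b' G i j : ordge 1 a -> ordge 1 b -> ordge 1 a' -> ordge 1 b' ->
  J (a - a') -> J (b - b') -> J (cfd d (Phid d a b G) i j - cfd d (Phid d a' b' G) i j).
Proof.
move=> ha hb ha' hb' Ja Jb.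
suff h x y : x = asum a (fun l => ('C(i + l, i))%:R * asum b (fun l' => ('C(j + l', j))%:R * cfd d G (i + l) (j + l'))) ->
    y = asum a' (fun l => ('C(i + l, i))%:R * asum b' (fun l' => ('C(j + l', j))%:R * cfd d G (i + l) (j + l'))) ->
    J (x - y).
  exact: h (cfd_Phid d G i j ha hb) (cfd_Phid d G i j ha' hb').
move=> -> ->; apply: (asum_cong ha ha' Ja) => l.
rewrite -mulrBr; apply: (idealM Jid); apply: (asum_cong hb hb' Jb) => l'.
by rewrite subrr; apply: (ideal0 Jid).
Qed.

Lemma ESR_congd d T T' : (forall i j, J (cfd d T i j - cfd d T' i j)) -> ESR J T -> ESR J T'.
Proof.
move=> h; apply: ESR_cong => // i j.
by case: d h => h; [apply: (h j i)|apply: (h i j)].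
Qed.

Lemma ESR_rawT dir F : ESR J F -> ~~ isbase (sp F) -> tangent dir (sp F) -> exists al be,
  [/\ ordge 1 al, ordge 1 be & ESR J (Phid (newd dir) al be (rawT dir (ord (sp F)) F))].
Proof.
case=> {}F; first by move=> ->.
move=> a b a' b' nb _ ha hb hs hv _; case: dir => [c|] /= td.
  by have [h1 h2] := ha c td; exists (a c), (b c); split=> //; apply: hs.
have [h1 h2] := hb (eqP td); exists b', a'; split=> //; apply: hv; exact/eqP.
Qed.

(** The section provided by [ESR] is congruent modulo [J] to the canonical one: transversally to an
    exceptional curve by [ESR_section], along it because both solve the contact equation modulo [J].
    [ESR_cong] then replaces one by the other. *)
Lemma ESR_kid e F e' F' : node_inv n0 e F -> ESR J F -> kid e F e' F' -> ESR J F'.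
Proof.
move=> hi E [dir k nb td hk].
set d := newd dir in hk *; set f := sp F in nb td hk *.
have [al [be [hal hbe ET]]] := ESR_rawT E nb td.
rewrite -/f in ET; set G := rawT dir (ord f) F in ET.
set g := rawTK dir (ord f) f in hk *.
have spG : sp G = g by rewrite sp_rawT.
have f0 := inv_neq0 hi; rewrite -/f in f0.
have n1 : (1 < ord f)%N.
  have /andP[fo _] := inv_ord hi; rewrite -/f in fo.
  by rewrite ltn_neqAle fo andbT eq_sym; move: nb; rewrite /isbase negb_or => /andP[].
have Jal : J al.
  apply: (@ESR_section _ _ J Jid Jmax d al be G k) => //; last by rewrite spG.
  by move=> j; rewrite rawT_axis; apply: ideal0.
have [cr|nc] := boolP ((flags dir e).1 && (flags dir e).2).
  rewrite /stepT cr -/G; have [GE fl] := rawT_child F (ord f) cr.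
  have fl' : if ~~ d then e.2 else e.1 by rewrite /d; case: (newd dir) fl.
  have [F0 [kF hkF]] := inv_flags hi fl'.
  have Jbe : J be.
    apply: (@ESR_section _ _ J Jid Jmax (~~ d) be al G (kF.+2 - ord f)) => //.
    - by rewrite PhidC.
    - by move=> j; rewrite /G GE cfd_child_axis //; apply: ideal0.
    - by rewrite /G GE sp_childT; apply: axis_mult_child.
  by apply: ESR_congd ET => i j; apply: Phid_modJ.
have [k0 Gk hw] := kid_newton n0K hi td nc hk.
rewrite -/f -/g -/d -/G in Gk hw *.
set be' := newton d G k (weight d k g).
have hbe' : ordge 1 be' by apply: newton_max.
rewrite /stepT (negbTE nc) -/G -/d -/be'.
have h0 : ordge 1 (0 : R) by apply: ordge0.
have {}ET : ESR J (PhiT d be G).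
  rewrite -(Phid0 d G hbe); apply: ESR_congd ET => i j.
  by apply: (Phid_cong_section _ _ _ _ hal hbe h0 hbe); rewrite ?subr0 // subrr; apply: (ideal0 Jid).
have T0 j : J (cfd d (PhiT d be G) 0 j).
  by rewrite PhiT_row0 //; [apply: ideal0|move=> i; apply: rawT_axis].
have spT : sp (PhiT d be G) = g by rewrite sp_PhiT.
have Jphi : J (cfd d (PhiT d be G) 1 k.-1).
  apply: (ESR_contact Jid Jmax ET T0 (k := k)); first by rewrite spT.
  by rewrite ltn_predL.
have Jbe : J (be - be').
  apply: newton_uniq => //.
  by move: Jphi; rewrite /d; case: (newd dir) => h; exact: h.
rewrite -(Phid0 d G hbe) in ET; rewrite -(Phid0 d G hbe'); apply: ESR_congd ET => i j.
by apply: (Phid_cong_section _ _ _ _ h0 hbe h0 hbe' _ Jbe); rewrite subrr; apply: (ideal0 Jid).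
Qed.

Lemma ESR_reach e F e' F' : node_inv n0 e F -> ESR J F -> reach e F e' F' -> node_inv n0 e' F' /\ ESR J F'.
Proof.
move=> hi E h; elim: h => {e' F'} // e1 F1 e2 F2 _ [hi1 E1] hk.
by split; [apply: kid_inv hi1 hk|apply: ESR_kid hi1 E1 hk].
Qed.

Lemma stepT_Phid e F dir k (d := newd dir) (f := sp F) : node_inv n0 e F -> tangent dir f ->
  axis_mult d (rawTK dir (ord f) f) k ->
  exists2 be, ordge 1 be & stepT dir (ord f) k (weight d k (rawTK dir (ord f) f)) e F =
     Phid d 0 be (rawT dir (ord f) F).
Proof.
move=> hi td hk; rewrite /stepT; case: ifPn => [cr|nc].
  by exists 0; rewrite ?Phid00 //; apply: ordge0.
have [k0 Gk hw] := kid_newton n0K hi td nc hk.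
eexists; last by rewrite Phid0 //; apply: newton_max.
exact: newton_max.
Qed.

Lemma ESR_of_low e F : node_inv n0 e F -> Acc kid_rel (e, F) ->
  (forall e' F', reach e F e' F' -> low J F') -> ESR J F.
Proof.
move=> hi ac; have {ac} : Acc kid_rel (e, F) by []; move: hi.
suff : forall x, Acc kid_rel x -> node_inv n0 x.1 x.2 ->
    (forall e' F', reach x.1 x.2 e' F' -> low J F') -> ESR J x.2.
  by move=> h hi ac; apply: (h (e, F)).
move=> x; elim=> {x} -[e1 F1] _ /= IH hi lo.
have lF : low J F1 by apply: lo (ReachRefl _ _).
have [bF|nb] := boolP (isbase (sp F1)); first exact: ESRbase.
set f := sp F1 in nb *.
have f0 := inv_neq0 hi; rewrite -/f in f0.
have child dir : tangent dir f -> exists al be,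
    [/\ ordge 1 al, ordge 1 be & ESR J (Phid (newd dir) al be (rawT dir (ord f) F1))].
  move=> td; have [k hk _] := axis_mult_new f0 td.
  have [be hbe eS] := stepT_Phid hi td hk.
  have hkid := Kid e1 nb td hk; rewrite eS in hkid.
  exists 0, be; split=> //; first exact: ordge0.
  apply: (IH (_, _) hkid); first exact: kid_inv hi hkid.
  by move=> e' F' /= hr; apply: lo (reach_kid hkid hr).
have /choice[s hs] : forall c : K, exists ab : R * R, root (cone f) c ->
    [/\ ordge 1 ab.1, ordge 1 ab.2 & ESR J (Phi ab.1 ab.2 (slopeT (ord f) (ser_const N c) F1))].
  move=> c; have [rc|] := boolP (root (cone f) c); last by exists (0, 0).
  by have [al [be h]] := child (Some c) rc; exists (al, be).
have [a' [b' hv]] : exists a b : R, cf f 0 (ord f) = 0 ->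
    [/\ ordge 1 a, ordge 1 b & ESR J (Phi a b (vertT (ord f) F1))].
  have [rc|] := pselect (cf f 0 (ord f) = 0); last by exists 0, 0.
  have td : tangent None f by apply/eqP.
  by have [al [be [h1 h2 h3]]] := child None td; exists be, al.
apply: (@ESRblowup _ _ _ _ (fun c => (s c).1) (fun c => (s c).2) a' b') => //.
- by move=> c /hs[].
- by move=> /hv[].
- by move=> c /hs[].
- by move=> /hv[].
Qed.

(** The tree on the right does not mention [J], so equisingularity modulo [J] becomes the
    containment in [J] of one fixed set of coefficients. *)
Theorem ESR_iff e F : node_inv n0 e F -> Acc kid_rel (e, F) ->
  ESR J F <-> forall e' F', reach e F e' F' -> low J F'.
Proof.
move=> hi ac; split=> [E e' F' h|]; last exact: ESR_of_low.
by have [_ /ESR_low] := ESR_reach hi E h.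
Qed.

End TreeIdeal.

(** * Isolated singularities *)

Section Swap.
Variable A : comNzRingType.
Implicit Types F G : mpser A 2.

Definition swap F : mpser A 2 := mk (fun i j => cf F j i).
Lemma swapK F : swap (swap F) = F. Proof. exact: cfP. Qed.
Lemma swapD F G : swap (F + G) = swap F + swap G. Proof. exact: cfP. Qed.
Lemma swapM F G : swap (F * G) = swap F * swap G.
Proof. by apply: cfP => i j; rewrite cf_mk !cfM exchange_big. Qed.
Lemma swap1 : swap 1 = 1.
Proof. by apply: cfP => i j; rewrite cf_mk !cf1 andbC. Qed.
Lemma swap_mono i j : swap (mono (mn i j)) = mono (mn j i).
Proof. by apply: cfP => k l; rewrite cf_mk !cf_mono andbC. Qed.

Definition dx F : mpser A 2 := mk (fun i j => i.+1%:R * cf F i.+1 j).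
Definition dy F : mpser A 2 := mk (fun i j => j.+1%:R * cf F i j.+1).
Lemma swap_dx F : swap (dx F) = dy (swap F). Proof. exact: cfP. Qed.
Lemma swap_dy F : swap (dy F) = dx (swap F). Proof. exact: cfP. Qed.

Let X := serX A.
Let Y := serY A.

Lemma cf_Xdx F i j : cf (X * dx F) i j = i%:R * cf F i j.
Proof. by rewrite cf_XM; case: i => [|i]; rewrite ?mul0r. Qed.
Lemma cf_Ydy F i j : cf (Y * dy F) i j = j%:R * cf F i j.
Proof. by rewrite cf_YM; case: j => [|j]; rewrite ?mul0r. Qed.

(** The Euler operator [x d/dx] multiplies coefficients by exponents, which makes its Leibniz rule a
    termwise identity; the factor [x] is cancelled afterwards. *)
Lemma dxM F G : dx (F * G) = dx F * G + F * dx G.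
Proof.
suff e : X * dx (F * G) = X * dx F * G + F * (X * dx G).
  by apply: (@serXn_inj _ 1); rewrite !expr1 -!/X e; ring.
apply: cfP => i j; rewrite cf_Xdx cfD.
have -> : cf (X * dx F * G) i j =
    \sum_(a < i.+1) \sum_(b < j.+1) a%:R * (cf F a b * cf G (i - a) (j - b)).
  by rewrite cfM; apply: eq_bigr => a _; apply: eq_bigr => b _; rewrite cf_Xdx mulrA.
have -> : cf (F * (X * dx G)) i j =
    \sum_(a < i.+1) \sum_(b < j.+1) (i - a)%:R * (cf F a b * cf G (i - a) (j - b)).
  by rewrite cfM; apply: eq_bigr => a _; apply: eq_bigr => b _; rewrite cf_Xdx mulrCA.
rewrite cfM mulr_sumr -big_split; apply: eq_bigr => a _ /=.
rewrite mulr_sumr -big_split; apply: eq_bigr => b _ /=.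
by rewrite -mulrDl -natrD subnKC // -ltnS ltn_ord.
Qed.

Lemma dyM F G : dy (F * G) = dy F * G + F * dy G.
Proof.
by rewrite -[LHS]swapK swap_dy swapM dxM swapD !swapM !swapK !swap_dx !swapK.
Qed.

(* The ideal of the singular locus. *)
Definition Jac F (z : mpser A 2) : Prop := exists a b c, z = a * F + b * dx F + c * dy F.

Lemma Jac_ideal F : is_ideal (Jac F).
Proof.
split; first by exists 0, 0, 0; ring.
  by move=> _ _ [a [b [c ->]]] [a' [b' [c' ->]]]; exists (a + a'), (b + b'), (c + c'); ring.
by move=> x _ [a [b [c ->]]]; exists (x * a), (x * b), (x * c); ring.
Qed.

Lemma Jac_self F : Jac F F. Proof. by exists 1, 0, 0; ring. Qed.
Lemma Jac_dx F : Jac F (dx F). Proof. by exists 0, 1, 0; ring. Qed.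
Lemma Jac_dy F : Jac F (dy F). Proof. by exists 0, 0, 1; ring. Qed.

Lemma Jac_unit u v F z : v * u = 1 -> Jac F z -> Jac (u * F) z.
Proof.
move=> uv [a [b [c ->]]]; have hJ := Jac_ideal (u * F).
have jF : Jac (u * F) F.
  by rewrite -[F in X in Jac _ X]mul1r -uv -mulrA; apply: (idealM hJ); apply: Jac_self.
have jd D : (D (u * F) = D u * F + u * D F) -> Jac (u * F) (D (u * F)) -> Jac (u * F) (D F).
  move=> e h; have -> : D F = v * (D (u * F) - D u * F).
    by rewrite e addrC addKr mulrA uv mul1r.
  by apply: (idealM hJ); apply: (idealB hJ) => //; apply: (idealM hJ).
apply: (idealD hJ); first apply: (idealD hJ); apply: (idealM hJ) => //.
  by apply: (jd dx); [exact: dxM|exact: Jac_dx].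
by apply: (jd dy); [exact: dyM|exact: Jac_dy].
Qed.

Lemma Jac_swap F z : Jac F z -> Jac (swap F) (swap z).
Proof.
by move=> [a [b [c ->]]]; exists (swap a), (swap c), (swap b); rewrite !swapD !swapM swap_dx swap_dy addrAC.
Qed.

End Swap.

Lemma measure_fix (A : comNzRingType) n (mu : 'X_{1..n} -> nat) (T : mpser A n -> mpser A n) :
  (forall (w w' : mpser A n) m, (forall k, (mu k < mu m)%N -> w k = w' k) ->
    T w m = T w' m) ->
  exists w, T w = w.
Proof.
move=> hT; pose w : mpser A n := MPSer (fun m => iter (mu m).+1 T 0 m).
have st k l m : (mu m < k)%N -> (k <= l)%N -> iter l T 0 m = iter k T 0 m.
  elim: k l m => // k IH [//|l] m mk kl; rewrite !iterS; apply: hT => k' k'm.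
  by apply: IH => //; apply: leq_trans k'm mk.
exists w; apply: mpserP => m; rewrite [RHS]/= -iterS iterS; apply: hT => k km.
by rewrite [LHS]/= -iterS (st _ _ _ (ltnSn _) km).
Qed.

(** * Weierstrass division in K[[x, y]] *)

Section Weierstrass.
Variable K : fieldType.
Implicit Types f g u z e : mpser K 2.

Definition regular d u : Prop := (forall j, (j < d)%N -> cf u 0 j = 0) /\ cf u 0 d != 0.

(** Here [u = lo + y^d (sh u)] with [sh u] invertible, with inverse [v], and [lo] divisible by [x].
    For [z = (sh u) q], the condition that the remainder has y-degree below [d] reads
    [z = sh g - sh (lo v z)], solved by a fixed point. *)
Lemma weierstrass_division d u g : regular d u ->
  exists q r, g = u * q + r /\ forall i j, (d <= j)%N -> cf r i j = 0.
Proof.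
move=> [u0 ud]; pose sh z : mpser K 2 := mk (fun i j => cf z i (j + d)).
pose lo : mpser K 2 := mk (fun i j => if (j < d)%N then cf u i j else 0).
have uE : u = lo + serY K ^+ d * sh u.
  apply: cfP => i j; rewrite cfD cf_YnM cf_mk; case: ltnP => jd; first by rewrite addr0.
  by rewrite add0r cf_mk subnK.
have [v hv] : exists v, sh u * v = 1.
  by apply: (@ser_inv _ _ _ (cf u 0 d)^-1); rewrite -mn00 -[sh u _]/(cf u 0 d) mulfV.
have lo0 j : cf lo 0 j = 0 by rewrite cf_mk; case: ifP => // /u0.
have lv0 j : cf (lo * v) 0 j = 0.
  by rewrite cfM big_ord1; apply: big1 => b _; rewrite lo0 mul0r.
pose T z := sh g - sh (lo * v * z).
have [z hz] : exists z, T z = z.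
  (* A factor [x] weighs [d + 1] and so outweighs the shift by [d] in the exponent of [y]; every
     term of [lo * v] contains one. *)
  apply: (@measure_fix _ _ (fun m => d.+1 * m 0%R + m 1%R)%N) => w w' m ww'.
  rewrite !serB; congr (_ - _); rewrite !cfE !cf_mk !cfM; apply: eq_bigr => a _.
  apply: eq_bigr => b _; have [->|a0] := posnP (nat_of_ord a); first by rewrite lv0 !mul0r.
  congr (_ * _); apply: ww'; rewrite mn0 mn1.
  have b_lt := ltn_ord b; have a_lt := ltn_ord a; move: a_lt; rewrite ltnS => a_lt.
  move: (nat_of_ord a) (nat_of_ord b) a0 a_lt b_lt => x y x0 xm ym.
  by have := subnKC xm; move: (m 0%R - x)%N => c <-; rewrite mulnDr; nia.
exists (v * z), (g - u * (v * z)); split; first by rewrite addrC subrK.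
have : sh (u * (v * z)) = sh g.
  have shD x y : sh (x + y) = sh x + sh y by apply: cfP.
  have shY x : sh (serY K ^+ d * x) = x.
    by apply: cfP => i j; rewrite cf_mk cf_YnM leq_addl addnK.
  rewrite {1}uE mulrDl shD -!mulrA shY [sh u * _]mulrA hv mul1r !mulrA.
  by rewrite -{2}hz /T addrC subrK.
move=> e i j dj; have := congr1 (fun x => cf x i (j - d)) e.
by rewrite !cf_mk subnK // cfB => ->; rewrite subrr.
Qed.

Lemma split_X g : g != 0 -> exists b g' d, g = serX K ^+ b * g' /\ regular d g'.
Proof.
move=> g0; have ex : exists i, `[< exists j, cf g i j != 0 >].
  apply: contrapT => h; case/eqP: g0; apply: cfP => i j; rewrite cf0.
  apply/eqP; apply: contrapT => /negP hij; apply: h; exists i; apply/asboolP; by exists j.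
case: (ex_minnP ex) => b /asboolP exj bmin.
exists b, (mk (fun i j => cf g (b + i) j)).
case: (ex_minnP exj) => d gd dmin; exists d; split; last first.
  split; last by rewrite cf_mk addn0.
  move=> j jd; rewrite cf_mk addn0; apply/eqP; apply: contrapT => /negP /dmin.
  by rewrite leqNgt jd.
apply: cfP => i j; rewrite cf_XnM; case: leqP => [bi|ib]; first by rewrite cf_mk subnKC.
apply/eqP; apply: contrapT => /negP h; have := bmin i.
by rewrite leqNgt ib => /implyP; rewrite implybF => /negP; apply; apply/asboolP; exists j.
Qed.

Lemma regularM d1 d2 u z : regular d1 u -> regular d2 z -> regular (d1 + d2) (u * z).
Proof.
move=> [u0 ud] [z0 zd]; split.
  move=> j jd; rewrite cfM big_ord1 big1 // => b _; rewrite subn0.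
  have [bd|db] := ltnP b d1; first by rewrite u0 ?mul0r.
  by rewrite z0 ?mulr0 //; have := ltn_ord b; lia.
rewrite cfM big_ord1 subn0 (bigD1 (Ordinal (_ : d1 < (d1 + d2).+1)%N)) /= ?ltnS ?leq_addr // => h.
rewrite addKn big1 ?addr0 ?mulf_neq0 // => b; rewrite -val_eqE /= => bd.
case: (ltngtP b d1) bd => // lt _; first by rewrite u0 ?mul0r.
by rewrite z0 ?mulr0 //; have := ltn_ord b; lia.
Qed.

Lemma regular_unit u : regular 0 u -> exists v, u * v = 1.
Proof.
by move=> [_ u0]; apply: (@ser_inv _ _ _ (cf u 0 0)^-1); rewrite -mn00 -/(cf u 0 0) mulfV.
Qed.

Lemma regular_neq0 d u : regular d u -> u != 0.
Proof. by move=> [_ ud]; apply: contra ud => /eqP ->; rewrite cf0. Qed.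

(* After inversion of x, the ideal I is generated by e. *)
Lemma gcd_regular (I : mpser K 2 -> Prop) a0 d0 u : is_ideal I -> regular d0 u ->
  I (serX K ^+ a0 * u) -> exists a d e, [/\ regular d e, I (serX K ^+ a * e) &
    forall b z, I (serX K ^+ b * z) -> divides e z].
Proof.
move=> hI ru Iu.
have ex : exists d, `[< exists a e, regular d e /\ I (serX K ^+ a * e) >].
  by exists d0; apply/asboolP; exists a0, u.
case: (ex_minnP ex) => d /asboolP[a [e [re Ie]]] dmin.
exists a, d, e; split=> // b z Iz.
(* The remainder has y-degree below [d]. If it is nonzero, removing a power of [x] leaves a series
   regular of smaller order, against the minimality of [d]. *)
have [q [r [zE r0]]] := weierstrass_division z re.
have [e0|/eqP nz] := pselect (r = 0); first by exists q; rewrite zE e0 addr0.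
have [c [r' [d' [rE rr]]]] := split_X nz.
have d'd : (d' < d)%N.
  rewrite ltnNge; apply/negP => h; case: rr => _ /eqP; apply.
  by have := r0 c d' h; rewrite rE cf_XnM leqnn subnn.
have : (d <= d')%N.
  apply: dmin; apply/asboolP; exists (a + b + c)%N, r'; split=> //.
  have -> : serX K ^+ (a + b + c) * r' = serX K ^+ a * (serX K ^+ b * z) - serX K ^+ b * q * (serX K ^+ a * e).
    have -> : serX K ^+ (a + b + c) * r' = serX K ^+ a * serX K ^+ b * r by rewrite rE !exprD; ring.
    by rewrite zE; ring.
  by apply: (idealB hI); apply: (idealM hI).
by rewrite leqNgt d'd.
Qed.

(** Regular series are not divisible by [x] and are closed under products, so the power of [x] has
    to come from the cofactor [w]. *)
Lemma regular_cancelX d u w z b : regular d u -> u * w = serX K ^+ b * z -> divides u z.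
Proof.
move=> ru; elim: b w z => [|b IH] w z e; first by exists w; rewrite e expr0 mul1r.
have [w0|w0] := eqVneq w 0.
  by exists 0; rewrite w0 mulr0 in e; rewrite mulr0; apply: (@serXn_inj _ b.+1); rewrite -e mulr0.
have [c [w' [d' [wE rw]]]] := split_X w0.
case: c wE => [|c] wE.
  rewrite expr0 mul1r in wE; subst w'; have [_ /eqP []] := regularM ru rw.
  by rewrite e cf_XnM.
apply: (IH (serX K ^+ c * w')); apply: (@serXn_inj _ 1).
transitivity (u * w); last by rewrite e !exprS; ring.
by rewrite wE !exprS; ring.
Qed.

Lemma divides_trans u z e : divides u z -> divides z e -> divides u e.
Proof. by move=> [a ->] [b ->]; exists (a * b); rewrite mulrA. Qed.
Lemma divides_refl u : divides u u.
Proof. by exists 1; rewrite mulr1. Qed.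

End Weierstrass.

Section IsolatedSing.
Variable K : closedFieldType.
Implicit Types f g u z e : mpser K 2.

Lemma divides_ord u z : divides u z -> z != 0 -> (ord u <= ord z)%N.
Proof.
move=> [w ->] z0; apply: ord_ge => // i j ij.
by apply: (ordge2P (ord u) (u * w)).1 ij; apply: ordgeMr; apply/ordge2P => k l; apply: ord_low.
Qed.

Lemma regular_factor d u z d' : regular d u -> regular d' z -> divides u z ->
  (d <= d')%N /\ (d = d' -> divides z u).
Proof.
move=> ru rz [w zE].
have w0 : w != 0 by apply: contra (regular_neq0 rz) => /eqP w0; rewrite zE w0 mulr0.
have [b [w' [c [wE rw]]]] := split_X w0.
case: b wE => [|b] wE; last first.
  case: rz => _ /eqP []; rewrite zE wE exprS -mulrA mulrCA cf_XM //.
rewrite expr0 mul1r in wE; subst w'; have := regularM ru rw; rewrite -zE => rz'.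
have dE : d' = (d + c)%N.
  case: rz rz' => z0 zd [z0' zd']; case: (ltngtP d' (d + c)) => // lt.
    by rewrite z0' ?eqxx in zd.
  by rewrite z0 ?eqxx in zd'.
split; first by rewrite dE leq_addr.
rewrite dE => /eqP; rewrite -{1}[d]addn0 eqn_add2l eq_sym => /eqP c0.
rewrite c0 in rw; have [v wv] := regular_unit rw.
by exists v; rewrite zE -mulrA wv mulr1.
Qed.

(** After inversion of [x] the ideal of the singular locus is generated by a regular [e]. If [e] is
    not a unit, an irreducible factor [g] of it divides [f] and its derivatives; square-freeness
    then makes [g] divide its own derivatives, which is impossible since [ord g <= ord f]. *)
Lemma isolated_X f : f != 0 -> cf f 0 0 = 0 -> square_free f ->
  (forall k, (0 < k <= ord f)%N -> k%:R != 0 :> K) -> exists k, Jac f (serX K ^+ k).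
Proof.
move=> f0 f00 sf hch; have hJ := Jac_ideal f.
have [b [f1 [d1 [fE r1]]]] := split_X f0.
have Jf1 : Jac f (serX K ^+ b * f1) by rewrite -fE; apply: Jac_self.
have [a [d [e [re Je ediv]]]] := gcd_regular hJ r1 Jf1.
case: d re => [|d] re.
  have [v ev] := regular_unit re; exists a.
  have -> : serX K ^+ a = v * (serX K ^+ a * e) by rewrite mulrCA [v * e]mulrC ev mulr1.
  exact: (idealM hJ).
(* A divisor of e of minimal positive order of regularity is irreducible. *)
have ex : exists d, `[< (0 < d)%N /\ exists2 g, regular d g & divides g e >].
  by exists d.+1; apply/asboolP; split=> //; exists e => //; apply: divides_refl.
case: (ex_minnP ex) => d0 /asboolP[d00 [g rg ge]] dmin.
have Jdiv z : Jac f z -> divides g z.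
  move=> Jz; apply: divides_trans ge _; apply: (ediv 0%N).
  by rewrite expr0 mul1r.
have [q fq] := Jdiv f (Jac_self f).
have gnu : ~ is_unit g.
  move=> [v /(congr1 (fun z : mpser K 2 => cf z 0 0))].
  rewrite cf1 cfM !big_ord1 (proj1 rg) // mul0r => h.
  by case/eqP: (oner_neq0 K).
pose I z := exists al be, z = al * g + be * q.
have hI : is_ideal I.
  split; first by exists 0, 0; ring.
    by move=> _ _ [x [y ->]] [x' [y' ->]]; exists (x + x'), (y + y'); ring.
  by move=> x _ [y [z ->]]; exists (x * y), (x * z); ring.
have Ig : I (serX K ^+ 0 * g) by exists 1, 0; ring.
have Iq : I (serX K ^+ 0 * q) by exists 0, 1; ring.
have [a' [d' [e' [re' Ie' e'div]]]] := gcd_regular hI rg Ig.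
have e'g := e'div _ _ Ig; have e'q := e'div _ _ Iq.
(* After inversion of [x], [e'] is a greatest common divisor of [g] and [q = f / g]. If its order of
   regularity is positive, minimality makes it an associate of [g], and then [g^2] divides [f]. *)
have [le eq] := regular_factor re' rg e'g.
case: (posnP d') => [d'0|d'0]; last first.
  have dd : (d0 <= d')%N.
    by apply: dmin; apply/asboolP; split=> //; exists e' => //; apply: divides_trans e'g ge.
  case: gnu; apply: sf; have ge' : divides g e' by apply: eq; apply/eqP; rewrite eqn_leq le dd.
  have [q' qE] := divides_trans ge' e'q.
  by exists q'; rewrite fq qE expr2 mulrA.
rewrite d'0 in re'; have [v e'v] := regular_unit re'.
have [al [be Xa]] : I (serX K ^+ a').
  have -> : serX K ^+ a' = v * (serX K ^+ a' * e') by rewrite mulrCA [v * e']mulrC e'v mulr1.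
  exact: (idealM hI).
have gD (D : mpser K 2 -> mpser K 2) : D f = D g * q + g * D q -> divides g (D f) -> divides g (D g).
  move=> De [w hw].
  have [w' hw'] : divides g (serX K ^+ a' * D g).
    exists (al * D g + be * (w - D q)).
    have -> : g * (al * D g + be * (w - D q)) = al * g * D g + be * (g * w - g * D q) by ring.
    by rewrite -hw De addrK Xa; ring.
  exact: regular_cancelX rg (esym hw').
have gx : divides g (dx g).
  by apply: (gD (@dx K) _ (Jdiv _ (Jac_dx f))); rewrite {1}fq dxM.
have gy : divides g (dy g).
  by apply: (gD (@dy K) _ (Jdiv _ (Jac_dy f))); rewrite {1}fq dyM.
have g0 := regular_neq0 rg.
have og : (ord g <= ord f)%N by apply: divides_ord f0; exists q.
have og1 : (0 < ord g)%N.
  apply: ord_ge => // i j; rewrite ltnS leqn0 addn_eq0 => /andP[/eqP -> /eqP ->].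
  exact: (proj1 rg).
(* A monomial of the initial form of [g] survives in one derivative, where it has degree
   [ord g - 1], because its exponents are at most [ord f] and so invertible when positive. *)
have /is_ordE[_ [i io gi]] := ordP g0.
have bad z k l : divides g z -> cf z k l != 0 -> (ord g <= k + l)%N.
  move=> gz zkl; have z0 : z != 0 by apply: contra zkl => /eqP ->; rewrite cf0.
  by apply: leq_trans (divides_ord gz z0) (ord_le zkl).
case: i io gi => [|i] io gi.
  rewrite subn0 in gi; have := bad (dy g) 0%N (ord g).-1 gy.
  rewrite cf_mk prednK // mulf_neq0 ?hch ?og1 //= => /(_ isT).
  by rewrite add0n leqNgt ltn_predL og1.
have := bad (dx g) i (ord g - i.+1)%N gx.
rewrite cf_mk mulf_neq0 ?hch //= ?(leq_trans io) // => /(_ isT).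
lia.
Qed.

Lemma square_free_swap f : square_free f -> square_free (swap f).
Proof.
move=> sf v [w e]; have [|z hz] := sf (swap v).
  by exists (swap w); rewrite -[f]swapK e swapM !expr2 swapM.
by exists (swap z); rewrite -[v]swapK -swapM -hz swap1.
Qed.

Lemma swap_neq0 f : f != 0 -> swap f != 0.
Proof. by apply: contra => /eqP e; rewrite -[f]swapK e; apply/eqP/cfP => i j; rewrite cf_mk !cf0. Qed.

Lemma ord_swap f : f != 0 -> ord (swap f) = ord f.
Proof.
move=> f0; apply: ordE; have /is_ordE[h0 [i io fi]] := ordP f0.
apply/is_ordE; split=> [i' j ij|]; first by rewrite cf_mk h0 // addnC.
by exists (ord f - i)%N; rewrite ?leq_subr // cf_mk subKn.
Qed.

Lemma isolated_Y f : f != 0 -> cf f 0 0 = 0 -> square_free f ->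
  (forall k, (0 < k <= ord f)%N -> k%:R != 0 :> K) -> exists k, Jac f (serY K ^+ k).
Proof.
move=> f0 f00 sf hch.
have [|k hk] := isolated_X (swap_neq0 f0) f00 (square_free_swap sf); first by rewrite ord_swap.
exists k; rewrite -[f]swapK; have := Jac_swap hk.
rewrite -[_ ^+ k]mulr1 -(expr0 (serY K)) monoXY swap_mono -monoXY expr0 mul1r; exact.
Qed.

End IsolatedSing.

(** * Termination of the blowing ups *)

Section SlopeHom.
Variable K : closedFieldType.
Local Notation X := (serX K).
Local Notation Y := (serY K).
Implicit Types f g h u z : mpser K 2.

(** [K] is viewed as a quotient of the power series ring in zero variables, so the results on
    substitutions over [B] apply to [B = K]. *)
Let evs : forall b : K, exists r, (@ev0 K 0 : {rmorphism mpser K 0 -> K}) r = b := @ev0_surj K 0.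
Let sep := @pow_sep _ _ _ _ evs.
Let mX := max_serX evs.
Let mS (c : K) : max_ideal (X * (Y + ser_const 2 c)).
Proof. by rewrite mulrC; apply: (idealM (max_S_ideal evs)). Qed.
Let sP c := slope_subst evs c.

Lemma slopeSM c f g : slopeS c (f * g) = slopeS c f * slopeS c g.
Proof. exact: (substM sep mX (@mS c) (sP c)). Qed.
Lemma slopeSD c f g : slopeS c (f + g) = slopeS c f + slopeS c g.
Proof. exact: (substD sep (sP c)). Qed.
Lemma slopeS_X c : slopeS c X = X.
Proof. exact: (substX sep (sP c)). Qed.
Lemma slopeS_Y c : slopeS c Y = X * (Y + ser_const 2 c).
Proof. exact: (substY sep (sP c)). Qed.
Lemma slopeS_exp c f k : slopeS c (f ^+ k) = slopeS c f ^+ k.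
Proof. exact: (substX_n sep mX (@mS c) (sP c)). Qed.

Lemma slopeS_dy c f : dy (slopeS c f) = X * slopeS c (dy f).
Proof.
apply: cfP => i j; rewrite cf_XM cf_mk cf_slopeS; case: i => [|i].
  by rewrite big_ord1 /= bin0n !mul0r mulr0.
rewrite big_ord_recl bin0n !mul0r add0r mulr_sumr cf_slopeS; apply: eq_bigr => l _.
rewrite cf_mk lift0 !subSS; have := mul_bin_diag l.+1 j; move/(congr1 (fun n : nat => n%:R : K)).
by rewrite !natrM => h; transitivity ((j.+1%:R * 'C(l.+1, j.+1)%:R) * c ^+ (l - j) * cf f (i - l) l.+1);
  [|rewrite -h]; ring.
Qed.

Lemma slopeS_dx c f : X * dx (slopeS c f) = slopeS c (X * dx f + Y * dy f).
Proof.
apply: cfP => i j; rewrite cf_Xdx !cf_slopeS mulr_sumr; apply: eq_bigr => l _.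
rewrite cfD cf_Xdx cf_Ydy mulrCA; congr (_ * _); rewrite -mulrDl -natrD subnK //.
by rewrite -ltnS ltn_ord.
Qed.

Lemma vertS_swap f : vertS f = swap (slopeS 0 (swap f)).
Proof.
apply: cfP => i j; rewrite cf_vertS cf_mk cf_slopeS; case: leqP => [ij|ji].
  rewrite (bigD1 (Ordinal (_ : i < j.+1)%N)) //= binn subnn expr0 !mul1r big1 ?addr0 // => l.
  rewrite -val_eqE /= => li; case: (ltngtP l i) li => // lt _.
    by rewrite bin_small // !mul0r.
  by rewrite -subn_gt0 in lt; rewrite expr0n (gtn_eqF lt) mulr0 mul0r.
rewrite big1 // => l _; rewrite bin_small ?mul0r //.
by apply: leq_ltn_trans ji; rewrite -ltnS ltn_ord.
Qed.

Lemma vertT_swap n f : vertT n f = swap (slopeT n 0 (swap f)).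
Proof.
apply: cfP => i [|j]; first by [].
rewrite -[LHS]/(cf (vertS f) i (j + n)) -[RHS]/(cf (slopeS 0 (swap f)) (j + n) i).
by rewrite vertS_swap.
Qed.

Lemma isbase_swap f : f != 0 -> isbase (swap f) = isbase f.
Proof.
move=> f0; rewrite /isbase ord_swap //; suff -> : disc (swap f) = disc f by [].
by rewrite /disc !cf_mk; ring.
Qed.

Lemma ord_monoM a b h : h != 0 -> ord (mono (mn a b) * h) = (a + b + ord h)%N.
Proof.
move=> h0; have /is_ordE[hl [i io hi]] := ordP h0; apply: ordE; apply/is_ordE; split.
  move=> k l kl; rewrite cf_monoM; case: ifP => // /andP[ak bl]; apply: hl; lia.
exists (a + i)%N; first by lia.
rewrite cf_monoM leq_addr /= addKn (_ : (_ - _ - _)%N = ord h - i)%N; last by lia.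
by rewrite (_ : (b <= _)%N) //; lia.
Qed.

(* The strict transform h0 along the slope c of a series h of order m. *)
Lemma slopeS_strict c h : h != 0 -> exists h0,
  [/\ X ^+ ord h * h0 = slopeS c h, (exists2 d, (d <= ord h)%N & regular d h0),
      cf h0 0 (ord h) = cf h 0 (ord h) &
      ((forall j, (j < ord h)%N -> cf h0 0 j = 0) ->
        cf h 0 (ord h) != 0 /\ (c = 0 -> (0 < ord h)%N -> cf h (ord h) 0 = 0))].
Proof.
move=> h0; set m := ord h; pose h' : mpser K 2 := mk (fun i j => cf (slopeT m c h) i.+1 j).
have hE i j : cf h' i j = cf (slopeS c h) (i + m) j by rewrite !cf_mk.
have hc j : cf h' 0 j = (cone h \Po ('X + c%:P))`_j by rewrite cf_mk slopeT_cone.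
have P0 := comp_XaddC_neq0 c (cone_neq0 h0).
have Psz : (size (cone h \Po ('X + c%:P)) <= m.+1)%N.
  by rewrite size_comp_poly2 ?size_XaddC // size_poly.
have hm : cf h' 0 m = cf h 0 m.
  rewrite hE cf_slopeS big_ord_recr /= binn subnn expr0 !mul1r big1 ?add0r // => l _.
  by rewrite bin_small ?mul0r // ltn_ord.
have ex0 : exists2 j, (j <= m)%N & cf h' 0 j != 0.
  exists (size (cone h \Po ('X + c%:P))).-1.
    by move: Psz; case: (size _).
  by rewrite hc -lead_coefE lead_coef_eq0.
have [d dm rd] : exists2 d, (d <= m)%N & regular d h'.
  have [j jm hj] := ex0; have ex' : exists j, cf h' 0 j != 0 by exists j.
  case: (ex_minnP ex') => d hd dmin; exists d; first exact: leq_trans (dmin _ hj) jm.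
  by split=> // i id; apply/eqP; apply: contraTT id => /dmin; rewrite -leqNgt.
exists h'; split=> //; [|by exists d|].
  have e : X ^+ m * slopeT m c h = X * slopeS c h by apply: slopeTP => i j; apply: ord_low.
  apply: (@serXn_inj _ 1); rewrite !expr1 -e mulrCA; congr (_ * _); by apply: cfP => -[|i] j; rewrite cf_XM.
move=> h'0; split.
  have [j jm hj] := ex0; rewrite -hm; move: jm; rewrite leq_eqVlt => /orP[/eqP <- //|jm].
  by rewrite h'0 ?eqxx in hj.
move=> c0 m0; rewrite -(h'0 0%N m0) hE add0n cf_slopeS c0 big_ord_recl big1 ?addr0 => [|l _].
  by rewrite bin0 subn0 expr0 !mul1r subn0.
by rewrite lift0 subn0 expr0n mulr0 mul0r.
Qed.

(** Chain rule for [slopeS c h = x^m h0]. It costs one factor [x], so a power of [x] in the ideal of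
    the singular locus loses [m - 1] in its exponent at each blowing up. *)
Lemma Jac_slopeS c m h h0 z : X ^+ m * h0 = slopeS c h -> Jac h z ->
  exists2 w, Jac h0 w & X * slopeS c z = X ^+ m * w.
Proof.
move=> e [a [b [d ->]]]; have hJ := Jac_ideal h0.
have dyE : X * slopeS c (dy h) = X ^+ m * dy h0.
  rewrite -slopeS_dy -e; apply: cfP => i j; rewrite cf_mk !cf_XnM cf_mk.
  by case: ifP; rewrite ?mulr0.
have dxE : X * slopeS c (dx h) = X ^+ m * (m%:R * h0 + X * dx h0 - (Y + ser_const 2 c) * dy h0).
  have -> : X * slopeS c (dx h) = X * dx (slopeS c h) - (Y + ser_const 2 c) * (X * slopeS c (dy h)).
    by rewrite slopeS_dx slopeSD !slopeSM slopeS_X slopeS_Y; ring.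
  have -> : X * dx (slopeS c h) = X ^+ m * (m%:R * h0 + X * dx h0).
    rewrite -e; apply: cfP => i j; rewrite cf_Xdx !cf_XnM cfD.
    case: leqP => mi; last by rewrite mulr0.
    rewrite cf_Xdx -[m%:R : mpser K 2](rmorph_nat (@ser_const K 2)) cf_constM -mulrDl -natrD subnKC //.
  by rewrite dyE; ring.
exists (X * slopeS c a * h0 + slopeS c b * (m%:R * h0 + X * dx h0 - (Y + ser_const 2 c) * dy h0) + slopeS c d * dy h0).
  apply: (idealD hJ); [apply: (idealD hJ)|]; apply: (idealM hJ).
  - exact: Jac_self.
  - apply: (idealB hJ); last by apply: (idealM hJ); apply: Jac_dy.
    by apply: (idealD hJ); apply: (idealM hJ); [exact: Jac_self|exact: Jac_dx].
  - exact: Jac_dy.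
rewrite !slopeSD !slopeSM -e !mulrDr [X * (slopeS c b * _)]mulrCA dxE.
rewrite [X * (slopeS c d * _)]mulrCA dyE; ring.
Qed.

End SlopeHom.

Section Strict.
Variable K : closedFieldType.
Local Notation X := (serX K).
Local Notation Y := (serY K).
Implicit Types (f g h u z : mpser K 2) (e : bool * bool).

Lemma cf_slopeS0 h i : cf (slopeS 0 h) i 0 = cf h i 0.
Proof.
rewrite cf_slopeS big_ord_recl big1 ?addr0 => [|l _]; first by rewrite bin0 subn0 expr0 !mul1r subn0.
by rewrite lift0 subn0 expr0n mulr0 mul0r.
Qed.

Lemma cancel_Xn p m u w d : cf u 0 d != 0 -> X ^+ p * u = X ^+ m * w ->
  (m <= p)%N /\ w = X ^+ (p - m) * u.
Proof.
move=> ud e; have mp : (m <= p)%N.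
  have := congr1 (fun z => cf z p d) e; rewrite !cf_XnM leqnn subnn => ez.
  by rewrite ez in ud; move: ud; case: leqP => // _; rewrite eqxx.
by split=> //; apply: (@serXn_inj _ m); rewrite -e mulrA -exprD subnKC.
Qed.

Lemma cf_Yc_n (c : K) b : cf ((Y + ser_const 2 c) ^+ b) 0 b != 0.
Proof. by rewrite cf_expYc binn subnn expr0 mulr1 oner_neq0. Qed.

(* h is the strict transform: the total transform f without its exceptional axes. *)
Record strict e f h : Prop := Strict {
  strict_eq : f = X ^+ e.1 * Y ^+ e.2 * h;
  strict_neq0 : h != 0;
  strict_pos : (0 < e.1 + e.2 + ord h)%N;
  strict_x : e.1 -> exists j, cf h 0 j != 0;
  strict_y : e.2 -> exists i, cf h i 0 != 0;
  strict_jx : exists a b, (b = 0%N \/ e.2) /\ Jac h (X ^+ a * Y ^+ b);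
  strict_jy : exists a b, (a = 0%N \/ e.1) /\ Jac h (X ^+ a * Y ^+ b) }.

Lemma swap_X : swap X = Y.
Proof. by rewrite serX_mono serY_mono swap_mono. Qed.
Lemma swap_Y : swap Y = X.
Proof. by rewrite -swap_X swapK. Qed.
Lemma swap_exp f k : swap (f ^+ k) = swap f ^+ k.
Proof. by elim: k => [|k IH]; rewrite ?expr0 ?swap1 // !exprS swapM IH. Qed.

Lemma strict_swap e f h : strict e f h -> strict (e.2, e.1) (swap f) (swap h).
Proof.
case=> -> h0 pos hx hy hjx hjy; split=> /=.
- by rewrite !swapM !swap_exp swap_X swap_Y [Y ^+ _ * _]mulrC.
- exact: swap_neq0.
- by rewrite ord_swap // [(e.2 + _)%N]addnC.
- exact: hy.
- exact: hx.
- have [a [b [ab hJ]]] := hjy; exists b, a; split=> //.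
  by have := Jac_swap hJ; rewrite swapM !swap_exp swap_X swap_Y mulrC.
have [a [b [ab hJ]]] := hjx; exists b, a; split=> //.
by have := Jac_swap hJ; rewrite swapM !swap_exp swap_X swap_Y mulrC.
Qed.

Lemma strict_ord e f h : strict e f h -> ord f = (e.1 + e.2 + ord h)%N.
Proof. by case=> -> h0 _ _ _ _ _; rewrite monoXY ord_monoM. Qed.

(** The order of the strict transform can only persist if the tangent cone is a multiple line that
    is not vertical, and then the new strict transform is not tangent to [x = 0]. The remaining
    clauses describe what drops in that case: the power of [x] in the ideal of the singular locus,
    or the contact with [y = 0]. *)
Lemma strict_slope e f h c : strict e f h -> exists h', [/\
  strict (flags (Some c) e) (slopeT (ord f) c f) h',
  (ord h' <= ord h)%N,
  ord h' = ord h -> [/\ cf h' 0 (ord h) != 0, cf h 0 (ord h) != 0 &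
    c = 0 -> (0 < ord h)%N -> cf h (ord h) 0 = 0],
  e.2 = false -> forall k, Jac h (X ^+ k) -> (ord h <= k.+1)%N /\ Jac h' (X ^+ (k.+1 - ord h)) &
  c = 0 -> forall i, cf h' i 0 = cf h (i + ord h) 0].
Proof.
move=> hs; have fo := strict_ord hs; case: hs => fE h0 pos hx hy hjx _.
have [g [gE [d dm rg] gm gc]] := slopeS_strict c h0; set m := ord h in fo gE dm gm gc *.
(* An old exceptional axis [y = 0] that misses the new point becomes the unit [y + c], absorbed into
   the strict transform. *)
pose u : mpser K 2 := if e.2 && (c != 0) then Y + ser_const 2 c else 1.
have Yc0 : c != 0 -> cf (Y + ser_const 2 c) 0 0 != 0.
  by have := cf_expYc c 1 0 0; rewrite expr1 => -> c0; rewrite bin0 subn0 expr1 mul1r.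
have u0 : cf u 0 0 != 0.
  by rewrite /u; case: ifP => [/andP[_ /Yc0]|_] //; rewrite cf1 oner_neq0.
have ru : regular 0 u by split.
have [v uv] := regular_unit ru; have vu : v * u = 1 by rewrite mulrC.
have rh' := regularM ru rg; rewrite add0n in rh'.
have h'0 := regular_neq0 rh'.
have ho : (ord (u * g)%R <= d)%N by have := ord_le rh'.2.
have jac a b : (b = 0%N \/ e.2) -> Jac h (X ^+ a * Y ^+ b) ->
    (m <= (a + b).+1)%N /\ exists b', [/\ b' = 0%N \/ e.2 && (c == 0), b = 0%N -> b' = 0%N &
      Jac (u * g) (X ^+ ((a + b).+1 - m) * Y ^+ b')].
  move=> hb hJ; have [w Jw e0] := Jac_slopeS gE hJ.
  have e1 : X ^+ (a + b).+1 * (Y + ser_const 2 c) ^+ b = X ^+ m * w.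
    by rewrite -e0 slopeSM !slopeS_exp slopeS_X slopeS_Y exprMn exprS exprD; ring.
  have [mp wE] := cancel_Xn (cf_Yc_n c b) e1; split=> //.
  rewrite wE in Jw; have hJg := Jac_ideal g.
  have [ec|ec] := boolP (e.2 && (c == 0)).
    exists b; split; [by right|by []|]; apply: (Jac_unit vu).
    by move: Jw; have /andP[_ /eqP ->] := ec; rewrite rmorph0 addr0.
  exists 0%N; split; [by left|by []|]; apply: (Jac_unit vu); rewrite expr0 mulr1.
  case: hb => [b0|e2]; first by move: Jw; rewrite b0 expr0 mulr1.
  rewrite e2 /= in ec; have [v' hv'] := regular_unit (conj (fun j (h : (j < 0)%N) => match notF h return cf _ 0 j = 0 with end) (Yc0 ec)).
  have -> : X ^+ ((a + b).+1 - m) = v' ^+ b * (X ^+ ((a + b).+1 - m) * (Y + ser_const 2 c) ^+ b).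
    by rewrite mulrCA -exprMn [v' * _]mulrC hv' expr1n mulr1.
  exact: (idealM hJg).
have g00 : c = 0 -> forall i, cf (u * g) i 0 = cf h (i + m) 0.
  move=> c0 i; rewrite /u c0 eqxx andbF mul1r -[RHS]cf_slopeS0; move: gE; rewrite c0 => <-; rewrite cf_XnM.
  by rewrite leq_addl addnK.
exists (u * g); split=> //.
- split=> //.
  + rewrite -[(flags _ _).1]/true -[(flags _ _).2]/(e.2 && (c == 0)).
    apply: (@serXn_inj _ (ord f)); rewrite slopeTP; last by move=> i j; apply: ord_low.
    rewrite fo {1}fE !slopeSM !slopeS_exp slopeS_X slopeS_Y -gE !exprD expr1.
    rewrite /u; case: (e.2) => /=; last by rewrite !expr0; ring.
    case: eqP => [->|_] /=; last by rewrite expr1 expr0; ring.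
    by rewrite rmorph0 addr0 expr1; ring.
  + by move=> _; exists d; case: rh'.
  + rewrite -[(flags _ _).2]/(e.2 && (c == 0)) => /andP[/hy [i hi] /eqP c0]; exists (i - m)%N.
    by rewrite g00 // subnK //; have := ord_le hi; rewrite addn0.
  + have [a [b [hb hJ]]] := hjx; have [_ [b' [h1 _ h2]]] := jac a b hb hJ.
    by exists ((a + b).+1 - m)%N, b'.
  have [a [b [hb hJ]]] := hjx; have [_ [b' [h1 _ h2]]] := jac a b hb hJ.
  by exists ((a + b).+1 - m)%N, b'; split=> //; right.
- exact: leq_trans ho dm.
- move=> hm; have dE : d = m by apply/eqP; rewrite eqn_leq dm -hm ho.
  have [|c1 c2] := gc; first by case: rg => rg _ j jm; apply: rg; rewrite dE.
  by split=> //; case: rh'; rewrite dE.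
move=> e2 k Jk; have [||mk [b' [_ b0 hJ]]] := jac k 0%N; [by left|by rewrite expr0 mulr1|].
by move: mk hJ; rewrite b0 // addn0 expr0 mulr1.
Qed.

Lemma strict_vert e f h : strict e f h -> exists h', [/\
  strict (e.1, true) (vertT (ord f) f) h',
  (ord h' <= ord h)%N,
  ord h' = ord h -> [/\ cf h' (ord h) 0 != 0, cf h (ord h) 0 != 0 &
    (0 < ord h)%N -> cf h 0 (ord h) = 0],
  e.1 = false -> forall k, Jac h (Y ^+ k) -> (ord h <= k.+1)%N /\ Jac h' (Y ^+ (k.+1 - ord h)) &
  forall j, cf h' 0 j = cf h 0 (j + ord h)].
Proof.
move=> hs; have h0 := strict_neq0 hs; have [g [gs go gm gJ gc]] := strict_slope 0 (strict_swap hs).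
have f0 : f != 0.
  have [eF _ _ _ _ _ _] := hs; apply: contra h0 => /eqP fz; apply/eqP/cfP => i j.
  have := congr1 (fun z => cf z (e.1 + i) (e.2 + j)) eF.
  by rewrite fz monoXY cf_monoM !leq_addr !addKn !cf0.
have g0 := strict_neq0 gs.
have os := ord_swap h0.
exists (swap g); rewrite !ord_swap //.
have := strict_swap gs; rewrite /= eqxx andbT ord_swap // => gs'.
split; rewrite ?vertT_swap //.
- by rewrite -os.
- by rewrite os in gm; move=> /gm [h1 h2 h3]; split=> // m0; apply: h3.
- move=> e1 k Jk; rewrite os in gJ; have [||le hJ] := gJ _ k; [by []|by have := Jac_swap Jk; rewrite swap_exp swap_Y|].
  by split=> //; have := Jac_swap hJ; rewrite swap_exp swap_X.
by move=> j; have := gc (erefl _) j; rewrite os.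
Qed.

End Strict.

Section Termination.
Variable K : closedFieldType.
Local Notation X := (serX K).
Local Notation Y := (serY K).
Implicit Types (f g h u z : mpser K 2) (e : bool * bool) (dir : option K).

Definition kidK (y x : (bool * bool) * mpser K 2) : Prop :=
  ~~ isbase x.2 /\ exists dir, y = (flags dir x.1, rawTK dir (ord x.2) x.2).

Lemma Acc_kids e f : (~~ isbase f -> forall dir, Acc kidK (flags dir e, rawTK dir (ord f) f)) ->
  Acc kidK (e, f).
Proof. by move=> h; split=> _ [/= nb [dir ->]]; apply: h. Qed.

Lemma strict_neq0f e f h : strict e f h -> f != 0.
Proof.
case=> -> h0 _ _ _ _ _; apply: contra h0 => /eqP fz; apply/eqP/cfP => i j.
have := congr1 (fun z => cf z (e.1 + i) (e.2 + j)) fz.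
by rewrite monoXY cf_monoM !leq_addr !addKn !cf0.
Qed.

Lemma strict_base e f h : strict e f h -> ord h = 0%N -> isbase f.
Proof.
move=> hs h0; have fo := strict_ord hs; have := strict_pos hs; rewrite h0 addn0 in fo *.
rewrite /isbase fo; case: e hs fo => -[] -[] hs fo //= _.
have h00 : cf h 0 0 != 0.
  by have /is_ordE[_ [i]] := ordP (strict_neq0 hs); rewrite h0 leqn0 => /eqP ->.
have -> : disc f = cf h 0 0 ^+ 2; last by rewrite expf_neq0.
by rewrite /disc (strict_eq hs) monoXY !cf_monoM mulr0 subr0.
Qed.

Lemma strict_baseX f h : strict (true, false) f h -> ord h = 1%N -> cf h 0 1 != 0 -> isbase f.
Proof.
move=> hs h1 h01; have fo := strict_ord hs; rewrite /isbase fo h1 /=.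
have -> : disc f = cf h 0 1 ^+ 2; last by rewrite expf_neq0.
by rewrite /disc (strict_eq hs) monoXY !cf_monoM mulr0 subr0.
Qed.

Lemma strict_baseY f h : strict (false, true) f h -> ord h = 1%N -> cf h 1 0 != 0 -> isbase f.
Proof.
move=> hs h1 h10; rewrite -isbase_swap; last exact: strict_neq0f hs.
by apply: (strict_baseX (strict_swap hs)); rewrite ?ord_swap //; apply: strict_neq0 hs.
Qed.

Section Level.
Variable m : nat.
Hypothesis m0 : (0 < m)%N.
Hypothesis IH : forall e f h, strict e f h -> (ord h < m)%N -> Acc kidK (e, f).

(** Kids whose strict transform has smaller order are accessible by [IH]; only those of the same
    order [m] remain to be handled. *)
Lemma Acc_kid e f h : ord h = m -> strict e f h ->
  (~~ isbase f -> forall c h', strict (flags (Some c) e) (slopeT (ord f) c f) h' -> ord h' = m ->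
     [/\ cf h' 0 m != 0, cf h 0 m != 0 & c = 0 -> cf h m 0 = 0] ->
     (e.2 = false -> forall k, Jac h (X ^+ k) -> (m <= k.+1)%N /\ Jac h' (X ^+ (k.+1 - m))) ->
     (c = 0 -> forall i, cf h' i 0 = cf h (i + m) 0) ->
     Acc kidK (flags (Some c) e, slopeT (ord f) c f)) ->
  (~~ isbase f -> forall h', strict (e.1, true) (vertT (ord f) f) h' -> ord h' = m ->
     [/\ cf h' m 0 != 0, cf h m 0 != 0 & cf h 0 m = 0] ->
     (e.1 = false -> forall k, Jac h (Y ^+ k) -> (m <= k.+1)%N /\ Jac h' (Y ^+ (k.+1 - m))) ->
     (forall j, cf h' 0 j = cf h 0 (j + m)) ->
     Acc kidK ((e.1, true), vertT (ord f) f)) ->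
  Acc kidK (e, f).
Proof.
move=> hm hs kS kV; apply: Acc_kids => nb [c|].
  have [h' [hs' le eq hJ hr]] := strict_slope c hs; rewrite hm in le eq hJ hr.
  move: le; rewrite leq_eqVlt => /orP[/eqP hm'|lt]; last exact: IH hs' lt.
  by apply: (kS nb c h') => //; have [h1 h2 h3] := eq hm'; split=> // c0; apply: h3.
have [h' [hs' le eq hJ hr]] := strict_vert hs; rewrite hm in le eq hJ hr.
move: le; rewrite leq_eqVlt => /orP[/eqP hm'|lt]; last exact: IH hs' lt.
by apply: (kV nb h') => //; have [h1 h2 h3] := eq hm'; split=> //; apply: h3.
Qed.

(** While the order stays [m], the exponent [k] drops by [m - 1]. For [m = 1] the strict transform
    is transversal to the exceptional axis, which is a node. *)
Lemma Acc_X k f h : strict (true, false) f h -> ord h = m -> cf h 0 m != 0 ->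
  Jac h (X ^+ k) -> Acc kidK ((true, false), f).
Proof.
have [n] := ubnP k; elim: n k f h => [|n IHk] k f h kn hs hm h0m Jk; first by rewrite ltn0 in kn.
apply: (Acc_kid hm hs) => nb; last by move=> h' _ _ [_ _ h0]; rewrite h0 eqxx in h0m.
move=> c h' hs' hm' [h'0 _ _] /(_ (erefl _) _ Jk) [mk Jk'] _.
apply: (IHk _ _ _ _ hs' hm' h'0 Jk').
have m1 : m != 1%N by apply: contra nb => /eqP m1; move: hm h0m; rewrite m1; apply: strict_baseX.
by clear -kn mk m0 m1; lia.
Qed.

(** At a crossing, a kid of the same order either leaves the axis [y = 0] for good or lowers the
    contact with it by [m]. Vertical kids of the same order are excluded by the coefficient of
    [y^m]. *)
Lemma Acc_X2 e f h : strict e f h -> e.1 -> ord h = m -> cf h 0 m != 0 -> Acc kidK (e, f).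
Proof.
case: e => e1 e2 hs; rewrite -[(e1, e2).1]/e1 => e1T hm h0m.
move: hs; rewrite e1T {e1 e1T} => hs.
have accX f' h' : strict (true, false) f' h' -> ord h' = m -> cf h' 0 m != 0 ->
    Acc kidK ((true, false), f').
  move=> hs' hm' h'0; have [a [b [hb hJ]]] := strict_jx hs'.
  have b0 : b = 0%N by case: hb.
  by apply: (Acc_X hs' hm' h'0 (k := a)); move: hJ; rewrite b0 expr0 mulr1.
case: e2 hs => hs; last exact: accX hs hm h0m.
have [i hi] := strict_y hs isT.
have [n] := ubnP i; elim: n i f h hs hm h0m hi => [|n IHi] i f h hs hm h0m hi in_; first by rewrite ltn0 in in_.
apply: (Acc_kid hm hs) => nb; last by move=> h' _ _ [_ _ h0]; rewrite h0 eqxx in h0m.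
move=> c h' hs' hm' [h'0 _ _] _ hr; move: hs'; rewrite /flags /=.
case: eqP => [c0|_] hs'; last exact: accX hs' hm' h'0.
have mi : (m <= i)%N by have := ord_le hi; rewrite hm addn0.
by apply: (IHi (i - m)%N _ _ hs' hm' h'0); [rewrite hr // subnK|clear -mi m0 in_; lia].
Qed.

Lemma Acc_Y k f h : strict (false, true) f h -> ord h = m -> cf h m 0 != 0 ->
  Jac h (Y ^+ k) -> Acc kidK ((false, true), f).
Proof.
have [n] := ubnP k; elim: n k f h => [|n IHk] k f h kn hs hm h0m Jk; first by rewrite ltn0 in kn.
apply: (Acc_kid hm hs) => nb.
  by move=> c h' hs' hm' [h'0 _ _] _ _; apply: Acc_X2 hs' _ hm' h'0.
move=> h' hs' hm' [h'0 _ _] /(_ (erefl _) _ Jk) [mk Jk'] _.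
apply: (IHk _ _ _ _ hs' hm' h'0 Jk').
have m1 : m != 1%N by apply: contra nb => /eqP m1; move: hm h0m; rewrite m1; apply: strict_baseY.
by clear -kn mk m0 m1; lia.
Qed.

Lemma Acc_Y2 e f h : strict e f h -> e.2 -> ord h = m -> cf h m 0 != 0 -> Acc kidK (e, f).
Proof.
case: e => e1 e2 hs; rewrite -[(e1, e2).2]/e2 => e2T hm h0m.
move: hs; rewrite e2T {e2 e2T} => hs.
case: e1 hs => hs; last first.
  have [a [b [ha hJ]]] := strict_jy hs.
  have a0 : a = 0%N by case: ha.
  by apply: (Acc_Y hs hm h0m (k := b)); move: hJ; rewrite a0 expr0 mul1r.
have [i hi] := strict_x hs isT.
have [n] := ubnP i; elim: n i f h hs hm h0m hi => [|n IHi] i f h hs hm h0m hi in_; first by rewrite ltn0 in in_.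
apply: (Acc_kid hm hs) => nb.
  by move=> c h' hs' hm' [h'0 _ _] _ _; apply: Acc_X2 hs' _ hm' h'0.
move=> h' hs' hm' [h'0 _ _] _ hr.
have mi : (m <= i)%N by have := ord_le hi; rewrite hm add0n.
by apply: (IHi (i - m)%N _ _ hs' hm' h'0); [rewrite hr // subnK|clear -mi m0 in_; lia].
Qed.

(** After one blowing up without loss of order, the new exceptional axis is transversal to the
    strict transform, which is the situation of the two previous cases. *)
Lemma Acc_level e f h : strict e f h -> ord h = m -> Acc kidK (e, f).
Proof.
move=> hs hm; apply: (Acc_kid hm hs) => _.
  by move=> c h' hs' hm' [h'0 _ _] _ _; apply: Acc_X2 hs' _ hm' h'0.
by move=> h' hs' hm' [h'0 _ _] _ _; apply: Acc_Y2 hs' _ hm' h'0.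
Qed.

End Level.

Lemma Acc_strict e f h : strict e f h -> Acc kidK (e, f).
Proof.
have [n] := ubnP (ord h); elim: n e f h => [|n IH] e f h hn hs; first by rewrite ltn0 in hn.
have [h0|h0] := posnP (ord h).
  by apply: Acc_kids => nb; rewrite (strict_base hs h0) in nb.
apply: (Acc_level h0 _ hs (erefl _)) => e' f' h' hs' lt; apply: (IH _ _ _ _ hs').
by apply: leq_trans lt _; rewrite -ltnS.
Qed.

Lemma Acc_root f : f != 0 -> cf f 0 0 = 0 -> square_free f ->
  (forall k, (0 < k <= ord f)%N -> k%:R != 0 :> K) -> Acc kidK ((false, false), f).
Proof.
move=> f0 f00 sf hch; apply: (@Acc_strict _ _ f).
have [k hk] := isolated_X f0 f00 sf hch; have [l hl] := isolated_Y f0 f00 sf hch.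
split; rewrite /= ?expr0 ?mul1r //.
- apply: (ord_ge f0) => i j; rewrite ltnS leqn0 addn_eq0 => /andP[/eqP -> /eqP ->]; exact: f00.
- by exists k, 0%N; rewrite expr0 mulr1; split=> //; left.
by exists 0%N, l; rewrite expr0 mul1r; split=> //; left.
Qed.

(** Every kid of a family projects to a kid of its special fibre, because translations by elements
    of the maximal ideal do not change special fibres. *)
Lemma Acc_kid_rel (N n0 : nat) e (F : mpser (mpser K N) 2) :
  (forall k, (0 < k <= n0)%N -> k%:R != 0 :> K) ->
  node_inv n0 e F -> Acc kidK (e, sp F) -> Acc (@kid_rel K N) (e, F).
Proof.
move=> n0K hi h; move: {-2}(e, sp F) h (erefl (e, sp F)) => x h; elim: h e F hi => {}x _ IH e F hi xE.
split=> -[e' F'] hk; have hi' := kid_inv n0K hi hk.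
apply: (IH (e', sp F')) (hi') (erefl _).
rewrite -xE; rewrite /kid_rel /= in hk.
have [dir k nb td hk'] := hk; split=> //; exists dir; congr (_, _).
rewrite /stepT; case: ifP => cr; first exact: sp_rawT.
rewrite sp_PhiT ?sp_rawT //.
have [] := kid_newton n0K hi td (negbT cr) hk' => k0 G0 hw.
exact: newton_max.
Qed.

End Termination.

(** * The equisingularity ideal *)

Section ESIdeal.
Variables (K : closedFieldType) (N : nat) (I : idealr (mpser K N)) (F : mpser K (N + 2)).
Local Notation R := (mpser K N).
Local Notation F0 := (ser_split F).
Let f := ser_special F.

Let spF0 : sp F0 = f. Proof. by []. Qed.

Hypotheses (f_neq0 : f != 0) (f_sing : ideal2 (serX K) (serY K) f) (f_sqfree : square_free f).
Hypothesis f_char : [pchar K] =i pred0 \/ exists2 p, p \in [pchar K] & (ord f < p)%N.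

Lemma cf_special00 : cf f 0 0 = 0.
Proof.
have [a [b ->]] := (ideal2P _ _ _).1 f_sing.
by rewrite cfD ![_ * ser_var _ _]mulrC cf_XM cf_YM addr0.
Qed.

Lemma small_natr_neq0 k : (0 < k <= ord f)%N -> k%:R != 0 :> K.
Proof.
move=> /andP[k0 kn]; apply/negP => kK; case: f_char => [ch0|[p pch pn]].
  by move/pcharf0P: ch0 => ch0; rewrite ch0 in kK; rewrite (eqP kK) in k0.
rewrite -(dvdn_pcharf pch) in kK.
by have := leq_ltn_trans (leq_trans (dvdn_leq k0 kK) kn) pn; rewrite ltnn.
Qed.

Lemma ord_special_gt0 : (0 < ord f)%N.
Proof.
apply: (ord_ge f_neq0) => i j; rewrite ltnS leqn0 addn_eq0 => /andP[/eqP -> /eqP ->].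
exact: cf_special00.
Qed.

Lemma root_inv : node_inv (ord f) (false, false) F0.
Proof. by split; rewrite ?spF0 //= ord_special_gt0 /= !addn0. Qed.

Lemma Acc_root_node : Acc (@kid_rel K N) ((false, false), F0).
Proof.
apply: (Acc_kid_rel small_natr_neq0 root_inv); rewrite spF0.
exact: Acc_root f_neq0 cf_special00 f_sqfree small_natr_neq0.
Qed.

Definition low_coef (r : R) : Prop :=
  exists e' F' i j, [/\ reach (false, false) F0 e' F', (i + j < ord (sp F'))%N & r = cf F' i j].

Lemma reach_inv e' F' : reach (false, false) F0 e' F' -> node_inv (ord f) e' F'.
Proof.
move=> h; elim: h => {e' F'}; first exact: root_inv.
by move=> e1 F1 e2 F2 _ hi hk; apply: kid_inv small_natr_neq0 _ _ _ _ hi hk.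
Qed.

Lemma low_coef_max r : ideal_gen low_coef r -> r 0%MM = 0.
Proof.
have hm : is_ideal (fun r : R => r 0%MM = 0).
  by split=> [|x y hx hy|x y hy]; rewrite ?ser0 ?serD ?hx ?hy ?addr0 // serM0 hy mulr0.
apply: (ideal_gen_min hm) => _ [e' [F' [i [j [_ ij ->]]]]].
by have := ord_low ij; rewrite cf_sp.
Qed.

Lemma base_proj_surj (y : base_ring I) : exists r, base_proj I r = y.
Proof. by exists (repr y); apply: reprK. Qed.

Definition ES_pred (y : base_ring I) : bool :=
  `[< exists2 r, ideal_gen low_coef r & base_proj I r = y >].

Let genI := ideal_gen_ideal low_coef.

Lemma ES_closed : idealr_closed ES_pred.
Proof.
split.
- by apply/asboolP; exists 0; [exact: (ideal0 genI)|rewrite rmorph0].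
(* Ideals of type [idealr] are proper: here the generators have no constant term, while elements of
   the kernel of the projection are not units. *)
- apply/negP => /asboolP[r /low_coef_max r0 e].
  have : ker (base_proj I) (1 - r) by rewrite /ker rmorphB rmorph1 e subrr.
  by move/ker_max/eqP; rewrite serB r0 ser1 eqxx subr0 oner_eq0.
move=> a u v /asboolP[r hr <-] /asboolP[s hs <-]; have [b <-] := base_proj_surj a.
apply/asboolP; exists (b * r + s); last by rewrite rmorphD rmorphM.
by apply: (idealD genI) => //; apply: (idealM genI).
Qed.

HB.instance Definition _ := isIdealr.Build (base_ring I) ES_pred ES_closed.

Definition ES : idealr (base_ring I) := ES_pred.

Lemma equisingular_modE (J : idealr (base_ring I)) :
  equisingular_mod J F <-> forall r, low_coef r -> base_proj I r \in J.
Proof.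
pose pi : {rmorphism R -> quot_ring J} := quot_proj J \o base_proj I.
have pi_surj y : exists r, pi r = y.
  have [r hr] := base_proj_surj (repr y); exists r.
  by rewrite /pi /= hr; apply: reprK.
have pi_const c : pi (ser_const N c) = quot_const J c by [].
have kerE r : ker pi r <-> base_proj I r \in J.
  have q0 : quot_proj J 0 = 0 := rmorph0 (quot_proj J).
  rewrite -[base_proj I r]subr0 Quotient.idealrBE /ker; split=> [h|/eqP h].
    by apply/eqP; apply: etrans h (esym q0).
  exact: etrans h q0.
have h0 : ordge 1 (0 : R) by apply: ordge0.
have Phi00 : Phi 0 0 F0 = F0 := Phid00 false F0.
have iff := ESR_iff small_natr_neq0 (ker_ideal pi) (@ker_max _ _ _ pi) root_inv Acc_root_node.
split=> [h r [e' [F' [i [j [hr ij ->]]]]]|h].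
  have [_ _] := ESR_of_equisingular pi_surj pi_const h (erefl _) spF0 (rmorph0 pi) (rmorph0 pi) f_neq0 ord_special_gt0.
  by rewrite Phi00 => /iff /(_ _ _ hr) hl; apply/kerE; apply: hl.
have hE : ESR (ker pi) F0.
  by apply/iff => e' F' hr i j ij; apply/kerE; apply: h; exists e', F', i, j.
have := equisingular_of_ESR pi_surj pi_const hE (esym Phi00) h0 h0 f_neq0 ord_special_gt0.
by rewrite rmorph0.
Qed.

Lemma ES_generates (hs : seq R) : (forall r, r \in hs <-> low_coef r) ->
  generates (map (base_proj I) hs) ES.
Proof.
move=> hE y; split=> [/asboolP[_ [l hl ->] <-]|[l hl ->]].
  exists [seq (base_proj I p.1, base_proj I p.2) | p <- l].
    by move=> p /mapP[q /hl /hE hq ->]; apply: map_f.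
  by rewrite rmorph_sum big_map; apply: eq_bigr => q _; rewrite rmorphM.
rewrite big_seq; apply: rpred_sum => p /hl /mapP[r /hE hr ->].
apply: idealMr; apply/asboolP; exists r => //.
exact: ideal_gen_sub.
Qed.

Lemma ES_min (J : idealr (base_ring I)) : equisingular_mod J F -> {subset ES <= J}.
Proof.
move=> /equisingular_modE h y /asboolP[_ [l hl ->] <-].
rewrite rmorph_sum big_seq; apply: rpred_sum => p /hl /h hp.
by rewrite rmorphM; apply: idealMr.
Qed.

Lemma ES_equisingular : equisingular_mod ES F.
Proof.
apply/equisingular_modE => r hr; apply/asboolP; exists r => //; exact: ideal_gen_sub.
Qed.

End ESIdeal.

Local Notation tnil := Defs.Nil.
Local Notation tcons := Defs.Cons.

(** * Computable functions *)

Section Computable.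
Variable K : fieldType.

Record world := World { wrt : {poly K} -> K; winp : nat -> seq nat -> K }.

Class encodable (A : Type) := encode : A -> tree K.

#[global] Instance encodable_nat : encodable nat := enc_nat K.
#[global] Instance encodable_unit : encodable unit := fun _ => tnil.
#[global] Instance encodable_bool : encodable bool := fun b => if b then tcons tnil tnil else tnil.
#[global] Instance encodable_field : encodable K := @Atom K.
#[global] Instance encodable_pair A B (eA : encodable A) (eB : encodable B) : encodable (A * B) :=
  fun x => tcons (encode x.1) (encode x.2).
#[global] Instance encodable_seq A (eA : encodable A) : encodable (seq A) := enc_seq encode.

(** The program is chosen before the world, so one program serves all root selectors and all input
    series. *)
Definition computable A B (eA : encodable A) (eB : encodable B) (f : world -> A -> B) : Prop :=
  exists p, forall w a, exec (wrt w) (winp w) p (encode a) (encode (f w a)).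
Arguments computable {A B eA eB} f.

Section Base.
Context {A B C D : Type} {eA : encodable A} {eB : encodable B} {eC : encodable C} {eD : encodable D}.

Lemma comp_ext (f g : world -> A -> B) : (forall w x, f w x = g w x) -> computable f -> computable g.
Proof. by move=> fg [p hp]; exists p => w a; rewrite -fg. Qed.

Lemma comp_id : computable (fun w (x : A) => x).
Proof. by exists PId => w a; constructor. Qed.

Lemma comp_app (f : world -> A -> B) (g : world -> B -> C) :
  computable g -> computable f -> computable (fun w x => g w (f w x)).
Proof. by move=> [q hq] [p hp]; exists (PSeq p q) => w a; econstructor; [apply: hp|apply: hq]. Qed.

Lemma comp_pair (f : world -> A -> B) (g : world -> A -> C) :
  computable f -> computable g -> computable (fun w x => (f w x, g w x)).
Proof. by move=> [p hp] [q hq]; exists (PCons p q) => w a; constructor; [apply: hp|apply: hq]. Qed.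

Lemma comp_fst (f : world -> A -> B * C) : computable f -> computable (fun w x => (f w x).1).
Proof.
by move=> [p hp]; exists (PSeq p PHead) => w a; econstructor; [apply: hp|exact: (ExecHead _ _ (encode _))].
Qed.

Lemma comp_snd (f : world -> A -> B * C) : computable f -> computable (fun w x => (f w x).2).
Proof.
by move=> [p hp]; exists (PSeq p PTail) => w a; econstructor; [apply: hp|exact: (ExecTail _ _ (encode _))].
Qed.

Lemma comp_tt : computable (fun w (x : A) => tt).
Proof. by exists PNil => w a; constructor. Qed.
Lemma comp_nil : computable (fun w (x : A) => [::] : seq B).
Proof. by exists PNil => w a; constructor. Qed.
Lemma comp_cons (f : world -> A -> B) (s : world -> A -> seq B) :
  computable f -> computable s -> computable (fun w x => f w x :: s w x).
Proof. by move=> [p hp] [q hq]; exists (PCons p q) => w a; constructor; [apply: hp|apply: hq]. Qed.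
Lemma comp_false : computable (fun w (x : A) => false).
Proof. by exists PNil => w a; constructor. Qed.
Lemma comp_true : computable (fun w (x : A) => true).
Proof. by exists (PCons PNil PNil) => w a; constructor; constructor. Qed.

Lemma comp_if (b : world -> A -> bool) (f g : world -> A -> B) :
  computable b -> computable f -> computable g -> computable (fun w x => if b w x then f w x else g w x).
Proof.
move=> [p hp] [q hq] [r hr]; exists (PIf p q r) => w a; have := hp w a.
by case: (b w a) => h; [apply: ExecIfTrue h _ (hq _ _)|apply: ExecIfFalse h _ (hr _ _)].
Qed.

Lemma comp_nilp (s : world -> A -> seq B) : computable s -> computable (fun w x => nilp (s w x)).
Proof.
move=> [p hp]; exists (PIf p PNil (PCons PNil PNil)) => w a; have := hp w a.
case: (s w a) => [|b t] h; first by apply: ExecIfFalse h _ _ => //; do !constructor.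
by apply: ExecIfTrue h _ _ => //; constructor.
Qed.

Lemma comp_head (d : world -> A -> B) (s : world -> A -> seq B) :
  computable d -> computable s -> computable (fun w x => seq.head (d w x) (s w x)).
Proof.
move=> [q hq] [p hp]; exists (PIf p (PSeq p PHead) q) => w a; have := hp w a.
case: (s w a) => [|b t] h; first by apply: ExecIfFalse h _ (hq _ _).
by apply: (ExecIfTrue _ h) => //; apply: (ExecSeq h); exact: (ExecHead _ _ (encode (b :: t))).
Qed.

Lemma comp_behead (s : world -> A -> seq B) : computable s -> computable (fun w x => behead (s w x)).
Proof.
move=> [p hp]; exists (PSeq p PTail) => w a; apply: (ExecSeq (hp w a)).
by case: (s w a) => [|b t]; [exact: (ExecTail _ _ tnil)|exact: (ExecTail _ _ (encode (b :: t)))].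
Qed.

(** A while loop on triples consisting of the remaining list, the accumulator and the fixed
    context. *)
Lemma comp_foldl (h : world -> A -> C -> B -> C) (z : world -> A -> C) (s : world -> A -> seq B) :
  computable (fun w (t : A * (C * B)) => h w t.1 t.2.1 t.2.2) -> computable z -> computable s ->
  computable (fun w x => foldl (h w x) (z w x) (s w x)).
Proof.
move=> [ph hh] [pz hz] [ps hs].
pose ctx := PSeq PTail PTail; pose acc := PSeq PTail PHead; pose item := PSeq PHead PHead.
pose body := PCons (PSeq PHead PTail) (PCons (PSeq (PCons ctx (PCons acc item)) ph) ctx).
exists (PSeq (PCons ps (PCons pz PId)) (PSeq (PWhile PHead body) (PSeq PTail PHead))) => w x.
apply: (ExecSeq (u := tcons (encode (s w x)) (tcons (encode (z w x)) (encode x)))).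
  by do !constructor; [apply: hs|apply: hz].
apply: (ExecSeq (u := tcons tnil (tcons (encode (foldl (h w x) (z w x) (s w x))) (encode x)))); last first.
  by apply: ExecSeq; [exact: (ExecTail _ _ (tcons _ _))|exact: (ExecHead _ _ (tcons _ _))].
elim: (s w x) (z w x) => [|b t IH] c.
  exact: (ExecWhileStop _ (ExecHead _ _ (tcons tnil _))).
apply: (ExecWhileStep (ExecHead _ _ (tcons _ _)) _ _ (IH _)) => //.
constructor; first by apply: ExecSeq; [exact: (ExecHead _ _ (tcons _ _))|exact: (ExecTail _ _ (tcons _ _))].
have ctxE u v v' : exec (wrt w) (winp w) ctx (tcons u (tcons v v')) v'.
  by apply: ExecSeq; [exact: (ExecTail _ _ (tcons _ _))|exact: (ExecTail _ _ (tcons _ _))].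
constructor; last exact: ctxE.
apply: ExecSeq (hh w (x, (c, b))); constructor; first exact: ctxE.
constructor; first by apply: ExecSeq; [exact: (ExecTail _ _ (tcons _ _))|exact: (ExecHead _ _ (tcons _ _))].
by apply: ExecSeq; [exact: (ExecHead _ _ (tcons _ _))|exact: (ExecHead _ _ (tcons _ _))].
Qed.

(** Numbers are unary, hence have the same encoding as lists of units, so list programs also compute
    on numbers. *)
Lemma enc_nseq k : encode k = encode (nseq k tt).
Proof. by elim: k => // k; rewrite /encode /= => ->. Qed.

Lemma comp_0 : computable (fun w (x : A) => 0%N).
Proof. by exists PNil => w a; constructor. Qed.
Lemma comp_S (n : world -> A -> nat) : computable n -> computable (fun w x => (n w x).+1).
Proof. by move=> [p hp]; exists (PCons PNil p) => w a; constructor; [constructor|apply: hp]. Qed.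
Lemma comp_nsequ (n : world -> A -> nat) : computable n -> computable (fun w x => nseq (n w x) tt).
Proof. by move=> [p hp]; exists p => w a; rewrite -enc_nseq. Qed.
Lemma comp_sizeu (s : world -> A -> seq unit) : computable s -> computable (fun w x => size (s w x)).
Proof.
move=> [p hp]; exists p => w a; rewrite enc_nseq; have := hp w a.
by congr exec; congr encode; elim: (s w a) => //= -[] t <-.
Qed.

Lemma comp_one : computable (fun w (x : A) => 1 : K).
Proof. by exists POne => w a; constructor. Qed.
Lemma comp_addr (f g : world -> A -> K) : computable f -> computable g -> computable (fun w x => f w x + g w x).
Proof.
move=> [p hp] [q hq]; exists (PSeq (PCons p q) PAdd) => w a.
by apply: ExecSeq (ExecAdd _ _ _ _); constructor; [apply: hp|apply: hq].
Qed.
Lemma comp_mulr (f g : world -> A -> K) : computable f -> computable g -> computable (fun w x => f w x * g w x).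
Proof.
move=> [p hp] [q hq]; exists (PSeq (PCons p q) PMul) => w a.
by apply: ExecSeq (ExecMul _ _ _ _); constructor; [apply: hp|apply: hq].
Qed.
Lemma comp_oppr (f : world -> A -> K) : computable f -> computable (fun w x => - f w x).
Proof. by move=> [p hp]; exists (PSeq p POpp) => w a; apply: ExecSeq (hp _ _) (ExecOpp _ _ _). Qed.
Lemma comp_invr (f : world -> A -> K) : computable f -> computable (fun w x => (f w x)^-1).
Proof. by move=> [p hp]; exists (PSeq p PInv) => w a; apply: ExecSeq (hp _ _) (ExecInv _ _ _). Qed.
Lemma comp_eqr (f g : world -> A -> K) : computable f -> computable g -> computable (fun w x => f w x == g w x).
Proof.
move=> [p hp] [q hq]; exists (PSeq (PCons p q) PEq) => w a.
by apply: ExecSeq (ExecEq _ _ _ _); constructor; [apply: hp|apply: hq].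
Qed.
Lemma comp_root (s : world -> A -> seq K) : computable s -> computable (fun w x => wrt w (Poly (s w x))).
Proof. by move=> [p hp]; exists (PSeq p PRoot) => w a; apply: ExecSeq (hp _ _) (ExecRoot _ _ _). Qed.
Lemma comp_coef (k : world -> A -> nat) (e : world -> A -> seq nat) :
  computable k -> computable e -> computable (fun w x => winp w (k w x) (e w x)).
Proof.
move=> [p hp] [q hq]; exists (PSeq (PCons p q) PCoef) => w a.
by apply: ExecSeq (ExecCoef _ _ _ _); constructor; [apply: hp|apply: hq].
Qed.

(* Unbounded search is the only source of partiality. *)
Lemma comp_search (t : world -> A -> nat -> bool) (f : world -> A -> nat -> B) :
  computable (fun w (x : A * nat) => t w x.1 x.2) -> computable (fun w (x : A * nat) => f w x.1 x.2) ->
  exists p, forall w a n, t w a n -> (forall i, (i < n)%N -> ~~ t w a i) ->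
    exec (wrt w) (winp w) p (encode a) (encode (f w a n)).
Proof.
move=> [pt ht] [pf hf].
have [q hq] : exists q, forall w (x : A * nat), exec (wrt w) (winp w) q (encode x) (encode (~~ t w x.1 x.2)).
  exists (PIf pt PNil (PCons PNil PNil)) => w x; have := ht w x.
  case: (t w x.1 x.2) => h; first by apply: (ExecIfTrue _ h) => //; constructor.
  by apply: (ExecIfFalse _ h) => //; do !constructor.
exists (PSeq (PCons PId PNil) (PSeq (PWhile q (PCons PHead (PCons PNil PTail))) pf)) => w a n tn tmin.
apply: (ExecSeq (u := encode (a, 0%N))); first by do !constructor.
apply: ExecSeq (hf w (a, n)).
generalize (add0n n); generalize 0%N at 1 2 => i; move: {1}n => m.
elim: m i => [|m IH] i e.
  rewrite addn0 in e; rewrite e; apply: (ExecWhileStop _ (hq w (a, n))); by rewrite /= tn.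
apply: (ExecWhileStep (hq w (a, i))); last by apply: (IH i.+1); rewrite addSnnS.
  by rewrite /= tmin // -e; lia.
constructor; first exact: (ExecHead _ _ (tcons _ _)).
constructor; first by constructor.
exact: (ExecTail _ _ (tcons _ _)).
Qed.

End Base.
End Computable.
Arguments computable {K A B eA eB} f.

(** Extension point of [comp_step], redefined whenever new operations have been shown computable. *)
Ltac comp_user := fail.

Ltac comp_step := lazymatch goal with
  | |- computable (fun w x => x) => apply comp_id
  | |- computable (fun w x => (@?f w x, @?g w x)) => apply (comp_pair (f := f) (g := g))
  | |- computable (fun w x => fst (@?f w x)) => apply (comp_fst (f := f))
  | |- computable (fun w x => snd (@?f w x)) => apply (comp_snd (f := f))
  | |- computable (fun w x => tt) => apply comp_tt
  | |- computable (fun w x => nil) => apply comp_nil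
  | |- computable (fun w x => cons (@?f w x) (@?g w x)) => apply (comp_cons (f := f) (s := g))
  | |- computable (fun w x => true) => apply comp_true
  | |- computable (fun w x => false) => apply comp_false
  | |- computable (fun w x => nilp (@?s w x)) => apply (comp_nilp (s := s))
  | |- computable (fun w x => seq.head (@?d w x) (@?s w x)) => apply (comp_head (d := d) (s := s))
  | |- computable (fun w x => behead (@?s w x)) => apply (comp_behead (s := s))
  | |- computable (fun w x => foldl (@?h w x) (@?z w x) (@?s w x)) =>
      apply (comp_foldl (h := h) (z := z) (s := s)); cbv beta
  | |- computable (fun w x => nseq (@?n w x) tt) => apply (comp_nsequ (n := n))
  | |- computable (fun w x => O) => apply comp_0
  | |- computable (fun w x => S (@?n w x)) => apply (comp_S (n := n))
  | |- computable (fun w x => GRing.add (@?f w x) (@?g w x)) => apply (comp_addr (f := f) (g := g))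
  | |- computable (fun w x => GRing.mul (@?f w x) (@?g w x)) => apply (comp_mulr (f := f) (g := g))
  | |- computable (fun w x => GRing.opp (@?f w x)) => apply (comp_oppr (f := f))
  | |- computable (fun w x => GRing.inv (@?f w x)) => apply (comp_invr (f := f))
  | |- computable (fun w x => GRing.one _) => apply comp_one
  | |- computable (fun w x => wrt w (Poly (@?s w x))) => apply (comp_root (s := s))
  | |- computable (fun w x => winp w (@?k w x) (@?e w x)) => apply (comp_coef (k := k) (e := e))
  | |- computable (fun w x => ?n w (@?f w x)) => apply (comp_app (g := n) (f := f))
  | |- _ => first [comp_user | apply comp_if]
  end.
Ltac comp_tac := cbv beta; repeat (first [assumption | comp_step]).

Section Derived.
Context {K : fieldType} {A B C : Type} {eA : encodable K A} {eB : encodable K B} {eC : encodable K C}.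
Implicit Types (m n : world K -> A -> nat) (b : world K -> A -> bool) (f g : world K -> A -> K).

Lemma iter_foldl (T : Type) (h : T -> T) z k : iter k h z = foldl (fun x _ => h x) z (nseq k tt).
Proof. by elim: k z => // k IH z; rewrite iterSr IH. Qed.

Lemma comp_iter n (h : world K -> A -> C -> C) (z : world K -> A -> C) :
  computable (fun w (t : A * C) => h w t.1 t.2) -> computable n -> computable z ->
  computable (fun w x => iter (n w x) (h w x) (z w x)).
Proof.
move=> ch cn cz; apply: (comp_ext (fun w x => esym (iter_foldl (h w x) (z w x) (n w x)))).
apply: (comp_foldl (h := fun w x c _ => h w x c)) => //; last exact: comp_nsequ.
apply: (comp_app (f := fun w (t : A * (C * unit)) => (t.1, t.2.1)) ch).
by comp_tac.
Qed.

Lemma comp_foldr (h : world K -> A -> B -> C -> C) (z : world K -> A -> C) (s : world K -> A -> seq B) :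
  computable (fun w (t : A * (B * C)) => h w t.1 t.2.1 t.2.2) -> computable z -> computable s ->
  computable (fun w x => foldr (h w x) (z w x) (s w x)).
Proof.
move=> ch cz cs.
have crev : computable (fun w x => rev (s w x)).
  have e (t acc : seq B) : foldl (fun acc a => a :: acc) acc t = catrev t acc by elim: t acc => /=.
  apply: (comp_ext (fun w x => e (s w x) [::])).
  apply: (comp_foldl (h := fun w x acc a => a :: acc)) => //; last exact: comp_nil.
  by comp_tac.
apply: (@comp_ext _ _ _ _ _ (fun w x => foldl (fun c a => h w x a c) (z w x) (rev (s w x)))).
  by move=> w x; rewrite foldl_rev.
apply: (comp_foldl (h := fun w x c a => h w x a c)) => //.
apply: (comp_app (f := fun w (t : A * (C * B)) => (t.1, (t.2.2, t.2.1))) ch).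
by comp_tac.
Qed.

End Derived.

Ltac comp_user ::= lazymatch goal with
  | |- computable (fun w x => foldr (@?h w x) (@?z w x) (@?s w x)) =>
      apply (comp_foldr (h := h) (z := z) (s := s)); cbv beta
  | |- computable (fun w x => iter (@?n w x) (@?h w x) (@?z w x)) =>
      apply (comp_iter (n := n) (h := h) (z := z)); cbv beta
  end.

Section Library0.
Context {K : fieldType} {A B C : Type} {eA : encodable K A} {eB : encodable K B} {eC : encodable K C}.
Implicit Types (m n : world K -> A -> nat) (b c : world K -> A -> bool) (f g : world K -> A -> K).

Lemma comp_pred n : computable n -> computable (fun w x => (n w x).-1).
Proof.
move=> cn; apply: (@comp_ext _ _ _ _ _ (fun w x => size (behead (nseq (n w x) tt)))).
  by move=> w x; rewrite size_behead size_nseq.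
by apply: comp_sizeu; comp_tac.
Qed.
Lemma comp_addn m n : computable m -> computable n -> computable (fun w x => (m w x + n w x)%N).
Proof.
move=> cm cn; apply: (@comp_ext _ _ _ _ _ (fun w x => iter (n w x) (fun k => k.+1) (m w x))).
  by move=> w x; rewrite -[LHS]/(iter _ succn _) iter_succn.
by comp_tac.
Qed.
Lemma comp_cat (s t : world K -> A -> seq B) : computable s -> computable t -> computable (fun w x => s w x ++ t w x).
Proof.
move=> cs ct; apply: (@comp_ext _ _ _ _ _ (fun w x => foldr (fun a l => a :: l) (t w x) (s w x))).
  by move=> w x; elim: (s w x) => //= a l ->.
by comp_tac.
Qed.
End Library0.

Ltac comp_user ::= lazymatch goal with
  | |- computable (fun w x => foldr (@?h w x) (@?z w x) (@?s w x)) =>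
      apply (comp_foldr (h := h) (z := z) (s := s)); cbv beta
  | |- computable (fun w x => iter (@?n w x) (@?h w x) (@?z w x)) =>
      apply (comp_iter (n := n) (h := h) (z := z)); cbv beta
  | |- computable (fun w x => predn (@?n w x)) => apply (comp_pred (n := n))
  | |- computable (fun w x => addn (@?m w x) (@?n w x)) => apply (comp_addn (m := m) (n := n))
  | |- computable (fun w x => cat (@?s w x) (@?t w x)) => apply (comp_cat (s := s) (t := t))
  end.

Section Library.
Context {K : fieldType} {A B C : Type} {eA : encodable K A} {eB : encodable K B} {eC : encodable K C}.
Implicit Types (m n : world K -> A -> nat) (b c : world K -> A -> bool) (f g : world K -> A -> K).

Lemma comp_negb b : computable b -> computable (fun w x => ~~ b w x).
Proof. by move=> cb; apply: (@comp_ext _ _ _ _ _ (fun w x => if b w x then false else true)) => //; comp_tac. Qed.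
Lemma comp_andb b c : computable b -> computable c -> computable (fun w x => b w x && c w x).
Proof. by move=> cb cc; apply: (@comp_ext _ _ _ _ _ (fun w x => if b w x then c w x else false)) => //; comp_tac. Qed.
Lemma comp_orb b c : computable b -> computable c -> computable (fun w x => b w x || c w x).
Proof. by move=> cb cc; apply: (@comp_ext _ _ _ _ _ (fun w x => if b w x then true else c w x)) => //; comp_tac. Qed.
Lemma comp_subn m n : computable m -> computable n -> computable (fun w x => (m w x - n w x)%N).
Proof.
move=> cm cn; apply: (@comp_ext _ _ _ _ _ (fun w x => iter (n w x) (fun k => k.-1) (m w x))).
  by move=> w x; rewrite -[LHS]/(iter _ predn _) iter_predn.
by comp_tac.
Qed.
Lemma comp_leq m n : computable m -> computable n -> computable (fun w x => (m w x <= n w x)%N).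
Proof.
move=> cm cn; apply: (@comp_ext _ _ _ _ _ (fun w x => nilp (nseq (m w x - n w x) tt))).
  by move=> w x; rewrite /nilp size_nseq.
by comp_tac; apply: comp_subn.
Qed.
Lemma comp_eqn m n : computable m -> computable n -> computable (fun w x => m w x == n w x).
Proof.
move=> cm cn; apply: (@comp_ext _ _ _ _ _ (fun w x => (m w x <= n w x)%N && (n w x <= m w x)%N)).
  by move=> w x; rewrite -eqn_leq.
by apply: comp_andb; apply: comp_leq.
Qed.

Lemma comp_flatten (s : world K -> A -> seq (seq B)) : computable s -> computable (fun w x => flatten (s w x)).
Proof.
move=> cs; apply: (@comp_ext _ _ _ _ _ (fun w x => foldr (fun a l => a ++ l) [::] (s w x))) => //.
by comp_tac.
Qed.
Lemma comp_map (h : world K -> A -> B -> C) (s : world K -> A -> seq B) :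
  computable (fun w (t : A * B) => h w t.1 t.2) -> computable s -> computable (fun w x => map (h w x) (s w x)).
Proof.
move=> ch cs; apply: (@comp_ext _ _ _ _ _ (fun w x => foldr (fun a l => h w x a :: l) [::] (s w x))).
  by move=> w x; elim: (s w x) => //= a l ->.
comp_tac; apply: (comp_app (f := fun w (t : A * (B * seq C)) => (t.1, t.2.1)) ch); comp_tac.
Qed.
Lemma comp_has (h : world K -> A -> B -> bool) (s : world K -> A -> seq B) :
  computable (fun w (t : A * B) => h w t.1 t.2) -> computable s -> computable (fun w x => has (h w x) (s w x)).
Proof.
move=> ch cs; apply: (@comp_ext _ _ _ _ _ (fun w x => foldr (fun a l => if h w x a then true else l) false (s w x))).
  by move=> w x; elim: (s w x) => //= a l ->.
comp_tac; apply: (comp_app (f := fun w (t : A * (B * bool)) => (t.1, t.2.1)) ch); comp_tac.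
Qed.
Lemma comp_all (h : world K -> A -> B -> bool) (s : world K -> A -> seq B) :
  computable (fun w (t : A * B) => h w t.1 t.2) -> computable s -> computable (fun w x => all (h w x) (s w x)).
Proof.
move=> ch cs; apply: (@comp_ext _ _ _ _ _ (fun w x => foldr (fun a l => if h w x a then l else false) true (s w x))).
  by move=> w x; elim: (s w x) => //= a l ->.
comp_tac; apply: (comp_app (f := fun w (t : A * (B * bool)) => (t.1, t.2.1)) ch); comp_tac.
Qed.
Lemma comp_find (h : world K -> A -> B -> bool) (s : world K -> A -> seq B) :
  computable (fun w (t : A * B) => h w t.1 t.2) -> computable s -> computable (fun w x => find (h w x) (s w x)).
Proof.
move=> ch cs; apply: (@comp_ext _ _ _ _ _ (fun w x => foldr (fun a k => if h w x a then 0%N else k.+1) 0%N (s w x))).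
  by move=> w x; elim: (s w x) => //= a l ->.
comp_tac; apply: (comp_app (f := fun w (t : A * (B * nat)) => (t.1, t.2.1)) ch); comp_tac.
Qed.
Lemma comp_size (s : world K -> A -> seq B) : computable s -> computable (fun w x => size (s w x)).
Proof.
move=> cs; apply: (@comp_ext _ _ _ _ _ (fun w x => foldr (fun a k => k.+1) 0%N (s w x))).
  by move=> w x; elim: (s w x) => //= a l ->.
by comp_tac.
Qed.
Lemma comp_nth (d : world K -> A -> B) (s : world K -> A -> seq B) n :
  computable d -> computable s -> computable n -> computable (fun w x => nth (d w x) (s w x) (n w x)).
Proof.
move=> cd cs cn; apply: (@comp_ext _ _ _ _ _ (fun w x => seq.head (d w x) (iter (n w x) (fun l => behead l) (s w x)))).
  by move=> w x; rewrite -[iter _ _ _]/(iter _ behead _) -drop_behead -nth0 nth_drop addn0.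
by comp_tac.
Qed.
Lemma comp_sumn (s : world K -> A -> seq nat) : computable s -> computable (fun w x => sumn (s w x)).
Proof.
move=> cs; apply: (@comp_ext _ _ _ _ _ (fun w x => foldr (fun a k => (a + k)%N) 0%N (s w x))) => //.
by comp_tac.
Qed.
Lemma comp_zeror : computable (fun w (x : A) => 0 : K).
Proof.
apply: (@comp_ext _ _ _ _ _ (fun w x => 1 + - 1)); first by move=> w x; rewrite subrr.
by comp_tac.
Qed.
Lemma comp_expr f n : computable f -> computable n -> computable (fun w x => f w x ^+ n w x).
Proof.
move=> cf cn; apply: (@comp_ext _ _ _ _ _ (fun w x => iter (n w x) (fun z => f w x * z) 1)).
  by move=> w x; elim: (n w x) => //= k ->; rewrite exprS.
comp_tac; apply: (comp_app (f := fun w (t : A * K) => t.1) cf); comp_tac.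
Qed.
Lemma comp_natr n : computable n -> computable (fun w x => (n w x)%:R : K).
Proof.
move=> cn; apply: (@comp_ext _ _ _ _ _ (fun w x => iter (n w x) (fun z => 1 + z) (0 : K))).
  by move=> w x; elim: (n w x) => //= k ->; rewrite mulrS.
comp_tac; exact: comp_zeror.
Qed.
Lemma comp_iota n : computable n -> computable (fun w x => iota 0 (n w x)).
Proof.
move=> cn; apply: (@comp_ext _ _ _ _ _ (fun w x => iter (n w x) (fun l => l ++ [:: size l]) [::])).
  by move=> w x; elim: (n w x) => // k IH; rewrite iterS IH size_iota -[RHS]/(iota 0 k.+1) -addn1 iotaD.
have csz : computable (fun (w : world K) (t : A * seq nat) => size t.2).
  apply: (@comp_ext _ _ _ _ _ (fun w (t : A * seq nat) => foldr (fun a k => k.+1) 0%N t.2)).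
    by move=> w x; elim: x.2 => //= a l ->.
  by comp_tac.
by comp_tac.
Qed.
End Library.

Ltac comp_user ::= lazymatch goal with
  | |- computable (fun w x => foldr (@?h w x) (@?z w x) (@?s w x)) =>
      apply (comp_foldr (h := h) (z := z) (s := s)); cbv beta
  | |- computable (fun w x => iter (@?n w x) (@?h w x) (@?z w x)) =>
      apply (comp_iter (n := n) (h := h) (z := z)); cbv beta
  | |- computable (fun w x => @GRing.zero _) => apply comp_zeror
  | |- computable (fun w x => predn (@?n w x)) => apply (comp_pred (n := n))
  | |- computable (fun w x => addn (@?m w x) (@?n w x)) => apply (comp_addn (m := m) (n := n))
  | |- computable (fun w x => subn (@?m w x) (@?n w x)) => apply (comp_subn (m := m) (n := n))
  | |- computable (fun w x => leq (@?m w x) (@?n w x)) => apply (comp_leq (m := m) (n := n))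
  | |- computable (fun w x => @eq_op _ (@?m w x) (@?n w x)) =>
      first [apply (comp_eqn (m := m) (n := n)) | apply (comp_eqr (f := m) (g := n))]
  | |- computable (fun w x => negb (@?b w x)) => apply (comp_negb (b := b))
  | |- computable (fun w x => andb (@?b w x) (@?c w x)) => apply (comp_andb (b := b) (c := c))
  | |- computable (fun w x => orb (@?b w x) (@?c w x)) => apply (comp_orb (b := b) (c := c))
  | |- computable (fun w x => cat (@?s w x) (@?t w x)) => apply (comp_cat (s := s) (t := t))
  | |- computable (fun w x => flatten (@?s w x)) => apply (comp_flatten (s := s))
  | |- computable (fun w x => map (@?h w x) (@?s w x)) => apply (comp_map (h := h) (s := s)); cbv beta
  | |- computable (fun w x => has (@?h w x) (@?s w x)) => apply (comp_has (h := h) (s := s)); cbv beta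
  | |- computable (fun w x => all (@?h w x) (@?s w x)) => apply (comp_all (h := h) (s := s)); cbv beta
  | |- computable (fun w x => find (@?h w x) (@?s w x)) => apply (comp_find (h := h) (s := s)); cbv beta
  | |- computable (fun w x => size (@?s w x)) => apply (comp_size (s := s))
  | |- computable (fun w x => nth (@?d w x) (@?s w x) (@?n w x)) => apply (comp_nth (d := d) (s := s) (n := n))
  | |- computable (fun w x => sumn (@?s w x)) => apply (comp_sumn (s := s))
  | |- computable (fun w x => GRing.exp (@?f w x) (@?n w x)) => apply (comp_expr (f := f) (n := n))
  | |- computable (fun w x => GRing.natmul (GRing.one _) (@?n w x)) => apply (comp_natr (n := n))
  | |- computable (fun w x => iota O (@?n w x)) => apply (comp_iota (n := n))
  end.
Ltac comp_with t := cbv beta; repeat (first [assumption | t | comp_step]).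

Section Binomial.
Context {K : fieldType} {A : Type} {eA : encodable K A}.

(** The iterated list contains the cardinals of all subsets of an n-element set. *)
Lemma bin_count n m :
  'C(n, m) = size (flatten [seq if j == m then [:: j] else [::] | j <- iter n (fun s => s ++ [seq j.+1 | j <- s]) [:: 0%N]]).
Proof.
pose cnt (m : nat) (s : seq nat) := size (flatten [seq if j == m then [:: j] else [::] | j <- s]).
rewrite -/(cnt m _); have cE k s : cnt k s = count_mem k s.
  by rewrite /cnt; elim: s => //= j s IH; rewrite size_cat IH; case: eqP.
rewrite cE; elim: n m => [|n IH] [|m]; rewrite ?bin0 //= count_cat count_map -?IH ?bin0.
  by rewrite -[X in _ = (_ + X)%N]/(count (fun j => j.+1 == 0%N) _) (eq_count (a2 := pred0)) // count_pred0.
by rewrite binS; congr (_ + _)%N; rewrite IH; apply: eq_count => j /=; rewrite eqSS.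
Qed.

Lemma comp_bin (n m : world K -> A -> nat) : computable n -> computable m ->
  computable (fun w x => 'C(n w x, m w x)).
Proof.
move=> cn cm; apply: (@comp_ext _ _ _ _ _ (fun w x => size (flatten [seq if j == m w x then [:: j] else [::] |
    j <- iter (n w x) (fun s => s ++ [seq j.+1 | j <- s]) [:: 0%N]]))).
  by move=> w x; rewrite -bin_count.
by comp_tac.
Qed.
End Binomial.

Ltac use_bin := lazymatch goal with
  | |- computable (fun w x => binomial (@?n w x) (@?m w x)) => apply (comp_bin (n := n) (m := m)) end.

(** * The algorithm *)

Section Algorithm.
Variable K : fieldType.

(* Sparse representation, without merging, of polynomials in s_1, ..., s_N;
   missing exponents are 0. *)
Definition spoly : Type := seq (seq nat * K).

Definition mexp N (e e' : seq nat) : seq nat := [seq (nth 0 e i + nth 0 e' i)%N | i <- iota 0 N].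
Definition pscale (c : K) (p : spoly) : spoly := [seq (q.1, c * q.2) | q <- p].
Definition pmul N (p q : spoly) : spoly :=
  flatten [seq [seq (mexp N a.1 b.1, a.2 * b.2) | b <- q] | a <- p].
Definition pexp N (p : spoly) k : spoly := iter k (fun z => pmul N p z) [:: ([::], 1)].
Definition pcoef N (p : spoly) (a : seq nat) : K :=
  foldr (fun q z => if all (fun i => nth 0 q.1 i == nth 0 a i)%N (iota 0 N) then q.2 + z else z) 0 p.

(* A blowing up step (vertical?, n, c, crossing?, k, weight), where n is the
   order before the step and k the contact with the new exceptional curve. *)
Definition step : Type := (bool * nat) * (K * (bool * (nat * K))).
Local Notation vertical st := st.1.1.
Local Notation order st := st.1.2.
Local Notation slope st := st.2.1.
Local Notation crossing st := st.2.2.1.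
Local Notation contact st := st.2.2.2.1.
Local Notation invderiv st := st.2.2.2.2.

Definition table : Type := seq (seq spoly).
Definition tget (T : table) i j : spoly := nth [::] (nth [::] T i) j.

Definition rawc (st : step) (T : table) i j : spoly :=
  if vertical st then
    if (j == 0%N) || ~~ (i <= j.-1 + order st)%N then [::] else tget T i (j.-1 + order st - i)
  else if i == 0%N then [::] else
    flatten [seq pscale ('C(l, j)%:R * slope st ^+ (l - j)) (tget T (i.-1 + order st - l) l)
            | l <- iota 0 (i.-1 + order st).+1].
Definition rawd (st : step) (T : table) i j : spoly :=
  if vertical st then rawc st T j i else rawc st T i j.

Definition newtc N D (st : step) (T : table) (b : spoly) : spoly :=
  b ++ pscale (- invderiv st) (flatten [seq pmul N (pexp N b l)
      (pscale 'C(((contact st).-1 + l)%N, (contact st).-1)%:R (rawd st T 1%N ((contact st).-1 + l)))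
    | l <- iota 0 D]).
(** Modulo the D-th power of the maximal ideal, [D] iterations suffice since each gains one order,
    and [D] terms of each sum suffice since [b] has no constant term. *)
Definition newtonc N D st T : spoly := iter D (fun b => newtc N D st T b) [::].

Definition entd N D (st : step) (T : table) (b : spoly) i j : spoly :=
  flatten [seq pmul N (pexp N b l) (pscale 'C(j + l, j)%:R (rawd st T i (j + l))) | l <- iota 0 D].
Definition ent N D (st : step) (T : table) (b : spoly) i j : spoly :=
  if crossing st then rawc st T i j
  else if vertical st then entd N D st T b j i else entd N D st T b i j.
Definition tstep N D B (st : step) (T : table) : table :=
  [seq [seq ent N D st T (newtonc N D st T) i j | j <- iota 0 B] | i <- iota 0 B].

Definition exps N D : seq (seq nat) :=
  iter N (fun L => flatten [seq [seq x :: e | e <- L] | x <- iota 0 D]) [:: [::]].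
Definition root_table (w : world K) N D B : table :=
  [seq [seq [seq (e, winp w 0 (e ++ [:: i; j])) | e <- exps N D] | j <- iota 0 B] | i <- iota 0 B].
(** A path lists the latest blowing up first, so the right fold replays it from the root. *)
Definition node_table (w : world K) N D B (p : seq step) : table :=
  foldr (fun st T => tstep N D B st T) (root_table w N D B) p.

(** Horner's scheme: the head of the result is the value at [r], and its tail is the quotient by
    [X - r]. *)
Definition horn (r : K) (p : seq K) : seq K := foldr (fun a acc => (a + r * seq.head 0 acc) :: acc) [::] p.
(** Repeated deflation until only a constant is left. Multiple roots are repeated, which duplicates
    vertices of the tree but not the ideal they generate. *)
Definition all_roots (w : world K) (cs : seq K) : seq K :=
  (iter (size cs) (fun s => if has (fun a => ~~ (a == 0)) (behead s.1)
     then (behead (horn (wrt w (Poly s.1)) s.1), wrt w (Poly s.1) :: s.2) else s) (cs, [::])).2.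

Definition tnode : Type := seq step * ((bool * bool) * nat).

Definition mkstep (v : bool) n (c : K) (cr : bool) k wt : step := ((v, n), (c, (cr, (k, wt)))).
(** The contact is at most the order [n], by [axis_mult_le] without exceptional axes. *)
Definition kid_contact N (T : table) n (v : bool) (c : K) : nat :=
  find (fun k => ~~ (pcoef N (rawd (mkstep v n c false 0%N 0) T 1%N k) [::] == 0)) (iota 0 n.+1).
(** The order is at most [k + 1], because the coefficient of [x y^k], or of [x^k y] in the vertical
    chart, is nonzero. *)
Definition kid_order N (T : table) n (v : bool) (c : K) k : nat :=
  find (fun m => has (fun i => ~~ (pcoef N (rawc (mkstep v n c false 0%N 0) T i (m - i)%N) [::] == 0)) (iota 0 m.+1))
    (iota 0 k.+2).
Definition kid_step N (T : table) n (v : bool) (c : K) cr k : step :=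
  mkstep v n c cr k (k%:R * pcoef N (rawd (mkstep v n c false 0%N 0) T 1%N k) [::])^-1.
Definition kid_crossing (e : bool * bool) (v : bool) (c : K) : bool :=
  if v then e.1 else e.2 && (c == 0).
Definition kid_node N (x : tnode) (T : table) (v : bool) (c : K) : tnode :=
  (kid_step N T x.2.2 v c (kid_crossing x.2.1 v c) (kid_contact N T x.2.2 v c) :: x.1,
   (if v then (x.2.1.1, true) else (true, kid_crossing x.2.1 v c),
    kid_order N T x.2.2 v c (kid_contact N T x.2.2 v c))).

Definition fcoef N (T : table) i j : K := pcoef N (tget T i j) [::].
Definition base_test N (T : table) n : bool :=
  (n == 1%N) || ((n == 2%N) && ~~ (fcoef N T 1%N 1%N * fcoef N T 1%N 1%N - 4%:R * fcoef N T 2%N 0%N * fcoef N T 0%N 2%N == 0)).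
Definition kids (w : world K) N (x : tnode) (T : table) : seq tnode :=
  if base_test N T x.2.2 then [::] else
    [seq kid_node N x T false c | c <- all_roots w [seq fcoef N T (x.2.2 - l)%N l | l <- iota 0 x.2.2.+1]] ++
    (if fcoef N T 0%N x.2.2 == 0 then [:: kid_node N x T true 0] else [::]).

(** A blowing up at a point of order [n] reads coefficients up to [n] places further, so this is the
    table size needed at the root to know [b] rows and columns at the end of the path. *)
Definition bound (p : seq step) b : nat := foldr (fun st m => (order st + m)%N) b p.
(** The shape of the tree only needs constant terms, hence precision 1. Finding contacts and orders
    reads indices up to [2 n], and the discriminant indices up to 2; both are below [2 n + 4]. *)
Definition level (w : world K) N n0 t : seq tnode :=
  iter t (fun L => flatten [seq kids w N x (node_table w N 1 (bound x.1 (x.2.2 + x.2.2 + 4)) x.1) | x <- L])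
    [:: ([::], ((false, false), n0))].

(** The order of the special fibre is sought below [t]; the default value [t] means that it was not
    found, and [complete] rejects it. *)
Definition root_order (w : world K) N t : nat :=
  find (fun m => has (fun i => ~~ (winp w 0 (nseq N 0%N ++ [:: i; (m - i)%N]) == 0)) (iota 0 m.+1)) (iota 0 t).
Definition complete (w : world K) N t : bool :=
  (root_order w N t < t)%N && nilp (level w N (root_order w N t) t).

Definition low_pairs n : seq (nat * nat) := flatten [seq [seq (i, j) | j <- iota 0 (n - i)] | i <- iota 0 n].
Definition gens (w : world K) N t : seq (seq step * (nat * nat)) :=
  flatten [seq [seq (x.1, ij) | ij <- low_pairs x.2.2] |
    x <- flatten [seq level w N (root_order w N t) i | i <- iota 0 t]].
(** A coefficient at [a] is unaffected by errors of order above the degree [sumn a]. *)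
Definition gen_coef (w : world K) N (g : seq step * (nat * nat)) (a : seq nat) : K :=
  pcoef N (tget (node_table w N (sumn a).+1 (bound g.1 (g.2.1 + g.2.2).+1) g.1) g.2.1 g.2.2) a.

End Algorithm.

Section Computability.
Context {K : fieldType}.
Local Notation fn A B := (world K -> A -> B).

Lemma comp_nseq0 A (eA : encodable K A) (n : fn A nat) : computable n -> computable (fun w x => nseq (n w x) 0%N).
Proof.
move=> cn; apply: (@comp_ext _ _ _ _ _ (fun w x => iter (n w x) (fun l => 0%N :: l) [::])).
  by move=> w x; elim: (n w x) => //= k ->.
by comp_tac.
Qed.

Lemma comp_pcoef A (eA : encodable K A) (N : fn A nat) (p : fn A (spoly K)) (a : fn A (seq nat)) :
  computable N -> computable p -> computable a -> computable (fun w x => pcoef (N w x) (p w x) (a w x)).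
Proof. by move=> cN cp ca; rewrite /pcoef; comp_tac. Qed.
Ltac use_pcoef := lazymatch goal with
  | |- computable (fun w x => pcoef (@?N w x) (@?p w x) (@?a w x)) => apply (comp_pcoef (N := N) (p := p) (a := a)) end.

Lemma comp_rawc A (eA : encodable K A) (st : fn A (step K)) (T : fn A (table K)) (i j : fn A nat) :
  computable st -> computable T -> computable i -> computable j ->
  computable (fun w x => rawc (st w x) (T w x) (i w x) (j w x)).
Proof. by move=> cst cT ci cj; rewrite /rawc /tget /pscale; comp_with ltac:(idtac; use_bin). Qed.
Ltac use_rawc := lazymatch goal with
  | |- computable (fun w x => rawc (@?s w x) (@?T w x) (@?i w x) (@?j w x)) =>
    apply (comp_rawc (st := s) (T := T) (i := i) (j := j)) end.

Lemma comp_newtonc A (eA : encodable K A) (N D : fn A nat) (st : fn A (step K)) (T : fn A (table K)) :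
  computable N -> computable D -> computable st -> computable T ->
  computable (fun w x => newtonc (N w x) (D w x) (st w x) (T w x)).
Proof.
move=> cN cD cst cT; rewrite /newtonc /newtc /rawd /pexp /pmul /mexp /pscale.
by comp_with ltac:(idtac; first [use_bin|use_rawc]).
Qed.
Ltac use_newtonc := lazymatch goal with
  | |- computable (fun w x => newtonc (@?N w x) (@?D w x) (@?s w x) (@?T w x)) =>
    apply (comp_newtonc (N := N) (D := D) (st := s) (T := T)) end.

Lemma comp_node_table A (eA : encodable K A) (N D B : fn A nat) (p : fn A (seq (step K))) :
  computable N -> computable D -> computable B -> computable p ->
  computable (fun w x => node_table w (N w x) (D w x) (B w x) (p w x)).
Proof.
move=> cN cD cB cp; rewrite /node_table /root_table /exps /tstep /ent /entd /rawd /pexp /pmul /mexp /pscale.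
by comp_with ltac:(idtac; first [use_bin|use_rawc|use_newtonc]).
Qed.
Ltac use_node_table := lazymatch goal with
  | |- computable (fun w x => node_table w (@?N w x) (@?D w x) (@?B w x) (@?p w x)) =>
    apply (comp_node_table (N := N) (D := D) (B := B) (p := p)) end.

Lemma comp_roots A (eA : encodable K A) (cs : fn A (seq K)) : computable cs ->
  computable (fun w x => all_roots w (cs w x)).
Proof. by move=> cc; rewrite /all_roots /horn; comp_tac. Qed.
Ltac use_roots := lazymatch goal with
  | |- computable (fun w x => all_roots w (@?s w x)) => apply (comp_roots (cs := s)) end.

Lemma comp_kid_node A (eA : encodable K A) (N : fn A nat) (y : fn A (tnode K)) (T : fn A (table K))
    (v : fn A bool) (c : fn A K) :
  computable N -> computable y -> computable T -> computable v -> computable c ->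
  computable (fun w x => kid_node (N w x) (y w x) (T w x) (v w x) (c w x)).
Proof.
move=> cN cy cT cv cc; rewrite /kid_node /kid_step /kid_order /kid_contact /kid_crossing /mkstep /rawd.
by comp_with ltac:(idtac; first [use_pcoef|use_rawc]).
Qed.
Ltac use_kid_node := lazymatch goal with
  | |- computable (fun w x => kid_node (@?N w x) (@?y w x) (@?T w x) (@?v w x) (@?c w x)) =>
    apply (comp_kid_node (N := N) (y := y) (T := T) (v := v) (c := c)) end.

Lemma comp_kids A (eA : encodable K A) (N : fn A nat) (y : fn A (tnode K)) (T : fn A (table K)) :
  computable N -> computable y -> computable T ->
  computable (fun w x => kids w (N w x) (y w x) (T w x)).
Proof.
move=> cN cy cT; rewrite /kids /base_test /fcoef /tget.
by comp_with ltac:(idtac; first [use_pcoef|use_roots|use_kid_node]).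
Qed.
Ltac use_kids := lazymatch goal with
  | |- computable (fun w x => kids w (@?N w x) (@?y w x) (@?T w x)) =>
    apply (comp_kids (N := N) (y := y) (T := T)) end.

Lemma comp_level A (eA : encodable K A) (N n0 t : fn A nat) :
  computable N -> computable n0 -> computable t ->
  computable (fun w x => level w (N w x) (n0 w x) (t w x)).
Proof.
move=> cN cn ct; rewrite /level /bound.
by comp_with ltac:(idtac; first [use_kids|use_node_table]).
Qed.
Ltac use_level := lazymatch goal with
  | |- computable (fun w x => level w (@?N w x) (@?n w x) (@?t w x)) =>
    apply (comp_level (N := N) (n0 := n) (t := t)) end.

Lemma comp_root_order A (eA : encodable K A) (N t : fn A nat) :
  computable N -> computable t -> computable (fun w x => root_order w (N w x) (t w x)).
Proof. by move=> cN ct; rewrite /root_order; comp_with ltac:(idtac; apply: comp_nseq0). Qed.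
Ltac use_root_order := lazymatch goal with
  | |- computable (fun w x => root_order w (@?N w x) (@?t w x)) =>
    apply (comp_root_order (N := N) (t := t)) end.

Lemma comp_complete A (eA : encodable K A) (N t : fn A nat) :
  computable N -> computable t -> computable (fun w x => complete w (N w x) (t w x)).
Proof. by move=> cN ct; rewrite /complete; comp_with ltac:(idtac; first [use_level|use_root_order]). Qed.

Lemma comp_gens A (eA : encodable K A) (N t : fn A nat) :
  computable N -> computable t -> computable (fun w x => gens w (N w x) (t w x)).
Proof. by move=> cN ct; rewrite /gens /low_pairs; comp_with ltac:(idtac; first [use_level|use_root_order]). Qed.

Lemma comp_gen_coef A (eA : encodable K A) (N : fn A nat) (g : fn A (seq (step K) * (nat * nat)))
    (a : fn A (seq nat)) : computable N -> computable g -> computable a ->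
  computable (fun w x => gen_coef w (N w x) (g w x) (a w x)).
Proof.
move=> cN cg ca; rewrite /gen_coef /tget /bound.
by comp_with ltac:(idtac; first [use_pcoef|use_node_table]).
Qed.

End Computability.

(** * Correctness of the algorithm *)

Section PolyValues.
Variables (K : fieldType) (N : nat).
Local Notation R := (mpser K N).
Implicit Types (p q : spoly K) (e : seq nat) (a b : R).

Definition mexpo e : 'X_{1..N} := [multinom nth 0%N e i | i < N].
Definition pval p : R := \sum_(q <- p) ser_const N q.2 * mono (mexpo q.1).

Lemma pval_nil : pval [::] = 0. Proof. by rewrite /pval big_nil. Qed.
Lemma pval_cat p q : pval (p ++ q) = pval p + pval q. Proof. by rewrite /pval big_cat. Qed.
Lemma pval_flatten (T : Type) (f : T -> spoly K) (s : seq T) :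
  pval (flatten [seq f x | x <- s]) = \sum_(x <- s) pval (f x).
Proof. by elim: s => [|x s IH]; rewrite ?big_nil ?pval_nil // big_cons /= pval_cat IH. Qed.
Lemma pval_pscale c p : pval (pscale c p) = ser_const N c * pval p.
Proof.
rewrite /pval big_map mulr_sumr; apply: eq_bigr => q _.
by rewrite [_.2]/= rmorphM mulrA.
Qed.

Lemma mono_mexp e e' : mono (mexpo (mexp N e e')) = mono (mexpo e) * mono (mexpo e') :> R.
Proof.
rewrite -monoD; congr mono; apply/mnmP => i; rewrite mnmDE !mnmE.
by rewrite (nth_map 0%N) ?size_iota // nth_iota.
Qed.

Lemma pval_pmul p q : pval (pmul N p q) = pval p * pval q.
Proof.
rewrite pval_flatten {2}/pval mulr_suml; apply: eq_bigr => x _.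
rewrite /pval big_map mulr_sumr; apply: eq_bigr => y _.
by rewrite [_.2]/= [_.1]/= mono_mexp rmorphM; ring.
Qed.

Lemma pval_pexp p k : pval (pexp N p k) = pval p ^+ k.
Proof.
elim: k => [|k IH]; last by rewrite [pexp _ _ _]iterS pval_pmul IH exprS.
rewrite /pval big_seq1 rmorph1 mul1r expr0 -mono0; congr mono.
by apply/mnmP => i; rewrite mnmE mnm0E nth_nil.
Qed.

Lemma mexpoK (a : 'X_{1..N}) : mexpo a = a.
Proof. by apply/mnmP => i; rewrite mnmE (mnm_nth 0%N). Qed.
Lemma mexpo_nil : mexpo [::] = 0%MM.
Proof. by apply/mnmP => i; rewrite mnmE mnm0E nth_nil. Qed.

Lemma mexpo_eq e e' :
  all (fun i => nth 0%N e i == nth 0%N e' i) (iota 0 N) = (mexpo e' == mexpo e).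
Proof.
apply/allP/eqP => [h|/mnmP h i].
  apply/mnmP => i; rewrite !mnmE; apply/esym/eqP/h.
  by rewrite mem_iota add0n ltn_ord.
by rewrite mem_iota add0n => iN; have := h (Ordinal iN); rewrite !mnmE => ->.
Qed.

Lemma pcoefE p e : pcoef N p e = pval p (mexpo e).
Proof.
rewrite /pval ser_sum /pcoef; elim: p => [|q p IH]; first by rewrite big_nil.
rewrite big_cons [LHS]/= mexpo_eq IH serMconst [mono _ _]/=.
by case: eqP; rewrite ?mulr1 ?mulr0 ?add0r.
Qed.

Lemma pcoef0 p : pcoef N p [::] = (pval p) 0%MM.
Proof. by rewrite pcoefE mexpo_nil. Qed.
Lemma pcoef_at p (a : 'X_{1..N}) : pcoef N p a = pval p a.
Proof. by rewrite pcoefE mexpoK. Qed.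

Lemma exps_mem n D e : (e \in exps n D) = (size e == n) && all (fun x => x < D)%N e.
Proof.
elim: n e => [|n IH] e; first by rewrite inE; case: e.
rewrite [exps _ _]iterS -/(exps n D) -/[seq x :: e | x <- iota 0 D, e <- exps n D].
apply/allpairsP/idP => [[[x e'] /= [xD he ->]]|].
  by move: xD he; rewrite mem_iota add0n IH eqSS /= => -> /andP[-> ->].
case: e => [//|x e] /= /andP[se /andP[xD he]]; exists (x, e) => /=; split=> //.
  by rewrite mem_iota.
by rewrite IH he andbT.
Qed.

Lemma exps_uniq n D : uniq (exps n D).
Proof.
elim: n => [//|n IH]; rewrite [exps _ _]iterS -/(exps n D).
apply: allpairs_uniq => //; first exact: iota_uniq.
by move=> [x e] [y e'] _ _ /= [-> ->].
Qed.

Lemma pval_exps D (c : seq nat -> K) (a : 'X_{1..N}) : (mdeg a < D)%N ->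
  pval [seq (e, c e) | e <- exps N D] a = c a.
Proof.
move=> aD; rewrite /pval big_map ser_sum.
have ain : (a : seq nat) \in exps N D.
  rewrite exps_mem size_tuple eqxx; apply/allP => x /(nthP 0%N)[i].
  rewrite size_tuple => iN <-; apply: leq_ltn_trans aD.
  by rewrite -[nth _ _ _]/(nth 0%N a (Ordinal iN)) -mnm_nth mdegE (bigD1 (Ordinal iN)) //= leq_addr.
rewrite (bigD1_seq (a : seq nat)) ?exps_uniq // big_seq_cond big1 ?addr0.
  by rewrite [_.2]/= [_.1]/= serMconst mexpoK [mono _ _]/= eqxx mulr1; apply: addr0.
move=> e /andP[]; rewrite exps_mem => /andP[/eqP se _] ea.
rewrite [_.2]/= [_.1]/= serMconst [mono _ _]/=; case: eqP => [e'|]; last by rewrite mulr0.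
case/eqP: ea; apply: (@eq_from_nth _ 0%N); rewrite ?size_tuple // se => i iN.
have -> : nth 0%N a i = a (Ordinal iN) by rewrite (mnm_nth 0%N).
by rewrite e' mnmE.
Qed.

End PolyValues.

Section Approximation.
Variables (K : closedFieldType) (N : nat) (F : mpser K (N + 2)).
Local Notation R := (mpser K N).
Variables (rt : {poly K} -> K) (gs : seq (mpser K N)).
Let w0 : world K := World rt (series_input F gs).
Variable D : nat.
Implicit Types (G : mpser R 2) (T : table K) (st : step K).
Local Notation "x =~ y" := (ordge D (x - y : R)) (at level 70).

Lemma root_coefE (a : 'X_{1..N}) i j : winp w0 0 (a ++ [:: i; j]) = cf (ser_split F) i j a.
Proof.
have sz : size (a ++ [:: i; j]) == (N + 2)%N by rewrite size_cat size_tuple.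
rewrite /= /coef_at insubT /cf /=; congr (F _); apply/mnmP => k; rewrite !(mnm_nth 0%N) /=.
by [].
Qed.

Lemma approx_refl x : x =~ x.
Proof. by rewrite subrr; apply: ordge0. Qed.
Lemma approxM x y x' y' : x =~ x' -> y =~ y' -> x * y =~ x' * y'.
Proof.
move=> hx hy; have -> : x * y - x' * y' = (x - x') * y + x' * (y - y') by ring.
by apply: ordgeD; [apply: ordgeMr|apply: ordgeMl].
Qed.
Lemma approxX x x' k : x =~ x' -> x ^+ k =~ x' ^+ k.
Proof. by move=> h; elim: k => [|k IH]; [apply: approx_refl|rewrite !exprS; apply: approxM]. Qed.
Lemma approxD x y x' y' : x =~ x' -> y =~ y' -> x + y =~ x' + y'.
Proof. by move=> hx hy; rewrite opprD addrACA; apply: ordgeD. Qed.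
Lemma approx_sum (I : eqType) (s : seq I) (f g : I -> R) : (forall i, i \in s -> f i =~ g i) ->
  \sum_(i <- s) f i =~ \sum_(i <- s) g i.
Proof.
by move=> h; rewrite -sumrB big_seq; apply: ordge_sum.
Qed.

Definition approx b T G : Prop := forall i j, (i < b)%N -> (j < b)%N -> pval N (tget T i j) =~ cf G i j.

Lemma tget_mk B (f : nat -> nat -> spoly K) i j : (i < B)%N -> (j < B)%N ->
  tget [seq [seq f i j | j <- iota 0 B] | i <- iota 0 B] i j = f i j.
Proof.
by move=> iB jB; rewrite /tget !(nth_map 0%N) ?size_iota // !nth_iota.
Qed.

Lemma root_approx B : approx B (root_table w0 N D B) (ser_split F).
Proof.
move=> i j iB jB a aD; rewrite tget_mk // serB.
by rewrite (pval_exps (fun e => winp w0 0 (e ++ [:: i; j])) aD) root_coefE subrr.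
Qed.

Definition sdir st : option K := if st.1.1 then None else Some st.2.1.
Lemma newd_sdir st : newd (sdir st) = st.1.1. Proof. by rewrite /sdir; case: st.1.1. Qed.

Lemma raw_approx st b T G i j : approx b T G ->
  (if st.1.1 then (j.-1 + st.1.2 < b)%N else (i.-1 + st.1.2 < b)%N) ->
  pval N (rawc st T i j) =~ cf (rawT (sdir st) st.1.2 G) i j.
Proof.
move=> hT; rewrite /rawc /sdir; case: (st.1.1) => h.
  rewrite -[rawT _ _ _]/(vertT st.1.2 G).
  case: j h => [|j] h; rewrite [X in pval N X]/=; first by rewrite pval_nil; apply: approx_refl.
  have -> : cf (vertT st.1.2 G) i j.+1 = cf (vertS G) i (j + st.1.2) by [].
  rewrite cf_vertS; case: leqP => ij; last by rewrite pval_nil; apply: approx_refl.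
  by apply: hT; apply: leq_ltn_trans h; rewrite ?leq_subr.
rewrite -[rawT _ _ _]/(slopeT st.1.2 (ser_const N st.2.1) G).
case: i h => [|i] h.
  by rewrite [X in pval N X]/= pval_nil; apply: approx_refl.
have -> : cf (slopeT st.1.2 (ser_const N st.2.1) G) i.+1 j =
  cf (slopeS (ser_const N st.2.1) G) (i + st.1.2) j by [].
rewrite cf_slopeS -(big_mkord predT
  (fun l => 'C(l, j)%:R * ser_const N st.2.1 ^+ (l - j) * cf G (i + st.1.2 - l) l)) /index_iota subn0.
rewrite -[X in pval N X]/(flatten [seq pscale ('C(l, j)%:R * st.2.1 ^+ (l - j)) (tget T (i + st.1.2 - l) l)
  | l <- iota 0 (i + st.1.2).+1]).
rewrite pval_flatten; apply: approx_sum => l; rewrite mem_iota add0n ltnS => /andP[_ hl].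
rewrite pval_pscale rmorphM rmorph_nat rmorphXn; apply: approxM; first exact: approx_refl.
by apply: hT; apply: leq_ltn_trans h => //; rewrite leq_subr.
Qed.

Lemma rawd_approx st b T G i j : approx b T G -> (i.-1 + st.1.2 < b)%N ->
  pval N (rawd st T i j) =~ cfd st.1.1 (rawT (sdir st) st.1.2 G) i j.
Proof.
move=> hT h; rewrite /rawd /cfd; case: ifP => v; apply: (raw_approx hT); by rewrite v.
Qed.

Lemma asum_approx b b' (g : nat -> R) (h : nat -> R) : ordge 1 b' -> b =~ b' ->
  (forall l, h l =~ g l) -> \sum_(l <- iota 0 D) b ^+ l * h l =~ asum b' g.
Proof.
move=> b1 bb hg; apply: (@ordge_trans _ _ D (\sum_(l <- iota 0 D) b' ^+ l * g l)).
  by apply: approx_sum => l _; apply: approxM; [apply: approxX|].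
apply: ordge_sym; have := @asumE _ _ b' g D b1.
by rewrite -(big_mkord predT (fun l => b' ^+ l * g l)) /index_iota subn0.
Qed.

Lemma pval_asum (b : spoly K) (c : nat -> nat) (r : nat -> spoly K) :
  pval N (flatten [seq pmul N (pexp N b l) (pscale (c l)%:R (r l)) | l <- iota 0 D]) =
  \sum_(l <- iota 0 D) pval N b ^+ l * ((c l)%:R * pval N (r l)).
Proof.
rewrite pval_flatten; apply: eq_bigr => l _.
by rewrite pval_pmul pval_pexp pval_pscale rmorph_nat.
Qed.

(** Two errors are controlled modulo the D-th power of the maximal ideal: stopping the iteration
    after [D] steps, and replacing coefficients and infinite sums by approximations within each
    step. *)
Lemma newton_approx st b T G (d := st.1.1) (H := rawT (sdir st) st.1.2 G) (k := st.2.2.2.1) (wt := st.2.2.2.2) :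
  approx b T G -> (st.1.2 < b)%N ->
  (0 < k)%N -> (cfd d H 1 k.-1) 0%MM = 0 -> wt * (k%:R * (cfd d H 1 k) 0%MM) = 1 ->
  pval N (newtonc N D st T) =~ newton d H k wt.
Proof.
move=> hT nb k0 Hk hw; apply: (@ordge_trans _ _ D (iter D (newton_step d H k wt) 0)); last first.
  by apply: ordge_sym; apply: newton_iter.
rewrite /newtonc; suff : ordge 1 (iter D (newton_step d H k wt) 0) /\
  pval N (iter D (fun b => newtc N D st T b) [::]) =~ iter D (newton_step d H k wt) 0 by case.
elim: {1 3 5}D => [|m [IH1 IH2]]; first by split; [apply: ordge0|rewrite pval_nil; apply: approx_refl].
rewrite !iterS; split; first exact: newton_step_max.
rewrite /newtc pval_cat pval_pscale rmorphN mulNr /newton_step; apply: approxD => //.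
rewrite -opprD; apply: ordgeN; apply: approxM; first exact: approx_refl.
rewrite (pval_asum _ (fun l => 'C(k.-1 + l, k.-1)) (fun l => rawd st T 1 (k.-1 + l))).
apply: asum_approx => // l; apply: approxM; first exact: approx_refl.
exact: (rawd_approx _ hT).
Qed.

Definition stepS st G : mpser R 2 :=
  let H := rawT (sdir st) st.1.2 G in
  if st.2.2.1 then H else PhiT st.1.1 (newton st.1.1 H st.2.2.2.1 st.2.2.2.2) H.

Definition step_ok st G : Prop :=
  let H := rawT (sdir st) st.1.2 G in let k := st.2.2.2.1 in
  ~~ st.2.2.1 -> [/\ (0 < k)%N, (cfd st.1.1 H 1 k.-1) 0%MM = 0 &
    st.2.2.2.2 * (k%:R * (cfd st.1.1 H 1 k) 0%MM) = 1].

Lemma step_approx st B b T G : step_ok st G -> approx (st.1.2 + b) T G -> (b <= B)%N ->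
  approx b (tstep N D B st T) (stepS st G).
Proof.
move=> ok hT bB i j ib jb.
rewrite tget_mk ?(leq_trans _ bB) //; rewrite /ent /stepS; set H := rawT _ _ _.
have bnd x : (x < b)%N -> (x.-1 + st.1.2 < st.1.2 + b)%N by lia.
case cr: st.2.2.1.
  by apply: (raw_approx hT); case: ifP => _; apply: bnd.
have b0 : (0 < b)%N by lia.
have [k0 Hk hw] := ok (negbT cr).
have nb : (st.1.2 < st.1.2 + b)%N by lia.
have hn := newton_approx hT nb k0 Hk hw; have n1 := newton_max k0 Hk hw.
rewrite -/H in hn n1; set nt := newton _ _ _ _ in hn n1 *; set nc := newtonc _ _ _ _ in hn *.
have key x y : (x < b)%N -> pval N (entd N D st T nc x y) =~
    asum nt (fun l => 'C(y + l, y)%:R * cfd st.1.1 H x (y + l)).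
  move=> xb; rewrite /entd (pval_asum _ (fun l => 'C(y + l, y)) (fun l => rawd st T x (y + l))).
  apply: asum_approx => // l; apply: approxM; first exact: approx_refl.
  by apply: (rawd_approx _ hT); apply: bnd.
rewrite /cfd in key; rewrite /PhiT; case v: st.1.1 key => key; last exact: (key i j ib).
exact: (key j i jb).
Qed.

End Approximation.

(** * Roots of a polynomial by deflation *)

Section Roots.
Variable K : closedFieldType.
Implicit Types (s : seq K) (r c : K).

Lemma find_iota (P : pred nat) n k : (k < n)%N -> P k -> (forall j, (j < k)%N -> ~~ P j) ->
  find P (iota 0 n) = k.
Proof.
move=> kn Pk Pj; have hs : has P (iota 0 n) by apply/hasP; exists k; rewrite ?mem_iota.
have fn : (find P (iota 0 n) < n)%N by rewrite -[X in (_ < X)%N](size_iota 0 n) -has_find.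
case: (ltngtP (find P (iota 0 n)) k) => // lt.
  by have := Pj _ lt; have := nth_find 0%N hs; rewrite nth_iota // add0n => ->.
by have := before_find 0%N lt; rewrite nth_iota // add0n Pk.
Qed.

Lemma Poly_eq0 s : ~~ has (fun a => ~~ (a == 0)) s -> Poly s = 0.
Proof.
move=> h; apply/polyP => i; rewrite coef_Poly coef0.
case: (ltnP i (size s)) => [lt|ge]; last by rewrite nth_default.
move: h; rewrite has_predC negbK => /allP /(_ _ (mem_nth 0 lt)) /eqP.
exact.
Qed.

Lemma Poly_cons c s : Poly (c :: s) = Poly s * 'X + c%:P.
Proof. by rewrite [Poly _]/= cons_poly_def. Qed.

Lemma Poly_behead s : Poly s = Poly (behead s) * 'X + (seq.head 0 s)%:P.
Proof. by case: s => [|a s]; [rewrite mul0r add0r|exact: Poly_cons]. Qed.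

Lemma size_horn r s : size (horn r s) = size s.
Proof. by elim: s => //= a s ->. Qed.

Lemma hornE r s : Poly s = Poly (behead (horn r s)) * ('X - r%:P) + (seq.head 0 (horn r s))%:P.
Proof.
elim: s => [|a s IH]; first by rewrite mul0r add0r.
rewrite Poly_cons [behead _]/= [seq.head _ _]/= (Poly_behead (horn r s)) {1}IH polyCD polyCM.
by ring.
Qed.

Variables (rt : {poly K} -> K) (inp : nat -> seq nat -> K).
Hypothesis hrt : root_finder rt.

Lemma rootsP cs c : Poly cs != 0 -> (c \in all_roots (World rt inp) cs) = root (Poly cs) c.
Proof.
move=> cs0; rewrite /all_roots; set st := fun s : seq K * seq K => if _ then _ else _.
pose test s := has (fun a : K => ~~ (a == 0)) (behead s).
(* Loop invariant: the current polynomial times the linear factors found so far is the input, and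
   while it is nonconstant every step has shortened the list by one. After [size cs] steps it must
   therefore be constant. *)
have inv m : Poly cs = Poly (iter m st (cs, [::])).1 * \prod_(r <- (iter m st (cs, [::])).2) ('X - r%:P) /\
    (test (iter m st (cs, [::])).1 -> (size (iter m st (cs, [::])).1 + m)%N = size cs).
  elim: m => [|m [IH1 IH2]]; first by rewrite /= big_nil mulr1 addn0.
  rewrite iterS; move: (iter m st _) IH1 IH2 => [s l] IH1 IH2; rewrite [(s, l).1]/= [(s, l).2]/= in IH1 IH2.
  rewrite /st [(s, l).1]/= [(s, l).2]/= -/(test s); case: ifP => ts; last by split; [exact: IH1|rewrite [(s, l).1]/= ts].
  set r := (X in horn X s).
  have rr : root (Poly s) r.
    apply: hrt; apply/negP => /eqP sz; move/hasP: ts => [a /(nthP 0)[i _ <-]] /negP; apply.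
    have := nth_default 0 (_ : (size (Poly s) <= i.+1)%N); rewrite sz => /(_ (ltn0Sn i)).
    by rewrite coef_Poly nth_behead => ->.
  have hd : (seq.head 0 (horn r s))%:P = 0 :> {poly K}.
    have := congr1 (fun p => p.[r]) (hornE r s).
    rewrite (eqP rr) hornerD hornerM !hornerE subrr mulr0 add0r => <-; exact: polyC0.
  split.
    by rewrite big_cons {1}IH1 {1}(hornE r s) hd addr0 mulrA.
  move=> _; rewrite size_behead size_horn -(IH2 ts) addnS.
  by case: (s) ts.
have [h1 h2] := inv (size cs); move: (iter _ st _) h1 h2 => [s l]; rewrite [(s, l).1]/= [(s, l).2]/= => h1 h2.
have ts : ~~ test s.
  apply/negP => ts; have := h2 ts; rewrite -[RHS]add0n => /eqP; rewrite eqn_add2r size_eq0 => /eqP s0.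
  by rewrite s0 in ts.
have sE : Poly s = (seq.head 0 s)%:P by rewrite Poly_behead (Poly_eq0 ts) mul0r add0r.
rewrite h1 rootM root_prod_XsubC sE rootC; case: eqP => // hd.
by rewrite h1 sE hd polyC0 mul0r eqxx in cs0.
Qed.

End Roots.

(** * Exploration of the tree by exact arithmetic *)

Section TreeCorrect.
Variables (K : closedFieldType) (N : nat) (F : mpser K (N + 2)).
Local Notation R := (mpser K N).
Local Notation F0 := (ser_split F).
Local Notation f := (ser_special F).
Hypotheses (f_neq0 : f != 0) (f_sing : ideal2 (serX K) (serY K) f) (f_sqfree : square_free f).
Hypothesis f_char : [pchar K] =i pred0 \/ exists2 p, p \in [pchar K] & (ord f < p)%N.
Variables (rt : {poly K} -> K) (gs : seq (mpser K N)).
Hypothesis hrt : root_finder rt.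
Let w0 : world K := World rt (series_input F gs).
Implicit Types (p : seq (step K)) (e : bool * bool) (st : step K) (x y : tnode K) (T : table K).

Definition pathF p : mpser R 2 := foldr (fun st G => stepS st G) F0 p.
Local Notation pathf p := (sp (pathF p)).

(** The data stored in a step are those prescribed by the special fibre, so replaying the step on
    series is the blowing up [stepT]. *)
Record valid_step p e st k : Prop := ValidStep {
  vs_nb : ~~ isbase (pathf p);
  vs_td : tangent (sdir st) (pathf p);
  vs_k : axis_mult st.1.1 (rawTK (sdir st) (ord (pathf p)) (pathf p)) k;
  vs_n : st.1.2 = ord (pathf p);
  vs_cr : st.2.2.1 = (flags (sdir st) e).1 && (flags (sdir st) e).2;
  vs_wt : st.2.2.2 = (k, weight st.1.1 k (rawTK (sdir st) (ord (pathf p)) (pathf p))) }.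

Inductive valid : seq (step K) -> bool * bool -> Prop :=
| ValidNil : valid [::] (false, false)
| ValidCons p e st k of valid p e & valid_step p e st k : valid (st :: p) (flags (sdir st) e).

Lemma pathF_cons p e st k : valid_step p e st k ->
  pathF (st :: p) = stepT (sdir st) (ord (pathf p)) k
    (weight st.1.1 k (rawTK (sdir st) (ord (pathf p)) (pathf p))) e (pathF p).
Proof.
case=> _ _ _ hn hcr hw; rewrite -[LHS]/(stepS st (pathF p)) /stepS /stepT.
by rewrite hn hcr hw newd_sdir.
Qed.

Lemma valid_kid p e st k : valid_step p e st k ->
  kid e (pathF p) (flags (sdir st) e) (pathF (st :: p)).
Proof.
move=> h; rewrite (pathF_cons h); case: h => nb td hk _ _ _.
by rewrite -{1}newd_sdir; apply: Kid; rewrite ?newd_sdir.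
Qed.

Lemma valid_reach p e : valid p e -> reach (false, false) F0 e (pathF p).
Proof.
elim=> {p e}; first exact: ReachRefl.
by move=> p e st k _ IH hk; apply: ReachStep IH (valid_kid hk).
Qed.

Lemma valid_inv p e : valid p e -> node_inv (ord f) e (pathF p).
Proof. by move=> h; apply: reach_inv (valid_reach h). Qed.

Lemma valid_step_ok p e st k : valid p e -> valid_step p e st k -> step_ok st (pathF p).
Proof.
move=> hv [nb td hk hn hcr hw]; rewrite /step_ok hcr hw hn => nc.
have hk' := hk; rewrite -{1}newd_sdir in hk'.
have := kid_newton (small_natr_neq0 f_char) (valid_inv hv) td nc hk'.
by rewrite !newd_sdir.
Qed.

Lemma sp_pathF_cons p e st k : valid p e -> valid_step p e st k ->
  pathf (st :: p) = rawTK (sdir st) (ord (pathf p)) (pathf p).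
Proof.
move=> hv h; have ok := valid_step_ok hv h; case: h => nb td hk hn hcr hw.
rewrite -[pathF _]/(stepS st (pathF p)) /stepS hn; case: ifPn => cr; first exact: sp_rawT.
have [k0 Gk hw'] := ok cr; rewrite sp_PhiT ?sp_rawT // -hn; exact: newton_max.
Qed.

Lemma bound_add p n b : bound p (n + b) = (n + bound p b)%N.
Proof. by elim: p => //= st p ->; rewrite addnCA. Qed.

Lemma valid_approx p e : valid p e -> forall D B b, (bound p b <= B)%N ->
  approx D b (node_table w0 N D B p) (pathF p).
Proof.
elim=> {p e} [|p e st k hv IH hs] D B b.
  move=> bB i j ib jb; apply: root_approx; exact: leq_trans bB.
rewrite -[bound _ _]/(st.1.2 + bound p b)%N -bound_add => bB.
apply: (step_approx (valid_step_ok hv hs)); first exact: IH.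
apply: leq_trans bB; rewrite bound_add; apply: leq_trans (leq_addl _ _).
by elim: (p) => //= a l ab; apply: leq_trans ab (leq_addl _ _).
Qed.

Definition good x : Prop := valid x.1 x.2.1 /\ x.2.2 = ord (pathf x.1).

Section Kids.
Variables (p : seq (step K)) (e : bool * bool) (T : table K).
Local Notation g := (pathf p).
Local Notation n := (ord g).
Local Notation dir v c := (if v then None else Some c).
Hypotheses (hv : valid p e) (hT : approx 1 (n + n + 4) T (pathF p)).
Let hi := valid_inv hv.

Lemma fcoefE i j : (i < n + n + 4)%N -> (j < n + n + 4)%N -> fcoef N T i j = cf g i j.
Proof.
move=> hij hji; rewrite /fcoef pcoef0 cf_sp; apply/eqP; rewrite -subr_eq0; apply/eqP.
by have := hT hij hji (m := 0%MM); rewrite serB mdeg0; apply.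
Qed.

Lemma rcoefE (v : bool) c cr k wt i j : (if v then (j.-1 + n < n + n + 4)%N else (i.-1 + n < n + n + 4)%N) ->
  pcoef N (rawc (mkstep v n c cr k wt) T i j) [::] = cf (rawTK (dir v c) n g) i j.
Proof.
move=> h; have := raw_approx (st := mkstep v n c cr k wt) (i := i) (j := j) hT h.
move/(_ 0%MM); rewrite mdeg0 serB => /(_ isT)/eqP; rewrite subr_eq0 => /eqP e0.
by rewrite pcoef0 e0 -sp_rawT cf_sp /sdir; case: (v).
Qed.

Lemma rcoefdE (v : bool) c cr k wt i j : (i.-1 + n < n + n + 4)%N ->
  pcoef N (rawd (mkstep v n c cr k wt) T i j) [::] = cfd v (rawTK (dir v c) n g) i j.
Proof.
by move=> h; rewrite /rawd /cfd [(mkstep _ _ _ _ _ _).1.1]/=; case: v h => h; rewrite rcoefE.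
Qed.

Lemma base_testE : base_test N T n = isbase g.
Proof.
rewrite /base_test !fcoefE; try lia.
by rewrite /isbase /disc expr2.
Qed.

Lemma kid_node_ok (v : bool) c : ~~ isbase g -> tangent (dir v c) g ->
  exists st k, [/\ kid_node N (p, (e, n)) T v c = (st :: p, (flags (sdir st) e, ord (pathf (st :: p)))),
    sdir st = dir v c & valid_step p e st k].
Proof.
move=> nb td; have [k hk k0] := axis_mult_new (inv_neq0 hi) td.
have kn : (k <= n)%N.
  have h1 : (false, false).1 -> forall j, cf g 0 j = 0 by move=> h; case: (notF h).
  have h2 : (false, false).2 -> forall i, cf g i 0 = 0 by move=> h; case: (notF h).
  have := axis_mult_le (inv_neq0 hi) td h1 h2 hk.
  by have -> : (flags (dir v c) (false, false)).1 && (flags (dir v c) (false, false)).2 = false;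
    [case: (v)|rewrite !addn0].
have nv : newd (dir v c) = v by case: (v).
rewrite nv in hk.
have kE : kid_contact N T n v c = k.
  apply: find_iota; first by rewrite ltnS.
    by rewrite rcoefdE ?(proj1 hk) //; lia.
  by move=> j jk; rewrite rcoefdE ?negbK ?(proj2 hk) ?eqxx //; lia.
have crE : kid_crossing e v c = (flags (dir v c) e).1 && (flags (dir v c) e).2.
  by rewrite /kid_crossing; case: (v); rewrite /= ?andbT.
exists (kid_step N T n v c (kid_crossing e v c) k), k.
have sd : sdir (kid_step N T n v c (kid_crossing e v c) k) = dir v c by rewrite /sdir; case: (v).
have hs : valid_step p e (kid_step N T n v c (kid_crossing e v c) k) k.
  split; rewrite ?sd //.
  by rewrite /kid_step rcoefdE //; lia.
split=> //; rewrite /kid_node [_.2.2]/= [_.2.1]/= [_.1]/= kE sd; congr (_, _); congr (_, _).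
  by rewrite crE; case: (v).
rewrite (sp_pathF_cons hv hs) sd; set h := rawTK _ _ _ in hk *.
have [h0 ho] := axis_mult_ord hk.
have cE m i : (m <= k.+1)%N -> (i <= m)%N ->
    pcoef N (rawc (mkstep v n c false 0%N 0) T i (m - i)%N) [::] = cf h i (m - i)%N.
  by move=> mk im; rewrite rcoefE //; case: ifP => _; lia.
apply: find_iota; first by rewrite ltnS.
  have /is_ordE[_ [i io hio]] := ordP h0; apply/hasP; exists i; first by rewrite mem_iota.
  by rewrite cE.
move=> j jo; apply/hasPn => i; rewrite mem_iota add0n => /= ij.
by rewrite cE // ?negbK ?ord_low // ?subnKC //; apply: ltnW (leq_trans jo ho).
Qed.

Lemma coneP : Poly [seq fcoef N T (n - l) l | l <- iota 0 n.+1] = cone g.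
Proof.
apply/polyP => l; rewrite coef_Poly coef_poly; case: ltnP => ln; last first.
  by rewrite nth_default // size_map size_iota.
by rewrite (nth_map 0%N) ?size_iota // nth_iota // add0n fcoefE //; lia.
Qed.

Lemma kids_nil : isbase g -> kids w0 N (p, (e, n)) T = [::].
Proof. by move=> hb; rewrite /kids [_.2.2]/= base_testE hb. Qed.

Lemma kidsP y : ~~ isbase g -> y \in kids w0 N (p, (e, n)) T <->
  exists v c, tangent (dir v c) g /\ (v -> c = 0) /\ y = kid_node N (p, (e, n)) T v c.
Proof.
move=> nb; rewrite /kids [_.2.2]/= base_testE (negbTE nb) mem_cat fcoefE; try lia.
have rE c : (c \in all_roots w0 [seq fcoef N T (n - l) l | l <- iota 0 n.+1]) = root (cone g) c.
  by rewrite rootsP // coneP // cone_neq0 // (inv_neq0 hi).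
split.
  case/orP => [/mapP[c]|]; first by rewrite rE => hc ->; exists false, c.
  by case: ifP => // h; rewrite inE => /eqP ->; exists true, 0.
move=> [[] [c [td [c0 ->]]]].
  by rewrite c0 // -[cf g 0 n == 0]/(tangent None g) td mem_seq1 eqxx orbT.
by rewrite map_f ?rE.
Qed.

End Kids.

Definition kidsw x : seq (tnode K) := kids w0 N x (node_table w0 N 1 (bound x.1 (x.2.2 + x.2.2 + 4)) x.1).

Lemma kidsw_good x y : good x -> y \in kidsw x -> good y /\ kid x.2.1 (pathF x.1) y.2.1 (pathF y.1).
Proof.
case: x => p [e n] [/= hv ->]; have hT := valid_approx hv (D := 1) (leqnn (bound p (ord (pathf p) + ord (pathf p) + 4))).
rewrite /kidsw [(_, _).1]/= [(_, _).2]/=.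
have [hb|nb] := boolP (isbase (pathf p)); first by rewrite (kids_nil _ hT).
move/(kidsP hv hT _ nb) => [v [c [td [_ ->]]]].
have [st [k [-> sd hs]]] := kid_node_ok hv hT nb td.
split; first by split=> //=; apply: ValidCons hv hs.
exact: valid_kid hs.
Qed.

Lemma kidsw_complete x e' F' : good x -> kid x.2.1 (pathF x.1) e' F' ->
  exists y, [/\ y \in kidsw x, y.2.1 = e' & pathF y.1 = F'].
Proof.
case: x => p [e n] [/= hv ->]; have hT := valid_approx hv (D := 1) (leqnn (bound p (ord (pathf p) + ord (pathf p) + 4))).
rewrite /kidsw [(_, _).1]/= [(_, _).2]/= => -[d k nb td hk].
have [v [c [dE c0]]] : exists v c, d = (if v then None else Some c) /\ (v -> c = 0).
  by case: (d) => [c|]; [exists false, c|exists true, 0].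
rewrite dE in td hk *; have [st [k' [yE sd hs]]] := kid_node_ok hv hT nb td.
have kk : k' = k.
  by apply: axis_mult_uniq hk; have := vs_k hs; rewrite -{1}newd_sdir sd.
exists (st :: p, (flags (sdir st) e, ord (pathf (st :: p)))); split.
- by apply/(kidsP hv hT _ nb); exists v, c; rewrite yE.
- by rewrite -sd.
by rewrite [(_, _).1]/= (pathF_cons hs) kk -newd_sdir sd.
Qed.

Definition grow (L : seq (tnode K)) : seq (tnode K) := flatten [seq kidsw x | x <- L].
Definition root_node n : tnode K := ([::], ((false, false), n)).

Lemma levelE n t : level w0 N n t = iter t grow [:: root_node n]. Proof. by []. Qed.

Lemma grow_cat t L1 L2 : iter t grow (L1 ++ L2) = iter t grow L1 ++ iter t grow L2.
Proof. by elim: t => // t IH; rewrite !iterS IH /grow map_cat flatten_cat. Qed.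
Lemma grow_nil t : iter t grow [::] = [::].
Proof. by elim: t => // t IH; rewrite iterS IH. Qed.

Lemma grow_stop d d' L : (d <= d')%N -> iter d grow L = [::] -> iter d' grow L = [::].
Proof. by move=> /subnK <- h; rewrite iterD h grow_nil. Qed.

Lemma grow_stops L : (forall y, y \in L -> exists d, iter d grow [:: y] = [::]) ->
  exists d, iter d grow L = [::].
Proof.
elim: L => [|y L IH] h; first by exists 0%N.
have [d hd] := h y (mem_head y L); have [|d' hd'] := IH; first by move=> z zL; apply: h; rewrite inE zL orbT.
exists (maxn d d'); rewrite -cat1s grow_cat.
by rewrite (grow_stop (leq_maxl d d') hd) (grow_stop (leq_maxr d d') hd').
Qed.

(** A finitely branching well-founded tree has only finitely many nonempty levels; here the depths
    of the finitely many kids have a maximum. *)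
Lemma grow_Acc z : Acc (@kid_rel K N) z -> forall x, good x -> (x.2.1, pathF x.1) = z ->
  exists d, iter d grow [:: x] = [::].
Proof.
elim=> {}z _ IH x gx xz; have [|d hd] := @grow_stops (kidsw x).
  move=> y /(kidsw_good gx)[gy hk]; apply: (IH (y.2.1, pathF y.1)) => //.
  by rewrite /kid_rel -xz.
by exists d.+1; rewrite iterSr /grow /= cats0.
Qed.

Let n0 := ord f.
Let tree t := iter t grow [:: root_node n0].

Lemma good_root : good (root_node n0).
Proof. by split; first exact: ValidNil. Qed.

Lemma tree_good t x : x \in tree t -> good x.
Proof.
elim: t x => [|t IH] x; first by rewrite inE => /eqP ->; apply: good_root.
by rewrite /tree iterS => /flatten_mapP[y /IH gy /(kidsw_good gy)[]].
Qed.

Lemma tree_reach e' F' : reach (false, false) F0 e' F' ->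
  exists t x, [/\ x \in tree t, x.2.1 = e' & pathF x.1 = F'].
Proof.
elim=> {e' F'}; first by exists 0%N, (root_node n0); rewrite inE eqxx.
move=> e1 F1 e2 F2 _ [t [x [xt xe xF]]] hk; rewrite -xe -xF in hk.
have [y [yk ye yF]] := kidsw_complete (tree_good xt) hk.
by exists t.+1, y; split=> //; apply/flatten_mapP; exists x.
Qed.

Lemma tree_finite : exists t, tree t = [::].
Proof. exact: grow_Acc (Acc_root_node f_neq0 f_sing f_sqfree f_char) _ good_root (erefl _). Qed.

Lemma root_orderE t : (n0 < t)%N && (root_order w0 N t == n0) || (t <= n0)%N && (root_order w0 N t == t).
Proof.
have cE i j : winp w0 0 (nseq N 0%N ++ [:: i; j]) = cf f i j.
  rewrite -[cf f i j]/(cf F0 i j 0%MM) -(root_coefE F rt gs); congr (winp _ _ (_ ++ _)).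
  apply: (@eq_from_nth _ 0%N) => [|k]; rewrite size_nseq ?size_tuple // => kN.
  by rewrite nth_nseq kN -[k]/(nat_of_ord (Ordinal kN)) -mnm_nth mnm0E.
have hz m : (m < n0)%N -> ~~ has (fun i => ~~ (winp w0 0 (nseq N 0%N ++ [:: i; (m - i)%N]) == 0)) (iota 0 m.+1).
  move=> mn; apply/hasPn => i; rewrite mem_iota add0n => /andP[_ im].
  by rewrite cE negbK ord_low ?subnKC.
case: ltnP => h /=; last first.
  apply/eqP; rewrite /root_order -[RHS](size_iota 0); apply: hasNfind; apply/hasPn => m.
  by rewrite mem_iota => /= mt; apply: hz; apply: leq_trans h.
rewrite orbF; apply/eqP; apply: find_iota => //.
have /is_ordE[_ [i io fi]] := ordP f_neq0; apply/hasP; exists i; first by rewrite mem_iota.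
by rewrite cE.
Qed.

Lemma completeE t : complete w0 N t -> (n0 < t)%N /\ tree t = [::].
Proof.
rewrite /complete; have := root_orderE t; case: ltnP => [nt|_] /=.
  by rewrite orbF => /eqP ->; rewrite nt levelE => /nilP.
by move/eqP ->; rewrite ltnn.
Qed.

Lemma complete_exists : exists t, complete w0 N t.
Proof.
have [t ht] := tree_finite; exists (maxn n0.+1 t).
have := root_orderE (maxn n0.+1 t); rewrite leq_maxl /= [(_ <= n0)%N]leqNgt leq_maxl orbF => /eqP.
rewrite /complete => ->; rewrite leq_maxl levelE -/(tree _).
by rewrite /tree (grow_stop (leq_maxr n0.+1 t) ht).
Qed.

Lemma low_pairsP n ij : (ij \in low_pairs n) = (ij.1 + ij.2 < n)%N.
Proof.
case: ij => i j; apply/flatten_mapP/idP => [[k]|/= ij].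
  by rewrite mem_iota => /= kn /mapP[l]; rewrite mem_iota => /= ln [-> ->]; lia.
exists i; first by rewrite mem_iota; lia.
by apply/mapP; exists j => //; rewrite mem_iota; lia.
Qed.

Definition gen_series t : seq R := [seq cf (pathF g.1) g.2.1 g.2.2 | g <- gens w0 N t].

Lemma gensP t g : complete w0 N t ->
  g \in gens w0 N t <-> exists i x, [/\ x \in tree i, g.1 = x.1 & (g.2.1 + g.2.2 < x.2.2)%N].
Proof.
move=> ct; have [nt tt] := completeE ct.
have -> : gens w0 N t = flatten [seq [seq (x.1, ij) | ij <- low_pairs x.2.2] |
    x <- flatten [seq tree i | i <- iota 0 t]].
  have := root_orderE t; rewrite nt leqNgt nt /= orbF => /eqP e.
  by rewrite /gens e.
split.
  move=> /flatten_mapP[x /flatten_mapP[i _ xi] /mapP[ij]].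
  by rewrite low_pairsP => h ->; exists i, x.
move=> [i [x [xi gx h]]]; apply/flatten_mapP; exists x.
  apply/flatten_mapP; exists i => //; rewrite mem_iota add0n /=.
  by rewrite ltnNge; apply/negP => ti; rewrite /tree (grow_stop ti tt) in xi.
by apply/mapP; exists g.2; [rewrite low_pairsP|rewrite -gx; case: (g)].
Qed.

Lemma gen_seriesP t r : complete w0 N t -> r \in gen_series t <-> low_coef F r.
Proof.
move=> ct; split.
  move=> /mapP[g /(gensP _ ct)[i [x [xi gx h]]] ->]; have [hv xn] := tree_good xi.
  by exists x.2.1, (pathF x.1), g.2.1, g.2.2; rewrite -xn gx; split=> //; apply: valid_reach.
move=> [e' [F' [i [j [hr ij ->]]]]]; have [t' [x [xt xe xF]]] := tree_reach hr.
apply/mapP; exists (x.1, (i, j)); last by rewrite xF.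
by apply/(gensP _ ct); exists t', x; split=> //=; rewrite (tree_good xt).2 xF.
Qed.

Lemma gen_coefE t g (a : 'X_{1..N}) : complete w0 N t -> g \in gens w0 N t ->
  gen_coef w0 N g a = cf (pathF g.1) g.2.1 g.2.2 a.
Proof.
move=> ct /(gensP _ ct)[i [x [xi gx _]]]; have [hv _] := tree_good xi; rewrite -gx in hv.
rewrite /gen_coef pcoef_at; apply/eqP; rewrite -subr_eq0 -serB; apply/eqP.
apply: (valid_approx hv (leqnn (bound g.1 (g.2.1 + g.2.2).+1))); rewrite ?ltnS ?leq_addr ?leq_addl //.
by rewrite sumnE.
Qed.

End TreeCorrect.

Section Programs.
Variable K : fieldType.

(** This program and the one for coefficients search for the same least complete [t], so their
    answers refer to the same list of generators. *)
Lemma size_program : exists p, forall (w : world K) (d : nat * nat) t,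
  complete w d.1 t -> (forall i, (i < t)%N -> ~~ complete w d.1 i) ->
  exec (wrt w) (winp w) p (encode d) (encode (size (gens w d.1 t))).
Proof.
apply: (comp_search (t := fun w (d : nat * nat) t => complete w d.1 t)
  (f := fun w (d : nat * nat) t => size (gens w d.1 t))).
  by apply: (comp_complete (N := fun w (x : nat * nat * nat) => x.1.1)); comp_tac.
apply: comp_size; by apply: (comp_gens (N := fun w (x : nat * nat * nat) => x.1.1)); comp_tac.
Qed.

Lemma coef_program : exists p, forall (w : world K) (d : (nat * nat) * (nat * seq nat)) t,
  complete w d.1.1 t -> (forall i, (i < t)%N -> ~~ complete w d.1.1 i) ->
  exec (wrt w) (winp w) p (encode d)
    (encode (gen_coef w d.1.1 (nth ([::], (0, 0)%N) (gens w d.1.1 t) d.2.1) d.2.2)).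
Proof.
apply: (comp_search (t := fun w (d : (nat * nat) * (nat * seq nat)) t => complete w d.1.1 t)
  (f := fun w (d : (nat * nat) * (nat * seq nat)) t =>
    gen_coef w d.1.1 (nth ([::], (0, 0)%N) (gens w d.1.1 t) d.2.1) d.2.2)).
  by apply: (comp_complete (N := fun w (x : (nat * nat) * (nat * seq nat) * nat) => x.1.1.1)); comp_tac.
apply: (comp_gen_coef (N := fun w (x : (nat * nat) * (nat * seq nat) * nat) => x.1.1.1)
  (g := fun w (x : (nat * nat) * (nat * seq nat) * nat) => nth ([::], (0, 0)%N) (gens w x.1.1.1 x.2) x.1.2.1)
  (a := fun w (x : (nat * nat) * (nat * seq nat) * nat) => x.1.2.2)); comp_tac.
by apply: (comp_gens (N := fun w (x : (nat * nat) * (nat * seq nat) * nat) => x.1.1.1)); comp_tac.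
Qed.

End Programs.

Theorem mainTheorem1 (K : closedFieldType) :
  exists P : algorithm,
  forall (N : nat) (I : idealr (mpser K N)) (F : mpser K (N + 2)),
    let f := ser_special F in
    f != 0 ->
    ideal2 (serX K) (serY K) f ->
    square_free f ->
    ([pchar K] =i pred0 \/ exists2 p, p \in [pchar K] & (ord f < p)%N) ->
  exists ES : idealr (base_ring I),
    [/\ equisingular_mod ES F,
        forall J : idealr (base_ring I), equisingular_mod J F -> {subset ES <= J} &
        forall (gs : seq (mpser K N)) (rt : {poly K} -> K),
          generates gs I -> root_finder rt ->
          exists2 hs : seq (mpser K N),
            returns rt P F gs hs & generates (map (base_proj I) hs) ES].
Proof.
have [pS hS] := size_program K; have [pC hC] := coef_program K.
exists (Algorithm pS pC) => N I F f f0 fsing fsq fch; exists (ES I F); split.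
- exact: ES_equisingular.
- by move=> J; apply: ES_min.
move=> gs rt _ hrt; pose w := World rt (series_input F gs).
have ex := complete_exists f0 fsing fsq fch gs hrt.
case: (ex_minnP ex) => t ct tmin.
have tmin' i : (i < t)%N -> ~~ complete w N i.
  by rewrite ltnNge => h; apply: contra h => /tmin.
exists (gen_series F rt gs t); last first.
  by apply: ES_generates => r; apply: gen_seriesP.
split.
  by have := hS w (N, size gs) t ct tmin'; rewrite -(size_map (fun g => cf (pathF F g.1) g.2.1 g.2.2)).
move=> i a; rewrite size_map => hi.
have gi : nth ([::], (0, 0)%N) (gens w N t) i \in gens w N t by apply: mem_nth.
have := hC w ((N, size gs), (i, a : seq nat)) t ct tmin'.
rewrite [(_, _).1]/= [(_, _).2]/= (gen_coefE f0 fsing fch hrt a ct gi).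
by rewrite (nth_map ([::], (0, 0)%N)).
Qed.
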